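(* Let $A$ be a Lie algebroid over $M$ and let $W(A)=\bigoplus_{p,q}W^{p,q}(A)$ be its Weil algebra, with the vertical differential $d^{\mathrm v}$, the horizontal differential $d^{\mathrm h}$ and the product defined in the context. Then $d^{\mathrm v}:W^{p,q}(A)\to W^{p,q+1}(A)$, $d^{\mathrm h}:W^{p,q}(A)\to W^{p+1,q}(A)$ and the product $W^{p,q}(A)\times W^{p',q'}(A)\to W^{p+p',q+q'}(A)$ are well defined (i.e. the given formulas do produce elements of $W(A)$), $d^{\mathrm v}$ and $d^{\mathrm h}$ are derivations (in the graded sense, with respect to the total degree $p+q$), and $$d^{\mathrm v}d^{\mathrm v}=0,\qquad d^{\mathrm h}d^{\mathrm h}=0,\qquad d^{\mathrm v}d^{\mathrm h}+d^{\mathrm h}d^{\mathrm v}=0.$$ In conclusion, $W(A)$ is a bigraded bidifferential algebra.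
   Context: $A\to M$ has anchor $\rho$ and bracket $[\cdot,\cdot]$ on $\Gamma(A)$. Elements of $\Omega^r(M;S^iA^* )=\Gamma(\Lambda^rT^*M\otimes S^iA^* )$ are viewed as symmetric $C^\infty(M)$-multilinear maps $P:\Gamma(A)^i\to\Omega^r(M)$, or as polynomial functions $P(\alpha)=P(\alpha,\dots,\alpha)$; $\partial_\alpha P(\alpha_0)=iP(\alpha,\alpha_0,\dots,\alpha_0)$. $\Gamma(A)$ acts by $L_\alpha(P)(\beta_1,\dots,\beta_i)=L_{\rho(\alpha)}(P(\beta_1,\dots,\beta_i))-\sum_jP(\beta_1,\dots,[\alpha,\beta_j],\dots,\beta_i)$. An element $c\in W^{p,q}(A)$ is a sequence $c=(c_0,c_1,\dots)$ of antisymmetric $\mathbb R$-multilinear maps $c_i:\Gamma(A)^{p-i}\to\Omega^{q-i}(M;S^iA^* )$ satisfying $$c_i(\alpha_1,\dots,f\alpha_{p-i})=fc_i(\alpha_1,\dots,\alpha_{p-i})-df\wedge\partial_{\alpha_{p-i}}(c_{i+1}(\alpha_1,\dots,\alpha_{p-i-1}))$$ for all $f\in C^\infty(M)$, $\alpha_j\in\Gamma(A)$. Write $c_i(\alpha_1,\dots,\alpha_{p-i}|\alpha)=c_i(\alpha_1,\dots,\alpha_{p-i})(\alpha)\in\Omega(M)$; $c_{-1}=0$. Vertical differential: $$(d^{\mathrm v}c)_k(\alpha_1,\dots,\alpha_{p-k}|\alpha)=(-1)^{p-k}\big(d_{DR}(c_k(\alpha_1,\dots,\alpha_{p-k}|\alpha))+c_{k-1}(\alpha_1,\dots,\alpha_{p-k},\alpha|\alpha)\big).$$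 Horizontal differential: $$(d^{\mathrm h}c)_k(\alpha_1,\dots,\alpha_{p-k+1}|\alpha)=\delta(c_k)(\alpha_1,\dots,\alpha_{p-k+1}|\alpha)+(-1)^{p-k}i_{\rho(\alpha)}c_{k-1}(\alpha_1,\dots,\alpha_{p-k+1}|\alpha),$$ where $\delta$ is the Koszul differential $\delta(c)(\alpha_1,\dots,\alpha_{r+1})=\sum_{i<j}(-1)^{i+j}c([\alpha_i,\alpha_j],\dots,\hat\alpha_i,\dots,\hat\alpha_j,\dots,\alpha_{r+1})+\sum_i(-1)^{i+1}L_{\alpha_i}(c(\alpha_1,\dots,\hat\alpha_i,\dots,\alpha_{r+1}))$. Product of $c\in W^{p,q}(A)$, $c'\in W^{p',q'}(A)$: $(cc')_k(\alpha_1,\dots,\alpha_{p+p'-k}|\alpha)$ is $$\sum_{i+j=k}(-1)^{(q-i)(p'-j)}\sum_\sigma\mathrm{sgn}(\sigma)\,c_i(\alpha_{\sigma(1)},\dots,\alpha_{\sigma(p-i)}|\alpha)\,c'_j(\alpha_{\sigma(p-i+1)},\dots,\alpha_{\sigma(p+p'-k)}|\alpha),$$ with $\sigma$ ranging over $(p-i,p'-j)$-shuffles (in particular the leading term $(cc')_0$ has sign $(-1)^{qp'}$). *)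

(* Defs.v *)
From HB Require Import structures.
From mathcomp Require Import all_boot all_order all_algebra perm.
From mathcomp Require Import ring.
From mathcomp Require Import all_classical all_reals all_analysis.
Set Implicit Arguments.
Unset Strict Implicit.
Unset Printing Implicit Defensive.
Import Order.TTheory GRing.Theory Num.Theory.
Import numFieldNormedType.Exports.
Local Open Scope classical_set_scope.
Local Open Scope ring_scope.

Section SmoothEuclidean.
Variables (R : realType) (n : nat).
Implicit Types (O : set 'rV[R]_n) (f g : 'rV[R]_n -> R).

(* [O] is meant to be open, so that the partial derivatives of [f] at points
   of [O] only depend on the restriction of [f] to [O]. *)
Fixpoint Ck (k : nat) O f : Prop :=
  {in O, continuous f} /\
  if k is k'.+1 then
    forall i : 'I_n, {in O, forall x, derivable f x (delta_mx 0 i)} /\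
                     Ck k' O ('D_(delta_mx 0 i) f)
  else True.

Definition Csmooth O f : Prop := forall k, Ck k O f.

Lemma near_continuous (f g : 'rV[R]_n -> R) x :
  (\near x, f x = g x) -> {for x, continuous f} -> {for x, continuous g}.
Proof.
move=> fg; have fgx := nbhs_singleton fg.
move=> cf; change (g @ x --> g x); rewrite -fgx.
exact: cvg_trans (near_eq_cvg fg) cf.
Qed.

Lemma Ck_ext k O f g : open O -> {in O, f =1 g} -> Ck k O f -> Ck k O g.
Proof.
move=> oO; elim: k f g => [|k IH] f g fg [cf df].
  split=> // x xO; apply: near_continuous (cf x xO).
  by apply: filterS (open_nbhs_nbhs (conj oO (set_mem xO))) => y /mem_set/fg.
have nfg x : x \in O -> \near x, f x = g x.
  by move=> xO; apply: filterS (open_nbhs_nbhs (conj oO (set_mem xO))) => y /mem_set/fg.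
split=> [x xO|i]; first exact: near_continuous (nfg _ xO) (cf x xO).
have [d1 d2] := df i; split=> [x xO|].
  exact: near_eq_derivable (nfg _ xO) (d1 _ xO).
by apply: IH d2 => x xO; apply: near_eq_derive; exact: nfg.
Qed.

Lemma CkW k O f : Ck k.+1 O f -> Ck k O f.
Proof.
elim: k f => [|k IH] f [cf df]; split=> // i.
by have [d1 d2] := df i; split=> //; exact: IH.
Qed.

Lemma Ck_cst k O (a : R) : open O -> Ck k O (fun=> a).
Proof.
move=> oO; elim: k a => [|k IH] a; split=> //.
- by move=> x _; exact: cst_continuous.
- by move=> x _; exact: cst_continuous.
move=> i; split=> [x _|]; first exact: derivable_cst.
by apply: Ck_ext (IH 0) => // x _; rewrite derive_cst.
Qed.

Lemma CkD k O f g : open O -> Ck k O f -> Ck k O g -> Ck k O (f + g).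
Proof.
move=> oO; elim: k f g => [|k IH] f g [cf df] [cg dg].
  by split=> // x xO; apply: continuousD; [exact: cf|exact: cg].
split=> [x xO|i]; first by apply: continuousD; [exact: cf|exact: cg].
have [f1 f2] := df i; have [g1 g2] := dg i; split=> [x xO|].
  by apply: derivableD; [exact: f1|exact: g1].
apply: Ck_ext (IH _ _ f2 g2) => // x xO; rewrite deriveD //.
  exact: f1.
exact: g1.
Qed.

Lemma CkM k O f g : open O -> Ck k O f -> Ck k O g -> Ck k O (f * g).
Proof.
move=> oO; elim: k f g => [|k IH] f g Cf Cg.
  case: Cf Cg => [cf _] [cg _].
  by split=> // x xO; apply: continuousM; [exact: cf|exact: cg].
have [[cf df] [cg dg]] := (Cf, Cg).
split=> [x xO|i]; first by apply: continuousM; [exact: cf|exact: cg].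
have [f1 f2] := df i; have [g1 g2] := dg i; split=> [x xO|].
  by apply: derivableM; [exact: f1|exact: g1].
have h1 := IH _ _ (CkW Cf) g2; have h2 := IH _ _ (CkW Cg) f2.
apply: Ck_ext (CkD oO h1 h2) => // x xO.
rewrite deriveM //; first exact: f1.
exact: g1.
Qed.

End SmoothEuclidean.

Record chart (R : realType) (n : nat) (M : topologicalType) := Chart {
  cdom : set M;
  cmap : M -> 'rV[R]_n;
  cinv : 'rV[R]_n -> M;
  cdom_open : open cdom;
  cim_open : open (cmap @` cdom);
  cmapK : {in cdom, cancel cmap cinv};
  cmap_cont : {in cdom, continuous cmap};
  cinv_cont : {in cmap @` cdom, continuous cinv} }.

Definition compatible (R : realType) n (M : topologicalType)
    (c c' : chart R n M) : Prop :=
  forall j, Csmooth (cmap c @` (cdom c `&` cdom c'))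
                    (fun u => cmap c' (cinv c u) 0 j).

Record manifold (R : realType) (n : nat) := Manifold {
  carrier :> topologicalType;
  atlas : set (chart R n carrier);
  atlas_cover : forall x, exists2 c, atlas c & cdom c x;
  atlas_compatible : forall c c', atlas c -> atlas c' -> compatible c c';
  carrier_hausdorff : hausdorff_space carrier;
  carrier_second_countable : @second_countable carrier }.

Section SmoothFunctions.
Variables (R : realType) (n : nat) (M : manifold R n).

Definition smooth_on (W : set M) (f : M -> R) : Prop :=
  forall c, atlas c -> Csmooth (cmap c @` (cdom c `&` W)) (f \o cinv c).

Lemma cim_openI (c : chart R n M) (W : set M) :
  open W -> open (cmap c @` (cdom c `&` W)).
Proof.
move=> oW; rewrite openE => _ [x [cx Wx] <-].
have cxi : (cmap c @` cdom c) (cmap c x) by exists x.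
have n1 : nbhs (cmap c x) (cmap c @` cdom c).
  by apply: open_nbhs_nbhs; split=> //; exact: cim_open.
have oV : open (cdom c `&` W) by apply: openI => //; exact: cdom_open.
have n2 : nbhs (cmap c x) (cinv c @^-1` (cdom c `&` W)).
  apply: (cinv_cont (mem_set cxi)); apply: open_nbhs_nbhs; split=> //.
  by rewrite (cmapK (mem_set cx)).
apply: filterS (filterI n1 n2) => _ [[y cy <-]].
by rewrite /= (cmapK (mem_set cy)) => -[_ Wy]; exists y.
Qed.

Lemma smooth_on_ext W f g : open W -> {in W, f =1 g} ->
  smooth_on W f -> smooth_on W g.
Proof.
move=> oW fg sf c ac k; apply: Ck_ext (sf c ac k); first exact: cim_openI.
move=> u /set_mem[x [cx Wx] <-] /=; rewrite (cmapK (mem_set cx)).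
by rewrite fg// mem_set.
Qed.

Lemma smooth_on_cst W a : open W -> smooth_on W (cst a).
Proof. by move=> oW c ac k; apply: Ck_cst; exact: cim_openI. Qed.

Lemma smooth_onD W f g : open W ->
  smooth_on W f -> smooth_on W g -> smooth_on W (f + g).
Proof.
by move=> oW sf sg c ac k; apply: CkD; [exact: cim_openI|exact: sf|exact: sg].
Qed.

Lemma smooth_onM W f g : open W ->
  smooth_on W f -> smooth_on W g -> smooth_on W (f * g).
Proof.
by move=> oW sf sg c ac k; apply: CkM; [exact: cim_openI|exact: sf|exact: sg].
Qed.

Lemma smooth_onS W W' f : open W -> open W' -> W' `<=` W ->
  smooth_on W f -> smooth_on W' f.
Proof.
move=> oW oW' WW' sf c ac k; have := sf c ac k.
have sub : cmap c @` (cdom c `&` W') `<=` cmap c @` (cdom c `&` W).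
  by apply: image_subset; exact: setIS.
elim: k (f \o cinv c) => [|k IH] g [cg dg]; split=> //.
- by move=> x /set_mem/sub/mem_set/cg.
- by move=> x /set_mem/sub/mem_set/cg.
move=> i; have [d1 d2] := dg i; split; last exact: IH.
by move=> x /set_mem/sub/mem_set/d1.
Qed.

Definition cinf_pred : {pred M -> R} := mem [set f | smooth_on setT f].

Lemma cinf_subring_closed : subring_closed cinf_pred.
Proof.
split=> [|f g|f g]; rewrite !inE.
- by apply: smooth_on_cst; exact: openT.
- move=> sf sg; apply: smooth_onD => //; first exact: openT.
  have -> : - g = cst (-1) * g.
    by apply/funext => x; rewrite [RHS]mulN1r.
  apply: smooth_onM => //; first exact: openT.
  by apply: smooth_on_cst; exact: openT.
- by move=> sf sg; apply: smooth_onM => //; exact: openT.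
Qed.

HB.instance Definition _ :=
  GRing.isSubringClosed.Build _ cinf_pred cinf_subring_closed.

(* [Cinf] is the ring of smooth functions on [M]; it is only a [comPzRingType]
   because [M] may be empty. *)
Record Cinf := MkCinf { cval :> M -> R; _ : cval \in cinf_pred }.
HB.instance Definition _ := [isSub of Cinf for cval].
HB.instance Definition _ := [Choice of Cinf by <:].
HB.instance Definition _ :=
  GRing.SubChoice_isSubComPzRing.Build _ _ Cinf (subringClosedP _).

Lemma cinf_cst_subproof (a : R) : cst a \in cinf_pred.
Proof. by rewrite inE; apply: smooth_on_cst; exact: openT. Qed.
Definition cinf_cst (a : R) : Cinf := MkCinf (cinf_cst_subproof a).

End SmoothFunctions.

Section Sections.
Variables (R : realType) (n : nat) (M : manifold R n).

(* All, not necessarily smooth, sections of a family of vector spaces. *)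
Definition rough_section (E : M -> lmodType R) := forall x, E x.

Section RoughModule.
Variable E : M -> lmodType R.
Local Notation S := (rough_section E).
Implicit Types (s t u : S) (f g : Cinf M).

HB.instance Definition _ := gen_eqMixin S.
HB.instance Definition _ := gen_choiceMixin S.

Let add s t : S := fun x => s x + t x.
Let opp s : S := fun x => - s x.
Let zero : S := fun x => 0.
Let scale f s : S := fun x => f x *: s x.

Let addA : associative add.
Proof. by move=> s t u; apply: functional_extensionality_dep => x; exact: addrA. Qed.
Let addC : commutative add.
Proof. by move=> s t; apply: functional_extensionality_dep => x; exact: addrC. Qed.
Let add0 : left_id zero add.
Proof. by move=> s; apply: functional_extensionality_dep => x; exact: add0r. Qed.
Let addN : left_inverse zero opp add.
Proof. by move=> s; apply: functional_extensionality_dep => x; exact: addNr. Qed.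
HB.instance Definition _ := GRing.isZmodule.Build S addA addC add0 addN.

Let scaleA f g s : scale f (scale g s) = scale (f * g) s.
Proof. by apply: functional_extensionality_dep => x; exact: scalerA. Qed.
Let scale1 : left_id 1 scale.
Proof. by move=> s; apply: functional_extensionality_dep => x; exact: scale1r. Qed.
Let scaleDr : right_distributive scale +%R.
Proof. by move=> f s t; apply: functional_extensionality_dep => x; exact: scalerDr. Qed.
Let scaleDl s : {morph scale^~ s : f g / f + g}.
Proof. by move=> f g; apply: functional_extensionality_dep => x; exact: scalerDl. Qed.
HB.instance Definition _ :=
  GRing.Zmodule_isLmodule.Build (Cinf M) S scaleA scale1 scaleDr scaleDl.

End RoughModule.

(* The tangent space at [x] is the space of derivations at [x] of the ring of
   smooth functions. *)
Definition pointder (x : M) : {pred Cinf M -> R^o} := mem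
  [set v : Cinf M -> R^o |
    (forall a f g, v (cinf_cst M a * f + g) = a * v f + v g) /\
    (forall f g, v (f * g) = f x * v g + g x * v f)].

Lemma pointder_submod_closed x : submod_closed (pointder x).
Proof.
split=> [|a v w]; rewrite !inE.
  by split=> *; rewrite /= !mulr0 ?addr0.
move=> [v1 v2] [w1 w2]; split=> [b f g|f g].
  have E h : (a *: v + w) h = a * v h + w h by [].
  rewrite !E v1 w1; ring.
have E h : (a *: v + w) h = a * v h + w h by [].
rewrite !E v2 w2; ring.
Qed.

HB.instance Definition _ (x : M) :=
  GRing.isSubmodClosed.Build _ _ (pointder x) (pointder_submod_closed x).

Record tangent (x : M) :=
  MkTangent { tval :> Cinf M -> R^o; _ : tval \in pointder x }.
HB.instance Definition _ x := [isSub of tangent x for @tval x].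
HB.instance Definition _ x := [Choice of tangent x by <:].
HB.instance Definition _ x := [SubChoice_isSubLmodule of tangent x by <:].

Definition TM : M -> lmodType R := tangent.

Definition along (X : rough_section TM) (f : Cinf M) : M -> R :=
  fun x => (X x : tangent x) f.

Definition vfield_pred : {pred rough_section TM} :=
  mem [set X | forall f, along X f \in cinf_pred (M := M)].

Lemma vfield_submod_closed : submod_closed vfield_pred.
Proof.
split=> [|f X Y]; rewrite !inE.
  move=> g; have -> : along 0 g = \val (0 : Cinf M) by [].
  exact: valP.
move=> hX hY g.
have -> : along (f *: X + Y) g = \val (f * MkCinf (hX g) + MkCinf (hY g)) by [].
exact: valP.
Qed.

HB.instance Definition _ :=
  GRing.isSubmodClosed.Build _ _ vfield_pred vfield_submod_closed.

Record vfield := MkVfield { vfval :> rough_section TM; _ : vfval \in vfield_pred }.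
HB.instance Definition _ := [isSub of vfield for vfval].
HB.instance Definition _ := [Choice of vfield by <:].
HB.instance Definition _ := [SubChoice_isSubLmodule of vfield by <:].

Lemma along_smooth (X : vfield) (f : Cinf M) : along X f \in cinf_pred (M := M).
Proof. by have /set_mem := valP X; apply. Qed.

Definition lie_fun (X : vfield) (f : Cinf M) : Cinf M :=
  MkCinf (along_smooth X f).

Definition vbracket_at (X Y : vfield) (x : M) (f : Cinf M) : R^o :=
  (vfval X x : tangent x) (lie_fun Y f) - (vfval Y x : tangent x) (lie_fun X f).

Lemma tangentD x (v : tangent x) f g : v (f + g) = v f + v g.
Proof.
have /set_mem[vl _] := valP v; have := vl 1 f g.
have -> : cinf_cst M 1 = 1 by apply/val_inj.
by rewrite !mul1r.
Qed.

Lemma tangentM x (v : tangent x) f g : v (f * g) = f x * v g + g x * v f.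
Proof. by have /set_mem[_ vm] := valP v; exact: vm. Qed.

Lemma tangent_cst x (v : tangent x) a : v (cinf_cst M a) = 0.
Proof.
have h : v 1 = 0.
  have e := tangentM v 1 1; apply: (addrI (v 1)); rewrite addr0 -[RHS]/(v 1).
  by rewrite -[in RHS](mulr1 1) e !mul1r.
have h0 : v 0 = 0.
  by apply: (addrI (v 0)); rewrite -tangentD !addr0.
have vl : v (cinf_cst M a * 1 + 0) = a * v 1 + v 0.
  by have /set_mem[+ _] := valP v; apply.
by move: vl; rewrite addr0 mulr1 h h0 mulr0 addr0.
Qed.

Lemma lie_funD X f g : lie_fun X (f + g) = lie_fun X f + lie_fun X g.
Proof. by apply/val_inj/funext => x; exact: tangentD. Qed.

Lemma lie_funM X f g : lie_fun X (f * g) = f * lie_fun X g + g * lie_fun X f.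
Proof. by apply/val_inj/funext => x; exact: tangentM. Qed.

Lemma lie_fun_cst X a : lie_fun X (cinf_cst M a) = 0.
Proof. by apply/val_inj/funext => x; exact: tangent_cst. Qed.

Lemma vbracket_at_der X Y x : vbracket_at X Y x \in pointder x.
Proof.
rewrite inE; split=> [a f g|f g]; rewrite /vbracket_at.
  rewrite !lie_funD !lie_funM !lie_fun_cst !mulr0 !addr0.
  rewrite !tangentD !tangentM !tangent_cst !mulr0 !addr0 /=; ring.
rewrite !lie_funM !tangentD !tangentM /= /along; ring.
Qed.

Lemma vbracket_smooth X Y :
  (fun x => MkTangent (vbracket_at_der X Y x)) \in vfield_pred.
Proof.
rewrite inE => f.
exact: (valP (lie_fun X (lie_fun Y f) - lie_fun Y (lie_fun X f))).
Qed.

Definition vbracket (X Y : vfield) : vfield := MkVfield (vbracket_smooth X Y).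

(* A vector bundle is given by its fibres and by a smoothly compatible family
   of local trivializations; these determine the manifold structure of the
   total space. *)
Record trivialization (E : M -> lmodType R) (r : nat) := Trivialization {
  tdom : set M;
  tmap : forall x, {linear E x -> 'rV[R]_r};
  tdom_open : open tdom;
  tmap_bij : forall x, tdom x -> bijective (tmap x) }.

Record vbundle := Vbundle {
  fibre :> M -> lmodType R;
  vrank : nat;
  trivs : set (trivialization fibre vrank);
  trivs_cover : forall x, exists2 t, trivs t & tdom t x;
  trivs_compatible : forall t t', trivs t -> trivs t' ->
    exists2 g : M -> 'M[R]_vrank,
      forall i j, smooth_on (tdom t `&` tdom t') (fun x => g x i j) &
      forall x a, tdom t x -> tdom t' x -> tmap t' x a = tmap t x a *m g x }.

Section SmoothSections.
Variable E : vbundle.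

Definition gsec_pred : {pred rough_section E} :=
  mem [set s | forall t, trivs t ->
    forall j, smooth_on (tdom t) (fun x => tmap t x (s x) 0 j)].

Lemma gsec_submod_closed : submod_closed gsec_pred.
Proof.
split=> [|f s u]; rewrite !inE.
  move=> t tt j; apply: smooth_on_ext (smooth_on_cst 0 (tdom_open t)).
    exact: tdom_open.
  by move=> x _; rewrite linear0 mxE.
move=> hs hu t tt j; have oW := tdom_open t.
have sf : smooth_on (tdom t) f.
  by apply: (smooth_onS openT oW) => //; have /set_mem := valP f.
apply: smooth_on_ext (smooth_onD oW (smooth_onM oW sf (hs t tt j)) (hu t tt j)).
  exact: oW.
by move=> x _; rewrite [X in tmap t x X](_ : _ = f x *: s x + u x) // linearP !mxE.
Qed.

HB.instance Definition _ :=
  GRing.isSubmodClosed.Build _ _ gsec_pred gsec_submod_closed.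

Record gsec := MkGsec { gsval :> rough_section E; _ : gsval \in gsec_pred }.
HB.instance Definition _ := [isSub of gsec for gsval].
HB.instance Definition _ := [Choice of gsec by <:].
HB.instance Definition _ := [SubChoice_isSubLmodule of gsec by <:].

(* Fibrewise linear maps [E -> TM]; smoothness amounts to preserving
   smoothness of sections. *)
Definition push (rho : forall x, {linear E x -> TM x}) (s : gsec) :
  rough_section TM := fun x => rho x (gsval s x).

Definition smooth_anchor (rho : forall x, {linear E x -> TM x}) : Prop :=
  forall s, push rho s \in vfield_pred.

Definition push_field rho (rho_smooth : smooth_anchor rho) (s : gsec) : vfield :=
  MkVfield (rho_smooth s).

End SmoothSections.

Record lie_algebroid := LieAlgebroid {
  lbundle :> vbundle;
  anchor_map : forall x, {linear lbundle x -> TM x};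
  anchor_smooth : smooth_anchor anchor_map;
  lbracket : gsec lbundle -> gsec lbundle -> gsec lbundle;
  lbracket_linear : forall (k : R) a b c,
    lbracket a (cinf_cst M k *: b + c)
      = cinf_cst M k *: lbracket a b + lbracket a c;
  lbracket_antisym : forall a b, lbracket a b = - lbracket b a;
  lbracket_jacobi : forall a b c,
    lbracket a (lbracket b c) + lbracket b (lbracket c a)
      + lbracket c (lbracket a b) = 0;
  lbracket_leibniz : forall a f b,
    lbracket a (f *: b)
      = f *: lbracket a b + lie_fun (push_field anchor_smooth a) f *: b;
  (* A consequence of the other axioms, usually part of the definition. *)
  anchor_bracket : forall a b,
    push_field anchor_smooth (lbracket a b)
      = vbracket (push_field anchor_smooth a) (push_field anchor_smooth b) }.

Definition anchor (A : lie_algebroid) (a : gsec A) : vfield :=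
  push_field (@anchor_smooth A) a.

End Sections.

(* A map of [k] variables in [T] is encoded as a function on [seq T] vanishing
   on the sequences of length different from [k]. *)

Section Multilinear.

Definition permute (T : Type) (s : seq T) (sigma : 'S_(size s)) : seq T :=
  [seq tnth (in_tuple s) (sigma i) | i <- enum 'I_(size s)].
#[global] Arguments permute {T} s sigma.

Definition symmetric_map (T V : Type) (F : seq T -> V) : Prop :=
  forall s sigma, F (permute s sigma) = F s.

Definition antisymmetric_map (T : Type) (V : zmodType) (F : seq T -> V) : Prop :=
  forall s sigma, F (permute s sigma) = F s *~ (-1) ^+ sigma.

(* Additivity and homogeneity in each variable, for scalars ranging over the
   image of [phi]. *)
Definition multilinear (S : Type) (K : pzRingType) (phi : S -> K)
    (T V : lmodType K) (F : seq T -> V) : Prop :=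
  forall s1 s2 k x y, F (s1 ++ (phi k *: x + y) :: s2)
    = phi k *: F (s1 ++ x :: s2) + F (s1 ++ y :: s2).

Definition is_shuffle (a m : nat) (sigma : 'S_m) : bool :=
  [forall i : 'I_m, forall j : 'I_m,
    (i < j)%N && ((j < a)%N || (a <= i)%N) ==> (sigma i < sigma j)%N].

(* The signed sum over the (a, size s - a)-shuffles. *)
Definition shuffle_sum (T : Type) (V : zmodType) (a : nat)
    (F : seq T -> seq T -> V) (s : seq T) : V :=
  \sum_(sigma : 'S_(size s) | is_shuffle a sigma)
    F (take a (permute s sigma)) (drop a (permute s sigma)) *~ (-1) ^+ sigma.

Definition omit (T : Type) (i : nat) (s : seq T) : seq T :=
  take i s ++ drop i.+1 s.

(* The indices below start from 0: the signs (-1)^(i+1) of the formulas with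
   indices starting from 1 become (-1)^i. *)
Definition koszul (T : Type) (V : zmodType) (br : T -> T -> T)
    (act : T -> V -> V) (c : seq T -> V) (s : seq T) : V :=
  \sum_(i < size s) \sum_(j < size s | (i < j)%N)
      c (br (tnth (in_tuple s) i) (tnth (in_tuple s) j) :: omit i (omit j s))
        *~ (-1) ^+ (i + j)
  + \sum_(i < size s) act (tnth (in_tuple s) i) (c (omit i s)) *~ (-1) ^+ i.

Definition lie_der (T : Type) (V : zmodType) (br : T -> T -> T)
    (act : T -> V -> V) (x : T) (F : seq T -> V) (s : seq T) : V :=
  act x (F s)
  - \sum_(j < size s) F (set_nth x s j (br x (tnth (in_tuple s) j))).

End Multilinear.

Lemma scale_sub_comb (K : comPzRingType) (V : lmodType K) (f g : K) (x y u v : V) :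
  f *: (g *: x - y) + (g *: u - v) = g *: (f *: x + u) - (f *: y + v).
Proof.
by rewrite scalerBr scalerDr !scalerA [f * _]mulrC addrACA -opprD.
Qed.

Lemma scale_add_comb (K : comPzRingType) (V : lmodType K) (f g : K) (x y u v : V) :
  f *: (g *: x + y) + (g *: u + v) = g *: (f *: x + u) + (f *: y + v).
Proof. by rewrite !scalerDr !scalerA [f * _]mulrC addrACA. Qed.

Section Forms.
Variables (R : realType) (n : nat) (M : manifold R n).
Local Notation C := (Cinf M).

(* Differential forms are viewed as antisymmetric maps, multilinear over the
   smooth functions, from vector fields to smooth functions. *)
Definition Omega := seq (vfield M) -> C^o.

HB.instance Definition _ := GRing.Lmodule.on Omega.

Definition is_form (r : nat) (w : Omega) : Prop :=
  [/\ forall xs, size xs <> r -> w xs = 0,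
      antisymmetric_map w & multilinear id w].

Definition form0 (f : C) : Omega := fun xs => if nilp xs then f else 0.

Definition dDR (w : Omega) : Omega :=
  koszul (@vbracket R n M) (@lie_fun R n M) w.

Definition lie_form (X : vfield M) (w : Omega) : Omega :=
  lie_der (@vbracket R n M) (@lie_fun R n M) X w.

Definition contract (X : vfield M) (w : Omega) : Omega := fun xs => w (X :: xs).

(* [r] is the degree of [w]. *)
Definition wedge (r : nat) (w w' : Omega) : Omega :=
  shuffle_sum r (fun xs ys => (w xs : C) * (w' ys : C)).

Lemma wedge_linearr r (w u v : Omega) (f : C) :
  wedge r w (f *: u + v) = f *: wedge r w u + wedge r w v.
Proof.
apply/funext => xs.
have E (u' v' : Omega) ys : (f *: u' + v') ys = f * (u' ys : C) + (v' ys : C) by [].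
rewrite E /wedge /shuffle_sum mulr_sumr -big_split /=.
apply: eq_bigr => sigma _; rewrite E.
by rewrite mulrDr mulrCA mulrzDl mulrzAr.
Qed.

End Forms.
Arguments Omega {R n} M.

Section Weil.
Variables (R : realType) (n : nat) (M : manifold R n) (A : lie_algebroid M).
Local Notation C := (Cinf M).
Local Notation Gamma := (gsec A).

Definition OmegaS := seq Gamma -> Omega M.

HB.instance Definition _ := GRing.Lmodule.on OmegaS.

(* [is_formS r i P]: [P] is an r-form on [M] with values in the i-th symmetric
   power of the dual of [A]. *)
Definition is_formS (r i : nat) (P : OmegaS) : Prop :=
  [/\ forall bs, size bs <> i -> P bs = 0,
      forall bs, is_form r (P bs),
      symmetric_map P & multilinear id P].

Definition lie_formS (a : Gamma) (P : OmegaS) : OmegaS :=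
  lie_der (@lbracket R n M A) (fun b => lie_form (anchor b)) a P.

Definition wedgeS (r : nat) (w : Omega M) (P : OmegaS) : OmegaS :=
  fun bs => wedge r w (P bs).

Lemma wedgeS_linear r w (f : C) (P Q : OmegaS) :
  wedgeS r w (f *: P + Q) = f *: wedgeS r w P + wedgeS r w Q.
Proof.
have E (P' Q' : OmegaS) t : (f *: P' + Q') t = f *: P' t + Q' t by [].
by apply/funext => bs; rewrite E /wedgeS E wedge_linearr.
Qed.

(* The polarized derivative: for [P] of degree [i],
   [partialS a P (nseq i.-1 b)] is i P(a, b, ..., b). *)
Definition partialS (a : Gamma) (P : OmegaS) : OmegaS :=
  fun bs => P (a :: bs) *+ (size bs).+1.

Lemma partialS_linear a (f : C) (P Q : OmegaS) :
  partialS a (f *: P + Q) = f *: partialS a P + partialS a Q.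
Proof.
have E (P' Q' : OmegaS) t : (f *: P' + Q') t = f *: P' t + Q' t by [].
by apply/funext => bs; rewrite E /partialS E mulrnDl scalerMnr.
Qed.

Lemma wedgeS0 r w : wedgeS r w (0 : OmegaS) = 0.
Proof. by have := wedgeS_linear r w (-1) 0 0; rewrite !scaleN1r !addNr. Qed.

Lemma partialS0 a : partialS a (0 : OmegaS) = 0.
Proof. by have := partialS_linear a (-1) 0 0; rewrite !scaleN1r !addNr. Qed.

(* [c i as bs xs] is c_i(as)(bs), evaluated on the vector fields [xs]. *)
Definition cochain := nat -> seq Gamma -> OmegaS.

HB.instance Definition _ := GRing.Lmodule.on cochain.

(* Components c_i with i > p, and form degrees q - i < 0, are zero. *)
Definition is_weil (p q : nat) (c : cochain) : Prop :=
  forall i,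
  [/\ forall as_, (size as_ + i)%N <> p -> c i as_ = 0,
      antisymmetric_map (c i),
      multilinear (cinf_cst M) (c i),
      forall as_, if (i <= q)%N then is_formS (q - i) i (c i as_)
                  else c i as_ = 0
    & forall as_ f a, c i (rcons as_ (f *: a))
        = f *: c i (rcons as_ a)
          - wedgeS 1 (dDR (form0 f)) (partialS a (c i.+1 as_))].

Definition weil_pred (p q : nat) : {pred cochain} := mem [set c | is_weil p q c].

Lemma weil_submod_closed p q : submod_closed (weil_pred p q).
Proof.
split=> [|f c c' /set_mem hc /set_mem hc']; apply/mem_set => i.
  split=> // [s sigma|s1 s2 k x y|as_|as_ g a].
  - by rewrite mul0rz.
  - by rewrite scaler0 addr0.
  - case: ifP => // _; split=> // [bs|s1 s2 k x y].
      split=> // [s sigma|s1 s2 k x y]; first by rewrite mul0rz.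
      by rewrite scaler0 addr0.
    by rewrite scaler0 addr0.
  - by rewrite partialS0 wedgeS0 scaler0 subr0.
have [h1 h2 h3 h4 h5] := hc i; have [h1' h2' h3' h4' h5'] := hc' i.
split=> [as_ e|s sigma|s1 s2 k x y|as_|as_ g a].
- by rewrite [LHS](_ : _ = f *: c i as_ + c' i as_) // h1 // h1' // scaler0 addr0.
- have E t : (f *: c + c') i t = f *: c i t + c' i t by [].
  by rewrite !E h2 h2' mulrzDl scalerMzr.
- have E t : (f *: c + c') i t = f *: c i t + c' i t by [].
  by rewrite !E h3 h3' scale_add_comb.
- have E : (f *: c + c') i as_ = f *: c i as_ + c' i as_ by [].
  rewrite E; have := h4 as_; have := h4' as_; case: ifP => _.
    move=> [a1 a2 a3 a4] [b1 b2 b3 b4]; split=> [bs e|bs|s sigma|s1 s2 k x y].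
    + by rewrite [LHS](_ : _ = f *: c i as_ bs + c' i as_ bs) // a1 // b1 // scaler0 addr0.
    + have [u1 u2 u3] := a2 bs; have [v1 v2 v3] := b2 bs.
      have E2 t : (f *: c i as_ + c' i as_) bs t = f *: c i as_ bs t + c' i as_ bs t by [].
      split=> [xs e|s sigma|s1 s2 k x y].
      * by rewrite E2 u1 // v1 // scaler0 addr0.
      * by rewrite !E2 u2 v2 mulrzDl scalerMzr.
      * by rewrite !E2 u3 v3 scale_add_comb.
    + by rewrite [LHS](_ : _ = f *: c i as_ (permute s sigma)
                            + c' i as_ (permute s sigma)) // a3 b3.
    + have E2 t : (f *: c i as_ + c' i as_) t = f *: c i as_ t + c' i as_ t by [].
      by rewrite !E2 a4 b4 scale_add_comb.
  by move=> -> ->; rewrite scaler0 addr0.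
have E j t : (f *: c + c') j t = f *: c j t + c' j t by [].
by rewrite E h5 h5' scale_sub_comb -wedgeS_linear -partialS_linear.
Qed.

HB.instance Definition _ (p q : nat) :=
  GRing.isSubmodClosed.Build _ _ (weil_pred p q) (weil_submod_closed p q).

(* [W p q] is the component of bidegree (p, q) of the Weil algebra of [A]. *)
Record W (p q : nat) := MkW { wval : cochain; _ : wval \in weil_pred p q }.
HB.instance Definition _ p q := [isSub of W p q for @wval p q].
HB.instance Definition _ p q := [Choice of W p q by <:].
HB.instance Definition _ p q := [SubChoice_isSubLmodule of W p q by <:].

(* c_k(as | a), the value of the polynomial function c_k(as) at [a]. *)
Definition ev (c : cochain) (k : nat) (as_ : seq Gamma) (a : Gamma) : Omega M :=
  c k as_ (nseq k a).

(* c_(k-1)(as | a), with c_(-1) = 0. *)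
Definition ev_pred (c : cochain) (k : nat) (as_ : seq Gamma) (a : Gamma) :
  Omega M := if k is k'.+1 then ev c k' as_ a else 0.

Definition deltaS (c : seq Gamma -> OmegaS) : seq Gamma -> OmegaS :=
  koszul (@lbracket R n M A) lie_formS c.

Definition is_dv p q (c : W p q) (d : W p q.+1) : Prop :=
  forall k as_ a, (size as_ + k)%N = p ->
    ev (wval d) k as_ a
      = (dDR (ev (wval c) k as_ a) + ev_pred (wval c) k (rcons as_ a) a) *~ (-1) ^+ (p - k).

(* The sign is (-1)^(p-k); [p + k] has the parity of p - k, also for k = p + 1. *)
Definition is_dh p q (c : W p q) (d : W p.+1 q) : Prop :=
  forall k as_ a, (size as_ + k)%N = p.+1 ->
    ev (wval d) k as_ a
      = deltaS (wval c k) as_ (nseq k a)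
        + contract (anchor a) (ev_pred (wval c) k as_ a) *~ (-1) ^+ (p + k).

(* For i > q or j > p', where the subtraction in the sign is truncated, the
   corresponding term is zero. *)
Definition is_mul p q p' q' (c : W p q) (c' : W p' q')
    (d : W (p + p') (q + q')) : Prop :=
  forall k as_ a, (size as_ + k)%N = (p + p')%N ->
    ev (wval d) k as_ a
      = \sum_(i < k.+1)
          shuffle_sum (p - i) (fun us vs =>
            wedge (q - i) (ev (wval c) i us a) (ev (wval c') (k - i) vs a)) as_
          *~ (-1) ^+ ((q - i) * (p' - (k - i))).

(* Elements of different components W p q, which may be indexed by equal but
   not convertible bidegrees, are compared as cochains. *)
Record bidifferential_bigraded_algebra
    (dv : forall p q, W p q -> W p q.+1)
    (dh : forall p q, W p q -> W p.+1 q)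
    (mul : forall p q p' q', W p q -> W p' q' -> W (p + p') (q + q')) : Prop := {
  mul_linearl : forall p q p' q' k (c1 c2 : W p q) (c' : W p' q'),
    mul p q p' q' (cinf_cst M k *: c1 + c2) c'
      = cinf_cst M k *: mul p q p' q' c1 c' + mul p q p' q' c2 c';
  mul_linearr : forall p q p' q' k (c : W p q) (c1 c2 : W p' q'),
    mul p q p' q' c (cinf_cst M k *: c1 + c2)
      = cinf_cst M k *: mul p q p' q' c c1 + mul p q p' q' c c2;
  mul_assoc : forall p q p' q' p'' q'' (c : W p q) (c' : W p' q') (c'' : W p'' q''),
    wval (mul _ _ _ _ c (mul _ _ _ _ c' c''))
      = wval (mul _ _ _ _ (mul _ _ _ _ c c') c'');
  mul_unit : exists e : W 0 0, forall p q (c : W p q),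
    wval (mul _ _ _ _ e c) = wval c /\ wval (mul _ _ _ _ c e) = wval c;
  dv_linear : forall p q k (c1 c2 : W p q),
    dv p q (cinf_cst M k *: c1 + c2) = cinf_cst M k *: dv p q c1 + dv p q c2;
  dh_linear : forall p q k (c1 c2 : W p q),
    dh p q (cinf_cst M k *: c1 + c2) = cinf_cst M k *: dh p q c1 + dh p q c2;
  dv_derivation : forall p q p' q' (c : W p q) (c' : W p' q'),
    wval (dv _ _ (mul _ _ _ _ c c'))
      = wval (mul _ _ _ _ (dv _ _ c) c')
        + wval (mul _ _ _ _ c (dv _ _ c')) *~ (-1) ^+ (p + q);
  dh_derivation : forall p q p' q' (c : W p q) (c' : W p' q'),
    wval (dh _ _ (mul _ _ _ _ c c'))
      = wval (mul _ _ _ _ (dh _ _ c) c')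
        + wval (mul _ _ _ _ c (dh _ _ c')) *~ (-1) ^+ (p + q);
  dv_dv : forall p q (c : W p q), dv _ _ (dv _ _ c) = 0;
  dh_dh : forall p q (c : W p q), dh _ _ (dh _ _ c) = 0;
  dv_dh : forall p q (c : W p q), dv _ _ (dh _ _ c) + dh _ _ (dv _ _ c) = 0 }.

End Weil.

(* Main.v *)
Require Import Defs.
From HB Require Import structures.
From mathcomp Require Import all_boot all_algebra perm.
From mathcomp Require Import ring.
From mathcomp Require Import all_classical all_reals all_analysis.

(** A cochain c of W^{p,q}(A) is encoded by one single function, c^: it is
    defined on words in three kinds of letters, Al a and Be a for a section a
    of A and Xi x for a vector field x, and its value on a word
    Al a1 ... Al am Be b1 ... Be bk Xi x1 ... Xi xr is
    k! c_k(a1, ..., am)(b1, ..., bk)(x1, ..., xr).  Give the letters Al and Xi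
    the odd parity and the letters Be the even one: the antisymmetry in the
    a's and x's and the symmetry in the b's become a single graded symmetry,
    and c^ is a function on a graded vector space.  Evaluation of the first
    letter t of a word is a contraction i_t, and the product of such functions
    is the one for which each i_t is a superderivation.

    The value of c^ on a word is reached by contracting its letters one by one,
    so an operator D is determined by its effect on constants and by its
    supercommutators with the contractions, and it is a superderivation as soon
    as these supercommutators are (superder_der).  The two differentials are the
    odd superderivations that kill constants and satisfy

      [i_Al(a), d^v] = 0,       [i_Be(b), d^v] = i_Al(b),   [i_Xi(x), d^v] = L_x,
      [i_Al(a), d^h] = L_a,     [i_Be(b), d^h] = K_b,       [i_Xi(x), d^h] = N_x,

    where L_x and L_a are Lie derivatives, and K_b, N_x are again
    superderivations with simple commutators.  That these formulas are the ones
    of the theorem is Cartan's formula: the Koszul differential and the sums over shuffles are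
      determined
    by the same recursions on the first argument (koszul_cons,
    shuffle_sum_cons).

    In this language the algebra is short.  The product is associative because
    associativity holds on the empty word and is inherited by contractions.
    The identities d^v d^v = 0, d^h d^h = 0 and d^v d^h + d^h d^v = 0 are proved
    by contracting letters in turn: the contraction of each side of an
    identity is the same identity for a contracted function, up to an
    identity between the commutators above, such as [L_a, d^v] = 0,
    [L_a, d^h] = 0 or [d^v, K_b] = - L_b.  The defining condition of W(A) reads

      i_Al(f a) = f i_Al(a) - (d^v f) i_Be(a)

    together with linearity of i_Be and i_Xi over functions (weilfn).  It
    holds for a product because the contractions are superderivations
    (weilfn_smul), and it survives d^v and d^h because these are superderivations
    and can be applied to it (weilfn_vdiff, weilfn_hdiff); for d^h it amounts to
    the behaviour of L_(f a), which is lieA_scale.  All this uses only that sections and vector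
      fields are
    Lie-Rinehart algebras connected by the anchor.

    The formulas of the theorem only prescribe values on words whose
    letters Be are all equal.  These determine the function by polarization
    (polar), so that each formula is equivalent to the corresponding equation
    between functions on words (is_dvP, is_dhP, is_mulP), and c is recovered
    from c^ after division by k!. *)
Set Implicit Arguments.
Unset Strict Implicit.
Unset Printing Implicit Defensive.
Import GRing.Theory.
Local Open Scope ring_scope.

Definition signed (V : zmodType) (b : bool) (x : V) : V := if b then - x else x.

(** * Superfunctions on words *)
Section SuperAlgebra.
Variables (C : comPzRingType) (T : Type) (par : T -> bool).
Local Notation fn := (seq T -> C).
Implicit Types (F G H : fn) (s : seq T) (t : T) (e : bool).

Definition spar s := foldr (fun t b => par t (+) b) false s.

(** The contraction by a letter. *)
Definition pd t F : fn := fun s => F (t :: s).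

(** For e true, the parity automorphism, which supplies the Koszul sign when an
    odd operator passes over F. *)
Definition twist e F : fn := fun s => signed (e && spar s) (F s).

(** The recursion says that each contraction is a superderivation, see [pd_smul];
    unfolding it gives the signed sum over all ways to distribute the letters
    of the word over the two factors. *)
Fixpoint smul_rec s F G : C :=
  if s is t :: s' then smul_rec s' (pd t F) G + smul_rec s' (twist (par t) F) (pd t G)
  else F [::] * G [::].
Definition smul F G : fn := fun s => smul_rec s F G.

Definition sconst (f : C) : fn := fun s => if nilp s then f else 0.

Lemma signed_signed (V : zmodType) a b (x : V) : signed a (signed b x) = signed (a (+) b) x.
Proof. by case: a; case: b; rewrite /= ?opprK. Qed.
Lemma signedD (V : zmodType) a (x y : V) : signed a (x + y) = signed a x + signed a y.
Proof. by case: a; rewrite /= ?opprD. Qed.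
Lemma signed0 (V : zmodType) a : signed a (0 : V) = 0.
Proof. by case: a; rewrite /= ?oppr0. Qed.
Lemma signedN (V : zmodType) a (x : V) : signed a (- x) = - signed a x.
Proof. by case: a. Qed.

Lemma fnP F G : F =1 G -> F = G.
Proof. exact: funext. Qed.

Lemma fn_cons F t s : F (t :: s) = pd t F s. Proof. by []. Qed.

Lemma pd_smul t F G :
  pd t (smul F G) = smul (pd t F) G + smul (twist (par t) F) (pd t G).
Proof. by []. Qed.

Lemma pdD t F G : pd t (F + G) = pd t F + pd t G. Proof. by []. Qed.
Lemma pdN t F : pd t (- F) = - pd t F. Proof. by []. Qed.
Lemma pd0 t : pd t 0 = 0. Proof. by []. Qed.
Lemma pd_cst t f : pd t (sconst f) = 0. Proof. by []. Qed.

Lemma fnD F G s : (F + G) s = F s + G s. Proof. by []. Qed.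
Lemma fnN F s : (- F) s = - F s. Proof. by []. Qed.
Lemma fn0 s : (0 : fn) s = 0. Proof. by []. Qed.
Definition fnE := (fnD, fnN, fn0).

Lemma signed_fn b F s : (signed b F) s = signed b (F s).
Proof. by case: b. Qed.
Lemma twistD e F G : twist e (F + G) = twist e F + twist e G.
Proof. by apply/fnP => s; rewrite fnE /twist fnE /signed; case: ifP; rewrite ?opprD. Qed.
Lemma twistN e F : twist e (- F) = - twist e F.
Proof. by apply/fnP => s; rewrite fnE /twist fnE /signed; case: ifP. Qed.
Lemma twist0 e : twist e 0 = 0.
Proof. by apply/fnP => s; rewrite /twist fnE /signed; case: ifP; rewrite ?oppr0. Qed.
Lemma twistT e e' F : twist e (twist e' F) = twist (e (+) e') F.
Proof.
apply/fnP => s; rewrite /twist /signed.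
by case: e; case: e'; case: (spar s); rewrite /= ?opprK.
Qed.

Lemma pd_twist t e F : pd t (twist e F) = signed (e && par t) (twist e (pd t F)).
Proof.
apply/fnP => s; rewrite signed_fn /pd /twist /= signed_signed.
by case: e; case: (par t); case: (spar s).
Qed.

Lemma smulDl F G H : smul (F + G) H = smul F H + smul G H.
Proof.
apply/fnP => s; rewrite fnE /smul; elim: s F G H => [|t s IH] F G H /=.
  by rewrite fnE mulrDl.
by rewrite pdD twistD !IH; ring.
Qed.
Lemma smulDr F G H : smul F (G + H) = smul F G + smul F H.
Proof.
apply/fnP => s; rewrite fnE /smul; elim: s F G H => [|t s IH] F G H /=.
  by rewrite fnE mulrDr.
by rewrite pdD !IH; ring.
Qed.
Lemma smul0l F : smul 0 F = 0.
Proof. by apply: (addrI (smul 0 F)); rewrite -smulDl !addr0. Qed.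
Lemma smul0r F : smul F 0 = 0.
Proof. by apply: (addrI (smul F 0)); rewrite -smulDr !addr0. Qed.
Lemma smulNl F G : smul (- F) G = - smul F G.
Proof. by apply: (addrI (smul F G)); rewrite -smulDl !subrr smul0l. Qed.
Lemma smulNr F G : smul F (- G) = - smul F G.
Proof. by apply: (addrI (smul F G)); rewrite -smulDr !subrr smul0r. Qed.
Lemma smul_signedl b F G : smul (signed b F) G = signed b (smul F G).
Proof. by case: b => //; exact: smulNl. Qed.
Lemma smul_signedr b F G : smul F (signed b G) = signed b (smul F G).
Proof. by case: b => //; exact: smulNr. Qed.

Lemma twist_smul e F G : twist e (smul F G) = smul (twist e F) (twist e G).
Proof.
case: e => //; apply/fnP => s; elim: s F G => [|t s IH] F G //.
rewrite (fn_cons (twist _ _)) (fn_cons (smul _ _)) pd_twist !pd_smul !pd_twist !fnE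
  !smul_signedl !smul_signedr !twistT addbC -twistT.
have E : twist true (smul (pd t F) G + smul (twist (par t) F) (pd t G)) s =
  smul (twist true (pd t F)) (twist true G) s + smul (twist true (twist (par t) F)) (twist true
    (pd t G)) s.
  by rewrite twistD fnE !IH.
by case: (par t) E => /= E; rewrite /= ?fnE ?E ?opprD.
Qed.

(** On a nonempty word, the Leibniz rule of contractions reduces the identity to
    the same one for contracted factors; graded commutativity below has the
    same proof. *)
Lemma smulA F G H : smul F (smul G H) = smul (smul F G) H.
Proof.
apply/fnP => s; elim: s F G H => [|t s IH] F G H.
  by rewrite /smul /= mulrA.
by rewrite !(fn_cons (smul _ _)) !pd_smul !smulDr !smulDl !fnE !twist_smul !IH addrA.
Qed.

Lemma twist_cst e f : twist e (sconst f) = sconst f.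
Proof.
apply/fnP => -[|u r]; rewrite /twist.
  by rewrite andbF.
by rewrite [sconst f _]/(0:C) signed0.
Qed.

Lemma smul_cstl f F s : smul (sconst f) F s = f * F s.
Proof.
elim: s F => [|t s IH] F //.
rewrite (fn_cons (smul _ _)) pd_smul pd_cst smul0l add0r.
by rewrite twist_cst IH.
Qed.

Lemma smul_cstr f F s : smul F (sconst f) s = f * F s.
Proof.
elim: s F => [|t s IH] F; first by rewrite /smul /= mulrC.
by rewrite (fn_cons (smul _ _)) pd_smul pd_cst smul0r addr0 IH.
Qed.

Lemma smul1l F : smul (sconst 1) F = F.
Proof. by apply/fnP => s; rewrite smul_cstl mul1r. Qed.
Lemma smul1r F : smul F (sconst 1) = F.
Proof. by apply/fnP => s; rewrite smul_cstr mul1r. Qed.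
Lemma smul_cstC f F : smul F (sconst f) = smul (sconst f) F.
Proof. by apply/fnP => s; rewrite smul_cstr smul_cstl. Qed.

Definition parity e F := twist true F = signed e F.

Lemma parity_pd t e F : parity e F -> parity (e (+) par t) (pd t F).
Proof.
rewrite /parity => h; have E : twist true (pd t F) = signed (par t) (pd t (twist true F)).
  by rewrite pd_twist signed_signed addbb.
rewrite E h; have -> : pd t (signed e F) = signed e (pd t F) by case: (e).
by rewrite signed_signed addbC.
Qed.

Lemma parity_twist e e' F : parity e F -> twist e' F = signed (e && e') F.
Proof. by case: e' => h; rewrite ?andbT ?andbF. Qed.

Lemma smul_comm e P F : parity e P -> smul F P = smul P (twist e F).
Proof.
move=> hP; apply/fnP => s; elim: s e P F hP => [|t s IH] e P F hP.
  by rewrite /smul /= mulrC /twist andbF.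
rewrite !(fn_cons (smul _ _)) !pd_smul !fnE.
rewrite (IH _ _ _ hP) (IH _ _ _ (parity_pd t hP)) pd_twist smul_signedr.
rewrite (parity_twist _ hP) smul_signedl addrC twistT.
have -> : e (+) par t (+) par t = e by case: (e); case: (par t).
by congr (_ + _); case: (e && par t); rewrite /= ?fnE ?opprK.
Qed.

(** The boolean is the parity of the operator. *)
Record superder e (D : fn -> fn) : Prop := {
  superderD : forall F G, D (F + G) = D F + D G;
  superder_twist : forall F, D (twist true F) = signed e (twist true (D F));
  superderM : forall F G, D (smul F G) = smul (D F) G + smul (twist e F) (D G) }.

Lemma superder0 e D : superder e D -> D 0 = 0.
Proof. by move=> h; apply: (addrI (D 0)); rewrite -(superderD h) !addr0. Qed.
Lemma superderN e D F : superder e D -> D (- F) = - D F.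
Proof. by move=> h; apply: (addrI (D F)); rewrite -(superderD h) !subrr (superder0 h). Qed.
Lemma superder_signed e D b F : superder e D -> D (signed b F) = signed b (D F).
Proof. by case: b => //; exact: superderN. Qed.
Lemma superder_pd t : superder (par t) (pd t).
Proof. by split=> // F; rewrite pd_twist. Qed.

Lemma superder_zero e : superder e (fun=> 0).
Proof.
split=> [F G|F|F G]; first by rewrite addr0.
  by rewrite twist0; case: e; rewrite /= ?oppr0.
by rewrite smul0l smul0r addr0.
Qed.

Lemma superder_add e D D' : superder e D -> superder e D' -> superder e (fun F => D F + D' F).
Proof.
move=> h h'; split=> [F G|F|F G].
- by rewrite (superderD h) (superderD h') addrACA.
- by rewrite (superder_twist h) (superder_twist h') twistD; case: e {h h'} => /=; rewrite ?opprD.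
- by rewrite (superderM h) (superderM h') smulDl smulDr addrACA.
Qed.

Lemma superder_opp e D : superder e D -> superder e (fun F => - D F).
Proof.
move=> h; split=> [F G|F|F G].
- by rewrite (superderD h) opprD.
- by rewrite (superder_twist h) twistN; case: e {h} => /=; rewrite ?opprK.
- by rewrite (superderM h) smulNl smulNr opprD.
Qed.

(** Operators given by recursion on words only read words in the letters that
    their commutators produce; this is used to compute on words lacking some
    kinds of letters, where the operators simplify. *)
Definition agree_on (P : pred T) F G := forall s, all P s -> F s = G s.

Lemma agree_on_smul P F F' G G' :
  agree_on P F F' -> agree_on P G G' -> agree_on P (smul F G) (smul F' G').
Proof.
move=> hF hG s; elim: s F F' G G' hF hG => [|t s IH] F F' G G' hF hG.
  by move=> _; rewrite /smul /= hF // hG.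
move=> /andP[Pt Ps]; rewrite !(fn_cons (smul _ _)) !pd_smul !fnE.
congr (_ + _); apply: IH => // r Pr; rewrite /pd ?hF ?hG //=; rewrite ?Pt //.
by rewrite /twist hF.
Qed.

(** R t u w expresses that t is the sum of u and w. *)
Variable R : T -> T -> T -> Prop.
Hypothesis R_par : forall t u w, R t u w -> par t = par u /\ par t = par w.

(** Adjacent transpositions suffice, and spare the sign of a graded permutation. *)
Definition supersym F := forall s1 t u s2,
  F (s1 ++ [:: t, u & s2]) = signed (par t && par u) (F (s1 ++ [:: u, t & s2])).
Definition letter_add F := forall s1 s2 t u w, R t u w ->
  F (s1 ++ t :: s2) = F (s1 ++ u :: s2) + F (s1 ++ w :: s2).
Definition sform F := supersym F /\ letter_add F.

Lemma sform_pdC t u F : sform F ->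
  pd u (pd t F) = signed (par t && par u) (pd t (pd u F)).
Proof. by case=> h _; apply/fnP => s; rewrite signed_fn; exact: (h [::]). Qed.

Lemma sform_pdD t u w F : R t u w -> sform F -> pd t F = pd u F + pd w F.
Proof. by move=> r [_ h]; apply/fnP => s; exact: (h [::] _ _ _ _ r). Qed.

Lemma sform_pd t F : sform F -> sform (pd t F).
Proof.
case=> h1 h2; split=> [s1 x y s2|s1 s2 x y z r]; first exact: (h1 (t :: s1)).
exact: (h2 (t :: s1)).
Qed.

Lemma sformD F G : sform F -> sform G -> sform (F + G).
Proof.
move=> [f1 f2] [g1 g2]; split=> [s1 x y s2|s1 s2 x y z r]; rewrite !fnE.
  by rewrite f1 g1 signedD.
by rewrite (f2 _ _ _ _ _ r) (g2 _ _ _ _ _ r) addrACA.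
Qed.

Lemma sformN F : sform F -> sform (- F).
Proof.
move=> [f1 f2]; split=> [s1 x y s2|s1 s2 x y z r]; rewrite !fnE.
  by rewrite f1; case: (par x && _).
by rewrite (f2 _ _ _ _ _ r) opprD.
Qed.

Lemma sform0 : sform 0.
Proof.
by split=> [s1 x y s2|s1 s2 x y z r]; rewrite !fnE ?signed0 ?addr0.
Qed.

Lemma sform_cst f : sform (sconst f).
Proof.
by split=> [[|a s1] x y s2|[|a s1] s2 x y z r]; rewrite /sconst /= ?signed0 ?addr0.
Qed.

Lemma spar_cat s1 s2 : spar (s1 ++ s2) = spar s1 (+) spar s2.
Proof. by elim: s1 => //= t s1 ->; rewrite addbA. Qed.

Lemma sform_twist e F : sform F -> sform (twist e F).
Proof.
case: e => //; move=> [f1 f2]; split=> [s1 x y s2|s1 s2 x y z r]; rewrite /twist.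
  rewrite f1 !spar_cat /= (addbCA (par y)).
  by rewrite !signed_signed addbC.
rewrite !spar_cat /= (f2 _ _ _ _ _ r) signedD.
by have [-> ->] := R_par r.
Qed.

Lemma sform_smul F G : sform F -> sform G -> sform (smul F G).
Proof.
move=> hF hG; split=> [s1 t u s2|s1 s2 t u w r].
  elim: s1 F G hF hG => [|a s1 IH] F G hF hG; last first.
    rewrite !cat_cons !(fn_cons (smul F G)).
    by rewrite pd_smul !fnE signedD !IH //; do ?[exact: sform_pd | exact: sform_twist].
  rewrite !cat0s !(fn_cons (smul F G)) !(fn_cons (pd _ _)).
  rewrite !pd_smul !pdD !pd_smul !pd_twist !(sform_pdC t u) // !smul_signedl !smul_signedr.
  rewrite !twistT; case: (par t) (par u) => -[]; rewrite /= ?fnE; ring.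
elim: s1 F G hF hG => [|a s1 IH] F G hF hG; last first.
  rewrite !cat_cons !(fn_cons (smul F G)) !pd_smul !fnE.
  by rewrite !IH 1?addrACA //; do ?[exact: sform_pd | exact: sform_twist].
rewrite !cat0s !(fn_cons (smul F G)) !pd_smul.
have [<- <-] := R_par r.
by rewrite !(sform_pdD r) // smulDl smulDr !fnE addrACA.
Qed.

Variables (V : zmodType) (wt : T -> V).
Definition wts s := foldr (fun t v => wt t + v) 0 s.
Definition supp v F := forall s, wts s <> v -> F s = 0.

Lemma supp_pd t v F : supp v F -> supp (v - wt t) (pd t F).
Proof.
by move=> h s hs; apply: h => /= e; apply: hs; rewrite -e addrC addKr.
Qed.
Lemma suppD v F G : supp v F -> supp v G -> supp v (F + G).
Proof. by move=> hF hG s hs; rewrite fnE hF // hG // addr0. Qed.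
Lemma suppN v F : supp v F -> supp v (- F).
Proof. by move=> hF s hs; rewrite fnE hF // oppr0. Qed.
Lemma supp0 v : supp v 0. Proof. by []. Qed.
Lemma supp_twist b v F : supp v F -> supp v (twist b F).
Proof. by move=> hF s hs; rewrite /twist hF // signed0. Qed.
Lemma supp_cst f : supp 0 (sconst f).
Proof. by case. Qed.
Lemma supp_smul v w F G : supp v F -> supp w G -> supp (v + w) (smul F G).
Proof.
move=> hF hG s; elim: s v w F G hF hG => [|t s IH] v w F G hF hG hs.
  rewrite /smul /=; have [v0|/eqP v0] := eqVneq v 0; last first.
    by rewrite hF ?mul0r // => v00; apply: v0.
  rewrite hG ?mulr0 // => w0; apply: hs; by rewrite -w0 v0 addr0.
rewrite (fn_cons (smul _ _)) pd_smul fnE.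
rewrite (IH (v - wt t) w) ?(IH v (w - wt t)) ?addr0 //.
- exact: supp_twist.
- exact: supp_pd.
- by move=> e; apply: hs; rewrite /= e addrCA [wt t + _]addrC subrK.
- exact: supp_pd.
- by move=> e; apply: hs; rewrite /= e addrA [wt t + _]addrC subrK.
Qed.

(** * Superderivations defined by their commutators with contractions *)
Fixpoint der_rec (e : bool) (phi : C -> C) (K : T -> fn -> fn) s F : C :=
  if s is t :: s' then signed (e && par t) (der_rec e phi K s' (pd t F)) + K t F s'
  else phi (F [::]).
(** The operator of parity e that is phi on constants and whose supercommutator
    with the contraction by t is K t, see [pd_der]. *)
Definition der e phi K F : fn := fun s => der_rec e phi K s F.

Lemma pd_der e phi K t F :
  pd t (der e phi K F) = signed (e && par t) (der e phi K (pd t F)) + K t F.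
Proof. by apply/fnP => s; rewrite /pd /der /= fnE; case: (e && _). Qed.

Lemma agree_on_der (P : pred T) (e : bool) phi K F G :
  (forall t F G, P t -> agree_on P F G -> agree_on P (K t F) (K t G)) ->
  agree_on P F G -> agree_on P (der e phi K F) (der e phi K G).
Proof.
move=> hK hFG s; elim: s F G hFG => [|t s IH] F G hFG.
  by rewrite /der /= hFG.
move=> /andP[Pt Ps]; rewrite !(fn_cons (der _ _ _ _)) !pd_der !fnE !signed_fn.
rewrite (IH _ (pd t G)) // ?(hK _ _ _ Pt hFG) // => r Pr.
by rewrite /pd hFG //= Pt.
Qed.

Variables (e : bool) (phi : C -> C) (K : T -> fn -> fn).
Local Notation dr := (der e phi K).

Hypothesis phiD : {morph phi : f g / f + g}.
Hypothesis phiM : forall f g, phi (f * g) = phi f * g + f * phi g.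
Hypothesis phi_parity : e -> forall f, phi f = 0.
Hypothesis K_superder : forall t, superder (e (+) par t) (K t).

(** The three properties hold on the empty word; on a longer word, contract
    the first letter and use that its commutator with the operator is a
    superderivation. *)
Lemma superder_der : superder e dr.
Proof.
have dD F G : dr (F + G) = dr F + dr G.
  apply/fnP => s; rewrite fnE /der; elim: s F G => [|t s IH] F G /=.
    by rewrite fnE phiD.
  rewrite pdD !IH (superderD (K_superder t)) fnE.
  by case: (e && _) => /=; ring.
have d0 : dr 0 = 0 by apply: (addrI (dr 0)); rewrite -dD !addr0.
have dN F : dr (- F) = - dr F.
  by apply: (addrI (dr F)); rewrite -dD !subrr.
have ds b F : dr (signed b F) = signed b (dr F) by case: b => //; exact: dN.
have dtw F : dr (twist true F) = signed e (twist true (dr F)).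
  apply/fnP => s; elim: s F => [|t s IH] F.
    rewrite signed_fn /der /= /twist /=; case: (e) phi_parity => //= h.
    by rewrite h // oppr0.
  rewrite (fn_cons (dr _)) (fn_cons (signed _ _)).
  have -> : pd t (signed e (twist true (dr F))) = signed e (pd t (twist true (dr F))).
    by case: (e).
  rewrite pd_twist !pd_der (superder_twist (K_superder t)) pd_twist ds fnE twistD.
  case: (e) (par t) IH => -[] /= IH; rewrite ?fnE ?IH ?twistN ?fnE; ring.
split=> // F G; apply/fnP => s; elim: s F G => [|t s IH] F G.
  rewrite /der /smul /= fnE /= phiM.
  by rewrite /twist andbF.
rewrite (fn_cons (dr _)) (fn_cons (_ + _)).
rewrite pdD !pd_smul !pd_der pd_twist (superderM (K_superder t)) dD !fnE twistT.
have dtwt : dr (twist (par t) F) = signed (e && par t) (twist (par t) (dr F)).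
  by case: (par t); rewrite ?andbT ?andbF.
have E1 := IH (pd t F) G; have E2 := IH (twist (par t) F) (pd t G).
rewrite twistT dtwt in E2.
rewrite !smulDl !smulDr !smul_signedl !smul_signedr !fnE (addbC (par t) e).
move: E1 E2; rewrite !smul_signedl !fnE.
by case: (e) (par t) => -[] /= E1 E2; rewrite !fnE E1 E2 ?fnE; ring.
Qed.

Lemma der_cst f : (forall t, K t (sconst f) = 0) -> dr (sconst f) = sconst (phi f).
Proof.
move=> hK; apply/fnP => -[|t s] //.
by rewrite (fn_cons (dr _)) pd_der pd_cst (superder0 superder_der) hK signed0 addr0.
Qed.

(** The first two letters can be exchanged when the K t satisfy the relation
    obtained by contracting [der] by t and u in both orders. *)
Lemma sform_der :
  (forall t F, sform F -> sform (K t F)) ->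
  (forall t u F, sform F ->
     signed (e && par t) (K u (pd t F)) + pd u (K t F)
     = signed (par t && par u) (signed (e && par u) (K t (pd u F)) + pd t (K u F))) ->
  (forall t u w F, R t u w -> sform F -> K t F = K u F + K w F) ->
  forall F, sform F -> sform (dr F).
Proof.
move=> Kgood Ksym Kadd F hF; split=> [s1 t u s2|s1 s2 t u w r].
  elim: s1 F hF => [|a s1 IH] F hF; last first.
    rewrite !cat_cons !(fn_cons (dr F)) pd_der !fnE !signed_fn.
    rewrite IH; last exact: sform_pd.
    have [-> _] := Kgood a F hF.
    by rewrite signedD !signed_signed addbC.
  rewrite !cat0s !(fn_cons (dr F)) !(fn_cons (pd _ _)).
  rewrite !pd_der !pdD.
  have E b x G : pd x (signed b G) = signed b (pd x G) by case: b.
  rewrite !E !pd_der !signedD -!addrA Ksym // (sform_pdC t u) //.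
  rewrite (superder_signed _ _ superder_der) !signed_signed !signedD !fnE !signed_fn !signed_signed.
  by case: (par t) (par u) => -[] //; case: (e) => //.
elim: s1 F hF => [|a s1 IH] F hF; last first.
  rewrite !cat_cons !(fn_cons (dr F)) pd_der !fnE !signed_fn.
  rewrite IH; last exact: sform_pd.
  have [_ h] := Kgood a F hF.
  by rewrite (h _ _ _ _ _ r) signedD addrACA.
rewrite !cat0s !(fn_cons (dr F)) !pd_der.
have [<- <-] := R_par r.
rewrite (sform_pdD r) // (Kadd _ _ _ _ r) // (superderD superder_der) signedD.
by rewrite !fnE addrACA.
Qed.

(** A shift by d of the weights can only be nonzero when constants are killed. *)
Lemma supp_der d :
  (forall t v F, supp v F -> supp (v + d - wt t) (K t F)) ->
  phi =1 (fun=> 0) \/ d = 0 ->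
  forall v F, supp v F -> supp (v + d) (dr F).
Proof.
move=> hK hphi v F hF s; elim: s v F hF => [|t s IH] v F hF hs.
  rewrite /der /=; case: hphi => [-> //|d0].
  rewrite hF; first by apply: (addrI (phi 0)); rewrite -phiD !addr0.
  by move=> v0; apply: hs; rewrite d0 addr0.
rewrite (fn_cons (dr _)) pd_der fnE signed_fn (IH (v - wt t)).
- rewrite signed0 add0r (hK t v) // => E; apply: hs => /=.
  by rewrite E addrC subrK.
- exact: supp_pd.
- by move=> E; apply: hs; rewrite /= E addrA [wt t + _]addrC subrK.
Qed.

End SuperAlgebra.

Arguments smul : simpl never.

(** * Lie-Rinehart algebras *)
Record lie_rinehart (C : comPzRingType) (L : lmodType C) := LieRinehart {
  act : L -> C -> C;
  brk : L -> L -> L;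
  actD : forall x, {morph act x : f g / f + g};
  actM : forall x f g, act x (f * g) = act x f * g + f * act x g;
  actDl : forall x y f, act (x + y) f = act x f + act y f;
  actZl : forall f x g, act (f *: x) g = f * act x g;
  brkD : forall x, {morph brk x : y z / y + z};
  brkC : forall x y, brk x y = - brk y x;
  brkJ : forall x y z, brk (brk x y) z = brk x (brk y z) - brk y (brk x z);
  brkZ : forall x f y, brk x (f *: y) = f *: brk x y + act x f *: y;
  act_brk : forall x y f, act (brk x y) f = act x (act y f) - act y (act x f) }.

Record anchored (C : comPzRingType) (L X : lmodType C)
    (LL : lie_rinehart L) (LX : lie_rinehart X) (rho : L -> X) : Prop := {
  anchD : {morph rho : a b / a + b};
  anchZ : forall f a, rho (f *: a) = f *: rho a;
  anch_act : forall a f, act LL a f = act LX (rho a) f;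
  anch_brk : forall a b, rho (brk LL a b) = brk LX (rho a) (rho b) }.

Section LieRinehartTheory.
Variables (C : comPzRingType) (L : lmodType C) (S : lie_rinehart L).

Lemma brkDl x y z : brk S (x + y) z = brk S x z + brk S y z.
Proof. by rewrite brkC brkD opprD -!(brkC S _ z). Qed.
Lemma brkZl x f y : brk S (f *: x) y = f *: brk S x y - act S y f *: x.
Proof. by rewrite brkC brkZ opprD -scalerN -brkC. Qed.
Lemma act0 x : act S x 0 = 0.
Proof. by apply: (addrI (act S x 0)); rewrite -actD !addr0. Qed.

End LieRinehartTheory.

(** * Superfunctions of a Lie algebroid *)
Section WeilModel.
Variables (C : comPzRingType) (G X : lmodType C).
Variables (LG : lie_rinehart G) (LX : lie_rinehart X) (rho : G -> X).
Hypothesis rhoP : anchored LG LX rho.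

(** [Al] stands for the arguments of the antisymmetric maps c_i, [Be] for those of
    the symmetric powers of the dual of A, [Xi] for those of differential forms. *)
Inductive letter := Al of G | Be of G | Xi of X.

Definition par t := if t is Be _ then false else true.

Inductive splits : letter -> letter -> letter -> Prop :=
| splitsA a b : splits (Al (a + b)) (Al a) (Al b)
| splitsB a b : splits (Be (a + b)) (Be a) (Be b)
| splitsX x y : splits (Xi (x + y)) (Xi x) (Xi y).

Lemma splits_par t u w : splits t u w -> par t = par u /\ par t = par w.
Proof. by case. Qed.

Definition wt t : int * int :=
  match t with Al _ => (1, 0) | Be _ => (1, 1) | Xi _ => (0, 1) end.

Local Notation fn := (seq letter -> C).
Local Notation twist := (twist par).
Local Notation smul := (smul par).
Local Notation "F ** H" := (smul F H) (at level 40, left associativity).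
Local Notation superder := (superder par).
Local Notation sform := (sform par splits).
Local Notation supp := (supp wt).
Local Notation der := (der par).
Implicit Types (F H : fn).

Lemma pdC t u F : sform F -> pd u (pd t F) = signed (par t && par u) (pd t (pd u F)).
Proof. exact: sform_pdC. Qed.

Lemma sform_zero t0 F : sform F -> splits t0 t0 t0 -> pd t0 F = 0.
Proof. by move=> g r; apply: (addrI (pd t0 F)); rewrite -(sform_pdD r g) addr0. Qed.
Lemma sform_Al0 F : sform F -> pd (Al 0) F = 0.
Proof. by move=> g; apply: sform_zero => //; have := splitsA 0 0; rewrite addr0. Qed.
Lemma sform_Be0 F : sform F -> pd (Be 0) F = 0.
Proof. by move=> g; apply: sform_zero => //; have := splitsB 0 0; rewrite addr0. Qed.
Lemma sform_Xi0 F : sform F -> pd (Xi 0) F = 0.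
Proof. by move=> g; apply: sform_zero => //; have := splitsX 0 0; rewrite addr0. Qed.
Lemma sform_AlD a b F : sform F -> pd (Al (a + b)) F = pd (Al a) F + pd (Al b) F.
Proof. exact: sform_pdD (splitsA a b). Qed.
Lemma sform_BeD a b F : sform F -> pd (Be (a + b)) F = pd (Be a) F + pd (Be b) F.
Proof. exact: sform_pdD (splitsB a b). Qed.
Lemma sform_XiD a b F : sform F -> pd (Xi (a + b)) F = pd (Xi a) F + pd (Xi b) F.
Proof. exact: sform_pdD (splitsX a b). Qed.
Lemma sform_AlN a F : sform F -> pd (Al (- a)) F = - pd (Al a) F.
Proof. by move=> g; apply: (addrI (pd (Al a) F)); rewrite -sform_AlD // !subrr sform_Al0. Qed.
Lemma sform_BeN a F : sform F -> pd (Be (- a)) F = - pd (Be a) F.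
Proof. by move=> g; apply: (addrI (pd (Be a) F)); rewrite -sform_BeD // !subrr sform_Be0. Qed.
Lemma sform_XiN a F : sform F -> pd (Xi (- a)) F = - pd (Xi a) F.
Proof. by move=> g; apply: (addrI (pd (Xi a) F)); rewrite -sform_XiD // !subrr sform_Xi0. Qed.

(** Graded symmetry lets the letters of a word be sorted by kind, so that
    identities can be checked by treating the three kinds in turn. *)
Definition nword (as_ bs : seq G) (xs : seq X) : seq letter :=
  map Al as_ ++ map Be bs ++ map Xi xs.
Definition als := pmap (fun t => if t is Al a then Some a else None).
Definition bes := pmap (fun t => if t is Be b then Some b else None).
Definition xis := pmap (fun t => if t is Xi x then Some x else None).
(** The sign of sorting: the parity of the number of pairs of a [Xi] preceding
    an [Al]. *)
Fixpoint xinv s : bool :=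
  if s is t :: s' then (if t is Xi _ then odd (size (als s')) else false) (+) xinv s'
  else false.

Lemma sform_move F t s1 s2 : sform F ->
  F (t :: s1 ++ s2) = signed (par t && spar par s1) (F (s1 ++ t :: s2)).
Proof.
elim: s1 F => [|u s1 IH] F gF /=; first by rewrite andbF.
rewrite -[LHS]/(pd u (pd t F) (s1 ++ s2)) pdC // signed_fn.
rewrite -[pd t (pd u F) _]/(pd u F (t :: s1 ++ s2)) IH; last exact: sform_pd.
by rewrite signed_signed -andb_addr.
Qed.

Lemma spar_Al as_ : spar par (map Al as_) = odd (size as_).
Proof. by elim: as_ => //= a as_ ->. Qed.
Lemma spar_Be bs : spar par (map Be bs) = false.
Proof. by elim: bs. Qed.
Lemma spar_Xi xs : spar par (map Xi xs) = odd (size xs).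
Proof. by elim: xs => //= a xs ->. Qed.

Lemma sform_sort F s : sform F -> F s = signed (xinv s) (F (nword (als s) (bes s) (xis s))).
Proof.
elim: s F => [|t s IH] F gF //.
rewrite [LHS](IH (pd t F)); last exact: sform_pd.
rewrite /pd; case: t => [a|b|x] /=; first by [].
  by rewrite /nword /= sform_move // andFb.
rewrite /nword /= catA sform_move // signed_signed spar_cat spar_Al spar_Be.
by rewrite addbF andTb addbC -catA.
Qed.

Lemma sform_ext F H : sform F -> sform H ->
  (forall as_ bs xs, F (nword as_ bs xs) = H (nword as_ bs xs)) -> F = H.
Proof.
by move=> gF gH h; apply/fnP => s; rewrite (sform_sort s gF) (sform_sort s gH) h.
Qed.

Definition nal t := if t is Al _ then false else true.
Definition isX t := if t is Xi _ then true else false.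
Definition alfree s := all nal s.
Definition xionly s := all isX s.
Lemma alfree_nword bs xs : alfree (map Be bs ++ map Xi xs).
Proof. by rewrite /alfree all_cat !all_map /=; apply/andP; split; exact/all_predT. Qed.
Lemma xionly_map xs : xionly (map Xi xs).
Proof. by rewrite /xionly all_map; exact/all_predT. Qed.

(** * Lie derivatives *)
Definition lact (x : X) (g : G -> G) t :=
  match t with Al a => Al (g a) | Be b => Be (g b) | Xi y => Xi (brk LX x y) end.
(** The Lie derivative along x of functions and vector fields, combined with an
    arbitrary infinitesimal action g on sections.  Both Lie derivatives
    that occur in the differentials are instances. *)
Definition lieop x g := der false (act LX x) (fun t F => - pd (lact x g t) F).

Lemma par_lact x g t : par (lact x g t) = par t. Proof. by case: t. Qed.

Lemma superder_lieop x g : superder false (lieop x g).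
Proof.
apply: superder_der => //; first exact: actD.
  exact: actM.
by move=> t; rewrite addFb -(par_lact x g); apply: superder_opp; exact: superder_pd.
Qed.

Lemma pd_lieop x g t F : pd t (lieop x g F) = lieop x g (pd t F) - pd (lact x g t) F.
Proof. by rewrite /lieop pd_der. Qed.

Lemma sform_lieop x g F : {morph g : a b / a + b} -> sform F -> sform (lieop x g F).
Proof.
move=> gD; move: F; apply: sform_der => //.
- exact: splits_par.
- exact: actD.
- exact: actM.
- by move=> t; rewrite addFb -(par_lact x g); apply: superder_opp; exact: superder_pd.
- by move=> t F gF; apply: sformN; exact: sform_pd.
- move=> t u F gF /=; rewrite !pdN (pdC t) // par_lact.
  rewrite (pdC _ u) // par_lact; apply/fnP => s.
  by rewrite signed_fn !fnE !signed_fn !signedD !signedN addrC.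
move=> t u w F [a b|a b|a b] gF /=; rewrite ?gD ?brkD.
- by rewrite sform_AlD // opprD.
- by rewrite sform_BeD // opprD.
- by rewrite sform_XiD // opprD.
Qed.

Lemma supp_lieop x g v F : supp v F -> supp v (lieop x g F).
Proof.
move=> hF; rewrite -[v]addr0; move: v F hF; apply: supp_der => //.
- exact: actD.
- move=> t v F hF; apply: suppN; rewrite addr0.
  have -> : wt t = wt (lact x g t) by case: t.
  exact: supp_pd.
- by right.
Qed.

Lemma lieop_cst x g f : lieop x g (sconst f) = sconst (act LX x f).
Proof.
apply: der_cst => //; [exact: actD|exact: actM|..].
  by move=> t; rewrite addFb -(par_lact x g); apply: superder_opp; exact: superder_pd.
by move=> t; rewrite pd_cst oppr0.
Qed.

(** Both sides are even derivations that agree on constants by the compatibility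
    of actions and brackets, and on letters by the Jacobi identity and the choice of k. *)
Lemma lieop_comm x g y h k F : (forall c, k c = g (h c) - h (g c)) -> sform F ->
  lieop x g (lieop y h F) - lieop y h (lieop x g F) = lieop (brk LX x y) k F.
Proof.
move=> kE gF; apply/fnP => s; elim: s F gF => [|t s IH] F gF.
  by rewrite /lieop /der /= fnE act_brk.
rewrite -[LHS]/(pd t (lieop x g (lieop y h F) - lieop y h (lieop x g F)) s).
rewrite (fn_cons (lieop _ _ _)) pdD pdN !pd_lieop.
rewrite !(superderD (superder_lieop _ _)) !(superderN _ (superder_lieop _ _)).
have -> : pd (lact (brk LX x y) k t) F =
    pd (lact x g (lact y h t)) F - pd (lact y h (lact x g t)) F.
  case: t => c /=; rewrite ?kE ?brkJ.
  - by rewrite sform_AlD // sform_AlN.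
  - by rewrite sform_BeD // sform_BeN.
  - by rewrite sform_XiD // sform_XiN.
have := IH (pd t F) (sform_pd t gF); rewrite !fnE => <-; ring.
Qed.

(** The de Rham differential acts only on the form part of a cochain: the Lie
    derivative [lieX] in its Cartan formula ignores the sections of A. *)
Definition zG : G -> G := fun=> 0.
Lemma zGD : {morph zG : a b / a + b}. Proof. by move=> a b; rewrite /zG addr0. Qed.
Definition lieX x := lieop x zG.
Definition lieA a := lieop (rho a) (brk LG a).

Lemma pd_lieX x t F : pd t (lieX x F) = lieX x (pd t F) - pd (lact x zG t) F.
Proof. exact: pd_lieop. Qed.
Lemma pd_lieA a t F : pd t (lieA a F) = lieA a (pd t F) - pd (lact (rho a) (brk LG a) t) F.
Proof. exact: pd_lieop. Qed.

Lemma sform_lieX x F : sform F -> sform (lieX x F).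
Proof. by apply: sform_lieop; exact: zGD. Qed.
Lemma sform_lieA a F : sform F -> sform (lieA a F).
Proof. by apply: sform_lieop; exact: brkD. Qed.

(** * The vertical differential *)
Definition vdiff_letter t F : fn :=
  match t with Al _ => 0 | Be b => pd (Al b) F | Xi x => lieX x F end.
Definition vdiff := der true (fun=> 0) vdiff_letter.

Lemma vdiff_letter_superder t : superder (true (+) par t) (vdiff_letter t).
Proof.
case: t => c /=; first exact: superder_zero.
  exact: (@superder_pd C _ par (Al c)).
exact: superder_lieop.
Qed.

Lemma zeroD : {morph (fun=> 0) : f g / f + g :> C}. Proof. by move=> *; rewrite addr0. Qed.
Lemma zeroM (f g : C) : 0 = 0 * g + f * 0. Proof. by rewrite mul0r mulr0 addr0. Qed.

Lemma superder_vdiff : superder true vdiff.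
Proof. apply: superder_der => //; [exact: zeroD|exact: zeroM|exact: vdiff_letter_superder]. Qed.

Lemma pdA_vdiff a F : pd (Al a) (vdiff F) = - vdiff (pd (Al a) F).
Proof. by rewrite /vdiff pd_der addr0. Qed.
Lemma pdB_vdiff b F : pd (Be b) (vdiff F) = vdiff (pd (Be b) F) + pd (Al b) F.
Proof. by rewrite /vdiff pd_der. Qed.
Lemma pdX_vdiff x F : pd (Xi x) (vdiff F) = - vdiff (pd (Xi x) F) + lieX x F.
Proof. by rewrite /vdiff pd_der. Qed.

Lemma sform_vdiff F : sform F -> sform (vdiff F).
Proof.
move: F; apply: sform_der => //; [exact: splits_par|exact: zeroD|exact: zeroM|
  exact: vdiff_letter_superder|..].
- move=> [a|b|x] F gF /=; [exact: sform0|exact: sform_pd|exact: sform_lieX].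
- move=> [a|b|x] [a'|b'|x'] F gF /=; rewrite ?pd0 ?addr0 ?add0r ?oppr0 //.
  + by rewrite (pdC (Al a) (Al b')) // opprK.
  + by rewrite pd_lieX /= sform_Al0 // subr0 add0r.
  + by rewrite (pdC (Al b) (Al a')).
  + by rewrite (pdC (Be b) (Al b')) // (pdC (Al b) (Be b')) // addrC.
  + by rewrite pd_lieX /= sform_Be0 // subr0 (pdC (Al b) (Xi x')) // addrC.
  + by rewrite pd_lieX /= sform_Al0 // subr0 opprK add0r.
  + by rewrite pd_lieX /= sform_Be0 // subr0 (pdC (Xi x) (Al b')) //= opprK addrC.
  + rewrite !pd_lieX /= brkC sform_XiN //; apply/fnP => s; rewrite !fnE; ring.
- move=> t u w F [a b|a b|a b] gF /=; first by rewrite addr0.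
    by rewrite sform_AlD.
  apply/fnP => s; rewrite fnE; elim: s F gF => [|t' s IH] F gF.
    by rewrite /lieX /lieop /der /= actDl.
  rewrite !(fn_cons (lieX _ _)) !pd_lieX !fnE IH; last exact: sform_pd.
  case: t' => c /=; rewrite ?sform_Al0 // ?sform_Be0 // ?brkDl ?sform_XiD // !fnE; ring.
Qed.

Lemma lieop_lieX x g y F : {morph g : a b / a + b} -> sform F ->
  lieop x g (lieX y F) - lieX y (lieop x g F) = lieX (brk LX x y) F.
Proof.
move=> gD; apply: lieop_comm => c; rewrite /zG.
have -> : g 0 = 0 by apply: (addrI (g 0)); rewrite -gD !addr0.
by rewrite subrr.
Qed.

Lemma lieA_comm a b F : sform F ->
  lieA a (lieA b F) - lieA b (lieA a F) = lieA (brk LG a b) F.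
Proof.
by rewrite /lieA (anch_brk rhoP); apply: lieop_comm => c; rewrite brkJ.
Qed.

Lemma lieop_vdiff x g F : {morph g : a b / a + b} -> sform F ->
  lieop x g (vdiff F) = vdiff (lieop x g F).
Proof.
move=> gD gF; apply/fnP => s; elim: s F gF => [|t s IH] F gF.
  by rewrite /lieop /vdiff /der /= act0.
rewrite (fn_cons (lieop _ _ _)) (fn_cons (vdiff _)) pd_lieop.
have h := IH (pd t F) (sform_pd t gF).
have lD := superderD (superder_lieop x g); have lN F' := superderN F' (superder_lieop x g).
have vD := superderD superder_vdiff; have vN F' := superderN F' superder_vdiff.
case: t h => c h /=.
- rewrite !pdA_vdiff pd_lieop lN vD vN !fnE h /=; ring.
- rewrite !pdB_vdiff !pd_lieop lD vD vN !fnE h /=; ring.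
rewrite !pdX_vdiff !pd_lieop lD lN vD vN.
rewrite -(lieop_lieX x c gD gF) !fnE h /=; ring.
Qed.

(** For a letter [Be] or [Xi], the two extra terms are [vdiff] composed with a
    contraction by [Al] or a Lie derivative, in both orders; they cancel since
    [vdiff] supercommutes with these. *)
Lemma vdiff_vdiff F : sform F -> vdiff (vdiff F) = 0.
Proof.
move=> gF; apply/fnP => s; elim: s F gF => [|t s IH] F gF //.
rewrite (fn_cons (vdiff _)); have := IH (pd t F) (sform_pd t gF); rewrite fn0 => h.
have vD := superderD superder_vdiff; have vN F' := superderN F' superder_vdiff.
case: t h => c h.
- by rewrite !pdA_vdiff vN !fnE h oppr0 oppr0.
- by rewrite !pdB_vdiff vD pdA_vdiff !fnE h; ring.
- by rewrite !pdX_vdiff vD vN /lieX lieop_vdiff ?fnE ?h //; [ring|exact: zGD].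
Qed.

(** * The horizontal differential *)
Definition anchE_letter t F : fn := if t is Be b then pd (Xi (rho b)) F else 0.
(** The contraction of forms by the anchor of a [Be] argument: up to sign, the
    whole horizontal differential on words without [Al], see [hdiff_alfree]. *)
Definition anchE := der true (fun=> 0) anchE_letter.
Definition brackB_letter (b : G) t F : fn := if t is Al a then pd (Be (brk LG a b)) F else 0.
(** Moves an [Al a] to a [Be [a, b]]; it arises because the Lie derivative along a
    acts by the bracket on the argument b of the symmetric power. *)
Definition brackB b := der true (fun=> 0) (brackB_letter b).
Definition hcommB b F : fn := - pd (Xi (rho b)) F - brackB b F.
Definition hcommX_letter (x : X) t F : fn := if t is Al a then pd (Xi (brk LX (rho a) x)) F else 0.
(** Likewise, the Lie derivative along a acts by the bracket with rho(a) on the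
    vector field x. *)
Definition hcommX x := der false (fun=> 0) (hcommX_letter x).
Definition hdiff_letter t F : fn :=
  match t with Al a => lieA a F | Be b => hcommB b F | Xi x => hcommX x F end.
(** Graded symmetry of the values forces the brackets in the commutators with [Be]
    and [Xi] once the commutator with [Al] is the Lie derivative. *)
Definition hdiff := der true (fun=> 0) hdiff_letter.

Lemma anchE_letter_superder t : superder (true (+) par t) (anchE_letter t).
Proof.
case: t => c /=; [exact: superder_zero| |exact: superder_zero].
exact: (@superder_pd C _ par (Xi (rho c))).
Qed.
Lemma brackB_letter_superder b t : superder (true (+) par t) (brackB_letter b t).
Proof.
case: t => c /=; [|exact: superder_zero|exact: superder_zero].
exact: (@superder_pd C _ par (Be (brk LG c b))).
Qed.
Lemma hcommX_letter_superder x t : superder (false (+) par t) (hcommX_letter x t).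
Proof.
case: t => c /=; [|exact: superder_zero|exact: superder_zero].
exact: (@superder_pd C _ par (Xi (brk LX (rho c) x))).
Qed.
Lemma superder_anchE : superder true anchE.
Proof. apply: superder_der => //; [exact: zeroD|exact: zeroM|exact: anchE_letter_superder]. Qed.
Lemma superder_brackB b : superder true (brackB b).
Proof. apply: superder_der => //; [exact: zeroD|exact: zeroM|exact: brackB_letter_superder]. Qed.
Lemma superder_hcommX x : superder false (hcommX x).
Proof. apply: superder_der => //; [exact: zeroD|exact: zeroM|exact: hcommX_letter_superder]. Qed.
Lemma superder_hcommB b : superder true (hcommB b).
Proof.
apply: superder_add; apply: superder_opp; last exact: superder_brackB.
exact: (@superder_pd C _ par (Xi (rho b))).
Qed.
Lemma hdiff_letter_superder t : superder (true (+) par t) (hdiff_letter t).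
Proof. case: t => c /=; [exact: superder_lieop|exact: superder_hcommB|exact: superder_hcommX]. Qed.
Lemma superder_hdiff : superder true hdiff.
Proof. apply: superder_der => //; [exact: zeroD|exact: zeroM|exact: hdiff_letter_superder]. Qed.

Lemma pdA_anchE a F : pd (Al a) (anchE F) = - anchE (pd (Al a) F).
Proof. by rewrite /anchE pd_der addr0. Qed.
Lemma pdB_anchE b F : pd (Be b) (anchE F) = anchE (pd (Be b) F) + pd (Xi (rho b)) F.
Proof. by rewrite /anchE pd_der. Qed.
Lemma pdX_anchE x F : pd (Xi x) (anchE F) = - anchE (pd (Xi x) F).
Proof. by rewrite /anchE pd_der addr0. Qed.
Lemma pdA_brackB b a F : pd (Al a) (brackB b F) = - brackB b (pd (Al a) F) + pd (Be (brk LG a b)) F.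
Proof. by rewrite /brackB pd_der. Qed.
Lemma pdB_brackB b c F : pd (Be c) (brackB b F) = brackB b (pd (Be c) F).
Proof. by rewrite /brackB pd_der addr0. Qed.
Lemma pdX_brackB b x F : pd (Xi x) (brackB b F) = - brackB b (pd (Xi x) F).
Proof. by rewrite /brackB pd_der addr0. Qed.
Lemma pdA_hcommX x a F : pd (Al a) (hcommX x F) =
  hcommX x (pd (Al a) F) + pd (Xi (brk LX (rho a) x)) F.
Proof. by rewrite /hcommX pd_der. Qed.
Lemma pdB_hcommX x c F : pd (Be c) (hcommX x F) = hcommX x (pd (Be c) F).
Proof. by rewrite /hcommX pd_der addr0. Qed.
Lemma pdX_hcommX y x F : pd (Xi x) (hcommX y F) = hcommX y (pd (Xi x) F).
Proof. by rewrite /hcommX pd_der addr0. Qed.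
Lemma pdA_hdiff a F : pd (Al a) (hdiff F) = - hdiff (pd (Al a) F) + lieA a F.
Proof. by rewrite /hdiff pd_der. Qed.
Lemma pdB_hdiff b F : pd (Be b) (hdiff F) = hdiff (pd (Be b) F) + hcommB b F.
Proof. by rewrite /hdiff pd_der. Qed.
Lemma pdX_hdiff x F : pd (Xi x) (hdiff F) = - hdiff (pd (Xi x) F) + hcommX x F.
Proof. by rewrite /hdiff pd_der. Qed.

Lemma pdA_hcommB b a F : sform F ->
  pd (Al a) (hcommB b F) = - hcommB b (pd (Al a) F) - pd (Be (brk LG a b)) F.
Proof.
move=> gF; rewrite /hcommB pdD !pdN pdA_brackB (pdC (Xi _) (Al a)) //=.
apply/fnP => s; rewrite !fnE; ring.
Qed.
Lemma pdB_hcommB b c F : sform F -> pd (Be c) (hcommB b F) = hcommB b (pd (Be c) F).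
Proof. by move=> gF; rewrite /hcommB pdD !pdN pdB_brackB (pdC (Xi _) (Be c)). Qed.
Lemma pdX_hcommB b x F : sform F -> pd (Xi x) (hcommB b F) = - hcommB b (pd (Xi x) F).
Proof.
move=> gF; rewrite /hcommB pdD !pdN pdX_brackB (pdC (Xi _) (Xi x)) //=.
apply/fnP => s; rewrite !fnE; ring.
Qed.

Lemma sform_brackB b F : sform F -> sform (brackB b F).
Proof.
move: F; apply: sform_der => //; [exact: splits_par|exact: zeroD|exact: zeroM|
  exact: brackB_letter_superder|..].
- move=> [a|c|x] F gF /=; [exact: sform_pd|exact: sform0|exact: sform0].
- move=> [a|c|x] [a'|c'|x'] F gF /=; rewrite ?pd0 ?addr0 ?add0r ?oppr0 //.
  + rewrite (pdC (Al a) (Be _)) // (pdC (Be _) (Al a')) //=.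
    by apply/fnP => s; rewrite !fnE; ring.
  + by rewrite (pdC (Be _) (Be c')) // add0r.
  + by rewrite (pdC (Be _) (Xi x')) // add0r opprK.
  + by rewrite (pdC (Be c) (Be _)) // add0r.
  + by rewrite (pdC (Xi x) (Be _)) // add0r.
move=> t u w F [a c|a c|a c] gF /=; rewrite ?addr0 //.
by rewrite brkDl sform_BeD.
Qed.

Lemma sform_hcommB b F : sform F -> sform (hcommB b F).
Proof.
move=> gF; apply: sformD; apply: sformN; first exact: sform_pd.
exact: sform_brackB.
Qed.

Lemma sform_hcommX y F : sform F -> sform (hcommX y F).
Proof.
move: F; apply: sform_der => //; [exact: splits_par|exact: zeroD|exact: zeroM|
  exact: hcommX_letter_superder|..].
- move=> [a|c|x] F gF /=; [exact: sform_pd|exact: sform0|exact: sform0].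
- move=> [a|c|x] [a'|c'|x'] F gF /=; rewrite ?pd0 ?addr0 ?add0r ?oppr0 //.
  + rewrite (pdC (Al a) (Xi _)) // (pdC (Xi _) (Al a')) //=.
    by apply/fnP => s; rewrite !fnE; ring.
  + by rewrite (pdC (Xi _) (Be c')) // add0r.
  + by rewrite (pdC (Xi _) (Xi x')) // add0r.
  + by rewrite (pdC (Be c) (Xi _)) // add0r.
  + by rewrite (pdC (Xi x) (Xi _)) // add0r.
move=> t u w F [a c|a c|a c] gF /=; rewrite ?addr0 //.
by rewrite (anchD rhoP) brkDl sform_XiD.
Qed.

Lemma lieA_split a b F : sform F -> lieA (a + b) F = lieA a F + lieA b F.
Proof.
move=> gF; apply/fnP => s; rewrite fnE; elim: s F gF => [|t s IH] F gF.
  by rewrite /lieA /lieop /der /= (anchD rhoP) actDl.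
rewrite !(fn_cons (lieA _ _)) !pd_lieA !fnE IH; last exact: sform_pd.
case: t => c /=; rewrite ?(anchD rhoP) brkDl.
- by rewrite sform_AlD // fnE; ring.
- by rewrite sform_BeD // fnE; ring.
- by rewrite sform_XiD // fnE; ring.
Qed.

Lemma brackB_split b c F : sform F -> brackB (b + c) F = brackB b F + brackB c F.
Proof.
move=> gF; apply/fnP => s; rewrite fnE; elim: s F gF => [|t s IH] F gF.
  by rewrite /brackB /der /= addr0.
rewrite !(fn_cons (brackB _ _)); have h := IH _ (sform_pd t gF); case: t h => a h.
- by rewrite !pdA_brackB !fnE h brkD sform_BeD // fnE; ring.
- by rewrite !pdB_brackB h.
- by rewrite !pdX_brackB !fnE h; ring.
Qed.

Lemma hcommB_split b c F : sform F -> hcommB (b + c) F = hcommB b F + hcommB c F.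
Proof.
move=> gF; rewrite /hcommB brackB_split // (anchD rhoP) sform_XiD //.
by apply/fnP => s; rewrite !fnE; ring.
Qed.

Lemma hcommX_split x y F : sform F -> hcommX (x + y) F = hcommX x F + hcommX y F.
Proof.
move=> gF; apply/fnP => s; rewrite fnE; elim: s F gF => [|t s IH] F gF.
  by rewrite /hcommX /der /= addr0.
rewrite !(fn_cons (hcommX _ _)); have h := IH _ (sform_pd t gF); case: t h => a h.
- by rewrite !pdA_hcommX !fnE h brkD sform_XiD // fnE; ring.
- by rewrite !pdB_hcommX h.
- by rewrite !pdX_hcommX h.
Qed.

Lemma sform_hdiff F : sform F -> sform (hdiff F).
Proof.
move: F; apply: sform_der => //; [exact: splits_par|exact: zeroD|exact: zeroM|
  exact: hdiff_letter_superder|..].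
- move=> [a|b|x] F gF /=; [exact: sform_lieA|exact: sform_hcommB|exact: sform_hcommX].
- move=> [a|b|x] [a'|b'|x'] F gF /=;
    rewrite ?pd_lieA ?pdA_hcommB ?pdB_hcommB ?pdX_hcommB ?pdA_hcommX ?pdB_hcommX ?pdX_hcommX //=;
    apply/fnP => s; rewrite ?(brkC LG a' a) ?sform_AlN // !fnE; ring.
move=> t u w F [a b|a b|a b] gF /=; [exact: lieA_split|exact: hcommB_split|exact: hcommX_split].
Qed.

Lemma brackB_alfree b F s : alfree s -> brackB b F s = 0.
Proof.
elim: s F => [|t s IH] F //; rewrite (fn_cons (brackB _ _)); case: t => // c hs.
- by rewrite pdB_brackB IH.
- by rewrite pdX_brackB fnE IH // oppr0.
Qed.
Lemma hcommX_alfree x F s : alfree s -> hcommX x F s = 0.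
Proof.
elim: s F => [|t s IH] F //; rewrite (fn_cons (hcommX _ _)); case: t => // c hs.
- by rewrite pdB_hcommX IH.
- by rewrite pdX_hcommX IH.
Qed.
(** The recursion for [hdiff] starts at the words without [Al], as the
    commutators with [Be] and [Xi] are nonzero only through the letters [Al] of
    the word, except for the contraction by the anchor. *)
Lemma hdiff_alfree F s : alfree s -> hdiff F s = - anchE F s.
Proof.
elim: s F => [|t s IH] F.
  by rewrite /hdiff /anchE /der /= oppr0.
rewrite (fn_cons (hdiff _)) (fn_cons (anchE _)); case: t => // c hs.
- by rewrite pdB_hdiff pdB_anchE /hcommB !fnE IH // brackB_alfree //; ring.
- by rewrite pdX_hdiff pdX_anchE !fnE IH // hcommX_alfree //; ring.
Qed.

Lemma agree_on_lieop_nal x g F H : agree_on nal F H -> agree_on nal (lieop x g F) (lieop x g H).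
Proof.
apply: agree_on_der => t F' H' Pt h s hs; rewrite !fnE; congr (- _).
by apply: h; case: t Pt.
Qed.
Lemma agree_on_lieop_isX x g F H : agree_on isX F H -> agree_on isX (lieop x g F) (lieop x g H).
Proof.
apply: agree_on_der => t F' H' Pt h s hs; rewrite !fnE; congr (- _).
by apply: h; case: t Pt.
Qed.
Lemma agree_on_anchE F H : agree_on nal F H -> agree_on nal (anchE F) (anchE H).
Proof. by apply: agree_on_der => -[a|b|x] F' H' // _ h s hs; exact: h. Qed.
Lemma agree_on_vdiff_isX F H : agree_on isX F H -> agree_on isX (vdiff F) (vdiff H).
Proof.
apply: agree_on_der => -[a|b|x] F' H' // _ h; exact: agree_on_lieop_isX.
Qed.

Lemma anchEN F : anchE (- F) = - anchE F. Proof. exact: (superderN _ superder_anchE). Qed.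
Lemma anchE_anchE F : anchE (anchE F) = 0.
Proof.
have vD := superderD superder_anchE.
apply/fnP => s; elim: s F => [|t s IH] F //.
rewrite (fn_cons (anchE _)); have := IH (pd t F); rewrite fn0 => h.
case: t h => c h.
- by rewrite !pdA_anchE anchEN !fnE h; ring.
- by rewrite !pdB_anchE vD pdX_anchE !fnE h; ring.
- by rewrite !pdX_anchE anchEN !fnE h; ring.
Qed.

Lemma lieA_anchE a F : lieA a (anchE F) = anchE (lieA a F).
Proof.
have vD := superderD superder_anchE.
have lD := superderD (superder_lieop (rho a) (brk LG a)).
have lN F' := superderN F' (superder_lieop (rho a) (brk LG a)).
rewrite -/(lieA a) in lD lN.
apply/fnP => s; elim: s F => [|t s IH] F.
  by rewrite /lieA /lieop /anchE /der /= act0.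
rewrite (fn_cons (lieA _ _)) (fn_cons (anchE _)) pd_lieA; have h := IH (pd t F).
case: t h => c h /=.
- rewrite !pdA_anchE pd_lieA lN vD anchEN !fnE h /=; ring.
- rewrite !pdB_anchE !pd_lieA lD vD anchEN !fnE h /= (anch_brk rhoP); ring.
- rewrite !pdX_anchE pd_lieA lN vD anchEN !fnE h /=; ring.
Qed.

Lemma hdiffN F : hdiff (- F) = - hdiff F. Proof. exact: (superderN _ superder_hdiff). Qed.
Lemma hdiffD F H : hdiff (F + H) = hdiff F + hdiff H. Proof. exact: (superderD superder_hdiff). Qed.
Lemma vdiffN F : vdiff (- F) = - vdiff F. Proof. exact: (superderN _ superder_vdiff). Qed.
Lemma vdiffD F H : vdiff (F + H) = vdiff F + vdiff H. Proof. exact: (superderD superder_vdiff). Qed.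
Lemma lieAD a F H : lieA a (F + H) = lieA a F + lieA a H.
Proof. by rewrite /lieA (superderD (superder_lieop (rho a) (brk LG a))). Qed.
Lemma lieAN a F : lieA a (- F) = - lieA a F.
Proof. exact: (superderN _ (superder_lieop (rho a) (brk LG a))). Qed.

(** Contract the letters [Al]: the defect at each of them is L_[a, b], given by
    [lieA_comm].  Without them [hdiff] is [anchE], which commutes with [lieA] as the
    anchor preserves brackets. *)
Lemma lieA_hdiff a F : sform F -> lieA a (hdiff F) = hdiff (lieA a F).
Proof.
move=> gF; apply: sform_ext => [||as_ bs xs].
- by apply: sform_lieA; exact: sform_hdiff.
- by apply: sform_hdiff; exact: sform_lieA.
elim: as_ F gF => [|b as_ IH] F gF; rewrite /nword.
  have hs := alfree_nword bs xs.
  rewrite [LHS](@agree_on_lieop_nal (rho a) (brk LG a) _ (- anchE F)) //; last by move=> s;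
    exact: hdiff_alfree.
  by rewrite hdiff_alfree // -lieA_anchE -/(lieA a) lieAN.
rewrite (fn_cons (lieA _ _)) (fn_cons (hdiff _)) -/(nword as_ bs xs) pd_lieA /= !pdA_hdiff.
rewrite lieAD lieAN pd_lieA /= hdiffD hdiffN !fnE.
have := IH _ (sform_pd (Al b) gF) => ->.
rewrite -(lieA_comm a b gF) !fnE; ring.
Qed.

(** The same reduction; on words without [Al], contractions by anchors
    anticommute. *)
Lemma hdiff_hdiff F : sform F -> hdiff (hdiff F) = 0.
Proof.
move=> gF; apply: sform_ext => [||as_ bs xs]; [|exact: sform0|].
  by do 2 apply: sform_hdiff.
elim: as_ F gF => [|b as_ IH] F gF; rewrite /nword.
  have hs := alfree_nword bs xs.
  rewrite hdiff_alfree // (@agree_on_anchE _ (- anchE F)) //; last by move=> s; exact: hdiff_alfree.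
  by rewrite anchEN anchE_anchE oppr0 oppr0.
rewrite (fn_cons (hdiff _)) -/(nword as_ bs xs) !pdA_hdiff hdiffD hdiffN lieA_hdiff //.
by rewrite !fnE (IH _ (sform_pd (Al b) gF)) fn0; ring.
Qed.

Lemma lieX_brackB x b F : sform F -> lieX x (brackB b F) = brackB b (lieX x F).
Proof.
have tD := superderD (superder_brackB b); have tN F' := superderN F' (superder_brackB b).
have lD := superderD (superder_lieop x zG); have lN F' := superderN F' (superder_lieop x zG).
rewrite -/(lieX x) in lD lN.
move=> gF; apply/fnP => s; elim: s F gF => [|t s IH] F gF.
  by rewrite /lieX /lieop /brackB /der /= act0.
rewrite (fn_cons (lieX _ _)) (fn_cons (brackB _ _)) pd_lieX; have h := IH _ (sform_pd t gF).
have g2 := sform_brackB b gF.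
case: t h => c h /=; rewrite ?sform_Al0 ?sform_Be0 // ?subr0.
- rewrite !pdA_brackB pd_lieX pd_lieX /= sform_Al0 // sform_Be0 // !subr0 lD lN !fnE h; ring.
- by rewrite !pdB_brackB pd_lieX /= sform_Be0 // subr0 h.
- rewrite !pdX_brackB pd_lieX /= lN tD tN !fnE h; ring.
Qed.

Lemma lieX_hcommB x b F : sform F ->
  lieX x (hcommB b F) = hcommB b (lieX x F) + pd (Xi (brk LX (rho b) x)) F.
Proof.
move=> gF; rewrite /hcommB.
have lD := superderD (superder_lieop x zG); have lN F' := superderN F' (superder_lieop x zG).
rewrite -/(lieX x) in lD lN.
rewrite lD !lN lieX_brackB // pd_lieX /= (brkC LX (rho b)) sform_XiN //.
by apply/fnP => s; rewrite !fnE; ring.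
Qed.

(** Cartan's homotopy formula for the Lie derivative along a section.  This is
    also what remains of the anticommutation of the differentials after
    a commutator with the contraction by [Be b]. *)
Lemma vdiff_hcommB b F : sform F -> vdiff (hcommB b F) + hcommB b (vdiff F) = - lieA b F.
Proof.
have kD := superderD (superder_hcommB b); have kN F' := superderN F' (superder_hcommB b).
move=> gF; apply/fnP => s; elim: s F gF => [|t s IH] F gF.
  rewrite /hcommB !fnE /= /brackB /der /= subr0 -/(pd (Xi (rho b)) _) add0r.
  rewrite -[X in - X]/((pd (Xi (rho b)) (vdiff F)) [::]) pdX_vdiff fnE.
  by rewrite /lieA /lieX /lieop /vdiff /der /= fnE oppr0 add0r.
rewrite (fn_cons (_ + _)) (fn_cons (- lieA _ _)) pdN pdD pd_lieA.
have gv := sform_vdiff gF.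
have := IH _ (sform_pd t gF); rewrite !fnE => h.
case: t h => c h /=.
- rewrite pdA_vdiff !pdA_hcommB // pdA_vdiff pdB_vdiff vdiffD !vdiffN kN !fnE.
  rewrite (brkC LG b) sform_AlN // fnE; move: h; set x := vdiff _ _; set y := hcommB _ _ _ => h.
  have -> : x = - lieA b (pd (Al c) F) s - y by rewrite -h; ring.
  ring.
- rewrite pdB_vdiff !pdB_hcommB // pdA_hcommB // pdB_vdiff kD !fnE.
  rewrite (brkC LG b) sform_BeN // fnE; move: h; set x := vdiff _ _; set y := hcommB _ _ _ => h.
  have -> : x = - lieA b (pd (Be c) F) s - y by rewrite -h; ring.
  ring.
- rewrite pdX_vdiff !pdX_hcommB // pdX_vdiff kD kN vdiffN lieX_hcommB // !fnE.
  move: h; set x := vdiff _ _; set y := hcommB _ (vdiff _) _ => h.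
  have -> : x = - lieA b (pd (Xi c) F) s - y by rewrite -h; ring.
  ring.
Qed.

Lemma hdiff_xionly F s : xionly s -> hdiff F s = 0.
Proof.
elim: s F => [|t s IH] F //; rewrite (fn_cons (hdiff _)); case: t => // c hs.
rewrite pdX_hdiff !fnE IH // hcommX_alfree ?addr0 ?oppr0 //.
by apply: (@sub_all _ isX nal _ s hs) => -[].
Qed.

(** Contracting [Al a] leaves the commutator of [lieA a] and [vdiff], which is 0;
    contracting [Be b] leaves [vdiff_hcommB]; on words of letters [Xi] alone, [hdiff]
    vanishes for degree reasons. *)
Lemma vdiff_hdiff F : sform F -> vdiff (hdiff F) + hdiff (vdiff F) = 0.
Proof.
move=> gF; apply: sform_ext => [||as_ bs xs]; [|exact: sform0|].
  by apply: sformD; [apply: sform_vdiff; exact: sform_hdiff|apply: sform_hdiff; exact: sform_vdiff].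
elim: as_ F gF => [|a as_ IH] F gF; rewrite /nword; last first.
  rewrite (fn_cons (_ + _)) -/(nword as_ bs xs) pdD pdA_vdiff pdA_hdiff pdA_hdiff pdA_vdiff.
  rewrite vdiffD vdiffN hdiffN /lieA lieop_vdiff //; last exact: brkD.
  have := IH _ (sform_pd (Al a) gF); rewrite !fnE => /eqP; rewrite addr_eq0 => /eqP ->.
  ring.
elim: bs F gF => [|b bs IH] F gF; rewrite /=; last first.
  rewrite (fn_cons (_ + _)) pdD pdB_vdiff pdB_hdiff pdB_hdiff pdB_vdiff pdA_hdiff vdiffD hdiffD.
  set r := map Be bs ++ map Xi xs.
  have k : vdiff (hcommB b F) r = - lieA b F r - hcommB b (vdiff F) r.
    by rewrite -fnN -vdiff_hcommB // fnE addrK.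
  have := IH _ (sform_pd (Be b) gF); rewrite !fnE -/r => /eqP; rewrite addr_eq0 => /eqP ->.
  rewrite k; ring.
have hs := xionly_map xs.
rewrite fnE (hdiff_xionly (vdiff F)) // addr0 (@agree_on_vdiff_isX _ 0) //.
  by rewrite (superder0 superder_vdiff).
exact: hdiff_xionly.
Qed.

(** * The Weil algebra inside superfunctions *)
Definition Be_linear F := forall f b, pd (Be (f *: b)) F = sconst f ** pd (Be b) F.
Definition Xi_linear F := forall f x, pd (Xi (f *: x)) F = sconst f ** pd (Xi x) F.
(** [vdiff (sconst f)] is df, a function of one letter [Xi]. *)
Definition Al_leibniz F := forall f a,
  pd (Al (f *: a)) F = sconst f ** pd (Al a) F - vdiff (sconst f) ** pd (Be a) F.
Record weilfn F : Prop := {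
  weilfn_sform : sform F; weilfn_Be : Be_linear F; weilfn_Xi : Xi_linear F;
    weilfn_Al : Al_leibniz F }.

Lemma pd_cstM t f H : pd t (sconst f ** H) = sconst f ** pd t H.
Proof. by rewrite pd_smul pd_cst smul0l add0r twist_cst. Qed.
Lemma signed_mulr b F H : F ** signed b H = signed b (F ** H).
Proof. exact: smul_signedr. Qed.

Lemma Be_linear_pd t F : sform F -> Be_linear F -> Be_linear (pd t F).
Proof.
move=> gF h f b; rewrite (pdC t (Be _)) // h pd_cstM (pdC t (Be b)) //.
by rewrite signed_mulr.
Qed.
Lemma Xi_linear_pd t F : sform F -> Xi_linear F -> Xi_linear (pd t F).
Proof.
move=> gF h f b; rewrite (pdC t (Xi _)) // h pd_cstM (pdC t (Xi b)) //.
by rewrite signed_mulr.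
Qed.

Lemma twist_dcst f : twist true (vdiff (sconst f)) = - vdiff (sconst f).
Proof.
have := superder_twist superder_vdiff (sconst f); rewrite twist_cst /= => E.
by rewrite {2}E opprK.
Qed.
Lemma twist_hcst f : twist true (hdiff (sconst f)) = - hdiff (sconst f).
Proof.
have := superder_twist superder_hdiff (sconst f); rewrite twist_cst /= => E.
by rewrite {2}E opprK.
Qed.
Lemma twist_hdcst f : twist true (hdiff (vdiff (sconst f))) = hdiff (vdiff (sconst f)).
Proof.
have := superder_twist superder_hdiff (vdiff (sconst f)); rewrite twist_dcst hdiffN.
by move=> /= /oppr_inj.
Qed.
Lemma parity_dcst f : parity par true (vdiff (sconst f)).
Proof. exact: twist_dcst. Qed.

Lemma vdiff0 : vdiff 0 = 0. Proof. exact: superder0 superder_vdiff. Qed.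
Lemma hdiff0 : hdiff 0 = 0. Proof. exact: superder0 superder_hdiff. Qed.
Lemma pdA_dcst a f : pd (Al a) (vdiff (sconst f)) = 0.
Proof. by rewrite pdA_vdiff pd_cst vdiff0 oppr0. Qed.
Lemma pdB_dcst a f : pd (Be a) (vdiff (sconst f)) = 0.
Proof. by rewrite pdB_vdiff !pd_cst vdiff0 addr0. Qed.
Lemma pdX_dcst x f : pd (Xi x) (vdiff (sconst f)) = sconst (act LX x f).
Proof. by rewrite pdX_vdiff pd_cst vdiff0 oppr0 add0r /lieX lieop_cst. Qed.
Lemma brackB_cst b f : brackB b (sconst f) = 0.
Proof.
apply/fnP => -[|t s] //; rewrite (fn_cons (brackB _ _)).
have d0 := superder0 (superder_brackB b).
by case: t => c; rewrite ?pdA_brackB ?pdB_brackB ?pdX_brackB !pd_cst d0 ?oppr0 ?addr0.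
Qed.
Lemma hcommX_cst b f : hcommX b (sconst f) = 0.
Proof.
apply/fnP => -[|t s] //; rewrite (fn_cons (hcommX _ _)).
have d0 := superder0 (superder_hcommX b).
by case: t => c; rewrite ?pdA_hcommX ?pdB_hcommX ?pdX_hcommX !pd_cst d0 ?oppr0 ?addr0.
Qed.
Lemma pdA_hcst a f : pd (Al a) (hdiff (sconst f)) = sconst (act LG a f).
Proof. by rewrite pdA_hdiff pd_cst hdiff0 oppr0 add0r /lieA lieop_cst (anch_act rhoP). Qed.
Lemma pdB_hcst b f : pd (Be b) (hdiff (sconst f)) = 0.
Proof. by rewrite pdB_hdiff /hcommB brackB_cst !pd_cst hdiff0 subr0 oppr0 addr0. Qed.
Lemma pdX_hcst x f : pd (Xi x) (hdiff (sconst f)) = 0.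
Proof. by rewrite pdX_hdiff hcommX_cst pd_cst hdiff0 oppr0 addr0. Qed.
Lemma brackB_dcst b f : brackB b (vdiff (sconst f)) = 0.
Proof.
apply/fnP => -[|t s] //; rewrite (fn_cons (brackB _ _)).
have d0 := superder0 (superder_brackB b).
by case: t => c; rewrite ?pdA_brackB ?pdB_brackB ?pdX_brackB ?pdA_dcst ?pdB_dcst ?pdX_dcst
  ?brackB_cst ?d0 ?oppr0 ?addr0.
Qed.
Lemma pdA_hdcst a f : pd (Al a) (hdiff (vdiff (sconst f))) = vdiff (sconst (act LG a f)).
Proof.
rewrite pdA_hdiff pdA_dcst hdiff0 oppr0 add0r /lieA lieop_vdiff; last exact: sform_cst.
  by rewrite lieop_cst (anch_act rhoP).
exact: brkD.
Qed.
Lemma pdB_hdcst b f : pd (Be b) (hdiff (vdiff (sconst f))) = - sconst (act LG b f).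
Proof.
by rewrite pdB_hdiff pdB_dcst hdiff0 add0r /hcommB brackB_dcst pdX_dcst subr0 (anch_act rhoP).
Qed.

Lemma pdA_dM a f H : pd (Al a) (vdiff (sconst f) ** H) = - (vdiff (sconst f) ** pd (Al a) H).
Proof. by rewrite pd_smul pdA_dcst smul0l add0r twist_dcst smulNl. Qed.
Lemma pdB_dM a f H : pd (Be a) (vdiff (sconst f) ** H) = vdiff (sconst f) ** pd (Be a) H.
Proof. by rewrite pd_smul pdB_dcst smul0l add0r. Qed.
Lemma pdX_dM x f H : pd (Xi x) (vdiff (sconst f) ** H) =
  sconst (act LX x f) ** H - vdiff (sconst f) ** pd (Xi x) H.
Proof. by rewrite pd_smul pdX_dcst twist_dcst smulNl. Qed.
Lemma pdA_hM a f H : pd (Al a) (hdiff (sconst f) ** H) =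
  sconst (act LG a f) ** H - hdiff (sconst f) ** pd (Al a) H.
Proof. by rewrite pd_smul pdA_hcst twist_hcst smulNl. Qed.
Lemma pdB_hM a f H : pd (Be a) (hdiff (sconst f) ** H) = hdiff (sconst f) ** pd (Be a) H.
Proof. by rewrite pd_smul pdB_hcst smul0l add0r. Qed.
Lemma pdX_hM a f H : pd (Xi a) (hdiff (sconst f) ** H) = - (hdiff (sconst f) ** pd (Xi a) H).
Proof. by rewrite pd_smul pdX_hcst smul0l add0r twist_hcst smulNl. Qed.
Lemma pdA_hdM a f H : pd (Al a) (hdiff (vdiff (sconst f)) ** H) =
  vdiff (sconst (act LG a f)) ** H + hdiff (vdiff (sconst f)) ** pd (Al a) H.
Proof. by rewrite pd_smul pdA_hdcst twist_hdcst. Qed.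
Lemma pdB_hdM a f H : pd (Be a) (hdiff (vdiff (sconst f)) ** H) =
  - (sconst (act LG a f) ** H) + hdiff (vdiff (sconst f)) ** pd (Be a) H.
Proof. by rewrite pd_smul pdB_hdcst smulNl. Qed.

(** L_(f x) = f L_x + df wedge i_x. *)
Lemma lieX_scale f x F : sform F -> Xi_linear F ->
  lieX (f *: x) F = sconst f ** lieX x F + vdiff (sconst f) ** pd (Xi x) F.
Proof.
move=> gF XF; apply/fnP => s; elim: s F gF XF => [|t s IH] F gF XF.
  rewrite fnE smul_cstl /lieX /lieop /der /= actZl /smul /=.
  by rewrite /vdiff /der /= mul0r addr0.
have := IH _ (sform_pd t gF) (Xi_linear_pd t gF XF); rewrite fnE => h.
rewrite (fn_cons (lieX _ _)) (fn_cons (_ + _)) pdD pd_cstM !pd_lieX.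
case: t h => c h; rewrite ?pdA_dM ?pdB_dM ?pdX_dM /= (pdC (Xi x)) //= ?sform_Al0 ?sform_Be0 //.
- by rewrite smulDr smulNr smulNr smul0r !fnE h; ring.
- by rewrite smulDr smulNr smul0r !fnE h; ring.
rewrite brkZl sform_XiD // sform_XiN // !XF smulDr !smulNr !fnE h; ring.
Qed.

Lemma brackB_scale f b F : sform F -> Be_linear F ->
  brackB (f *: b) F = sconst f ** brackB b F + hdiff (sconst f) ** pd (Be b) F.
Proof.
move=> gF BF; apply/fnP => s; elim: s F gF BF => [|t s IH] F gF BF.
  by rewrite fnE smul_cstl /brackB /smul /= /hdiff /der /= mulr0 mul0r addr0.
have := IH _ (sform_pd t gF) (Be_linear_pd t gF BF); rewrite fnE => h.
rewrite (fn_cons (brackB _ _)) (fn_cons (_ + _)) pdD pd_cstM.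
case: t h => c h; rewrite ?pdA_hM ?pdB_hM ?pdX_hM /= (pdC (Be b)) //=.
- rewrite !pdA_brackB brkZ sform_BeD // !BF smulDr smulNr !fnE h; ring.
- by rewrite !pdB_brackB h.
- by rewrite !pdX_brackB smulNr !fnE h; ring.
Qed.

(** This and the next lemmas are what [Be_linear], [Xi_linear] and [Al_leibniz]
    become after a commutator with [hdiff]. *)
Lemma hcommB_scale f b F : sform F -> Be_linear F -> Xi_linear F ->
  hcommB (f *: b) F = sconst f ** hcommB b F - hdiff (sconst f) ** pd (Be b) F.
Proof.
move=> gF BF XF; rewrite /hcommB brackB_scale // (anchZ rhoP) XF smulDr !smulNr.
by rewrite opprD addrA.
Qed.

Lemma hcommX_scale f x F : sform F -> Xi_linear F ->
  hcommX (f *: x) F = sconst f ** hcommX x F + hdiff (sconst f) ** pd (Xi x) F.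
Proof.
move=> gF BF; apply/fnP => s; elim: s F gF BF => [|t s IH] F gF BF.
  by rewrite fnE smul_cstl /hcommX /smul /= /hdiff /der /= mulr0 mul0r addr0.
have := IH _ (sform_pd t gF) (Xi_linear_pd t gF BF); rewrite fnE => h.
rewrite (fn_cons (hcommX _ _)) (fn_cons (_ + _)) pdD pd_cstM.
case: t h => c h; rewrite ?pdA_hM ?pdB_hM ?pdX_hM /= (pdC (Xi x)) //=.
- rewrite !pdA_hcommX brkZ sform_XiD // !BF (anch_act rhoP) smulDr smulNr !fnE h; ring.
- by rewrite !pdB_hcommX h.
- by rewrite !pdX_hcommX smulNr !fnE h; ring.
Qed.

Lemma weilfn_pdA b F : weilfn F -> weilfn (pd (Al b) F).
Proof.
case=> gF BF XF AF; split; [exact: sform_pd|exact: Be_linear_pd|exact: Xi_linear_pd|].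
move=> f a; rewrite (pdC (Al b) (Al _)) // AF /= pdD pdN pd_cstM pdA_dM.
rewrite (pdC (Al b) (Al a)) // (pdC (Al b) (Be a)) //= smulNr.
by apply/fnP => s; rewrite !fnE; ring.
Qed.
Lemma weilfn_pdB b F : weilfn F -> weilfn (pd (Be b) F).
Proof.
case=> gF BF XF AF; split; [exact: sform_pd|exact: Be_linear_pd|exact: Xi_linear_pd|].
move=> f a; rewrite (pdC (Be b) (Al _)) // AF /= pdD pdN pd_cstM pdB_dM.
by rewrite (pdC (Be b) (Al a)) // (pdC (Be b) (Be a)).
Qed.

Lemma lieA_xionly a F s : xionly s -> lieA a F s = lieX (rho a) F s.
Proof.
elim: s F => [|t s IH] F //; rewrite (fn_cons (lieA _ _)) (fn_cons (lieX _ _)).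
by case: t => // c hs; rewrite pd_lieA pd_lieX !fnE IH.
Qed.

Lemma smul_xionly F H s : (forall r, xionly r -> F r = 0) -> xionly s -> (F ** H) s = 0.
Proof.
move=> h hs; have A : agree_on isX F 0 by exact: h.
by rewrite (@agree_on_smul _ _ par isX F 0 H H) // smul0l.
Qed.

Lemma nword_Al a as_ bs xs F : F (nword (a :: as_) bs xs) = pd (Al a) F (nword as_ bs xs).
Proof. by []. Qed.
Lemma nword_Be b bs xs F : F (nword [::] (b :: bs) xs) = pd (Be b) F (nword [::] bs xs).
Proof. by []. Qed.

(** Both sides have the same commutators with the contractions by [Al] and [Be], up
    to Leibniz rules for F itself, so that only words in [Xi] remain; there
    the equation is [lieX_scale] at rho(a).  A contraction of F by a [Xi] need not
    satisfy [Al_leibniz], hence the restriction to sorted words, in which these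
    letters come last. *)
Lemma lieA_scale f a F : weilfn F ->
  lieA (f *: a) F = sconst f ** lieA a F + hdiff (sconst f) ** pd (Al a) F
    - hdiff (vdiff (sconst f)) ** pd (Be a) F - vdiff (sconst f) ** hcommB a F.
Proof.
move=> wF; apply: sform_ext => [||as_ bs xs].
- exact: sform_lieA (weilfn_sform wF).
- have gF := weilfn_sform wF; have gc := sform_cst par splits f.
  have gM := sform_smul splits_par.
  by do ?apply: sformD; do ?apply: sformN; apply: gM => //;
    do ?[exact: sform_pd | apply: sform_lieA | apply: sform_hcommB | apply: sform_hdiff |
      apply: sform_vdiff].
(* Contracting [Al c] reproduces the equation for the contracted function, plus
   the terms of [a, c] and c.f given by [brkZl] and [pdA_hdM], which cancel. *)
elim: as_ F wF => [|c as_ IH] F wF; last first.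
  have gF := weilfn_sform wF; have := IH _ (weilfn_pdA c wF).
  rewrite !nword_Al pdD pdN pdD pdN pdD pd_cstM !pd_lieA pdA_hM pdA_hdM pdA_dM pdA_hcommB //=.
  move: (hcommB a (pd (Al c) F)) => K.
  rewrite (pdC (Al a) (Al c)) // (pdC (Be a) (Al c)) //=.
  rewrite brkZl sform_AlD // sform_AlN // !(weilfn_Al wF).
  by rewrite !smulDr !smulNr !fnE => ->; rewrite (brkC LG c a) sform_BeN // smulNr !fnE; ring.
elim: bs F wF => [|c bs IH] F wF; last first.
  have gF := weilfn_sform wF; have := IH _ (weilfn_pdB c wF).
  rewrite !nword_Be pdD pdN pdD pdN pdD pd_cstM !pd_lieA pdB_hM pdB_hdM pdB_dM pdB_hcommB //=.
  move: (hcommB a (pd (Be c) F)) => K.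
  rewrite (pdC (Al a) (Be c)) // (pdC (Be a) (Be c)) //=.
  rewrite brkZl sform_BeD // sform_BeN // !(weilfn_Be wF).
  by rewrite !smulDr !smulNr !fnE => ->; ring.
have hs := xionly_map xs; rewrite /nword /=.
rewrite !fnE !smul_cstl !lieA_xionly // (anchZ rhoP) lieX_scale; last 2 first.
- exact: weilfn_sform.
- exact: weilfn_Xi.
rewrite fnE smul_cstl (@smul_xionly (hdiff (sconst f))) //; last by move=> r; exact: hdiff_xionly.
rewrite (@smul_xionly (hdiff (vdiff _))) //; last by move=> r; exact: hdiff_xionly.
rewrite addr0 subr0 (@agree_on_smul _ _ par isX (vdiff (sconst f)) (vdiff (sconst f))
  (hcommB a F) (- pd (Xi (rho a)) F)) //; first by rewrite smulNr fnE opprK.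
move=> r hr; rewrite /hcommB !fnE brackB_alfree ?oppr0 ?addr0 //.
by apply: (@sub_all _ isX nal _ r hr) => -[].
Qed.

(** Apply [vdiff] to the three conditions on F.  The error term at [Be] of the
    commutator with [Al] is the one that [Al_leibniz] provides, and d(df) = 0
    disposes of the rest. *)
Lemma weilfn_vdiff F : weilfn F -> weilfn (vdiff F).
Proof.
case=> gF BF XF AF; have M := superderM superder_vdiff.
have vf f := vdiff_vdiff (sform_cst par splits f).
split; first exact: sform_vdiff.
- move=> f b; rewrite !pdB_vdiff BF AF M twist_cst smulDr.
  by apply/fnP => s; rewrite !fnE; ring.
- move=> f x; rewrite !pdX_vdiff XF lieX_scale // M twist_cst smulDr smulNr.
  by apply/fnP => s; rewrite !fnE; ring.
move=> f a; rewrite !pdA_vdiff AF pdB_vdiff vdiffD vdiffN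
  !M twist_cst vf twist_dcst smul0l smulNr smulNl smulDr.
by apply/fnP => s; rewrite !fnE; ring.
Qed.

Lemma weilfn_hdiff F : weilfn F -> weilfn (hdiff F).
Proof.
move=> wF; case: (wF) => gF BF XF AF; have M := superderM superder_hdiff.
split; first exact: sform_hdiff.
- move=> f b; rewrite !pdB_hdiff BF M twist_cst hcommB_scale // smulDr.
  by apply/fnP => s; rewrite !fnE; ring.
- move=> f x; rewrite !pdX_hdiff XF hcommX_scale // M twist_cst smulDr smulNr.
  by apply/fnP => s; rewrite !fnE; ring.
move=> f a; rewrite !pdA_hdiff AF lieA_scale // pdB_hdiff hdiffD hdiffN !M twist_cst twist_dcst.
rewrite !smulDr !smulNr smulNl.
by apply/fnP => s; rewrite !fnE; ring.
Qed.

Lemma weilfn_smul F H : weilfn F -> weilfn H -> weilfn (F ** H).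
Proof.
move=> wF wH; split; first by apply: (sform_smul splits_par); exact: weilfn_sform.
- move=> f b; rewrite !pd_smul (weilfn_Be wF) (weilfn_Be wH) /= smulDr !smulA.
  by rewrite (smul_cstC _ f F).
- move=> f b; rewrite !pd_smul (weilfn_Xi wF) (weilfn_Xi wH) /= smulDr !smulA.
  by rewrite (smul_cstC _ f (twist true F)).
move=> f a; rewrite !pd_smul (weilfn_Al wF) (weilfn_Al wH) /= !smulDl !smulDr !smulNl !smulNr.
rewrite !smulA (smul_cstC _ f (twist true F)) (smul_comm _ (parity_dcst f)) twistT /=.
by apply/fnP => s; rewrite !fnE; ring.
Qed.

Lemma weilfn_cst f : weilfn (sconst f).
Proof.
split; first exact: sform_cst.
- by move=> g b; rewrite !pd_cst smul0r.
- by move=> g b; rewrite !pd_cst smul0r.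
by move=> g b; rewrite !pd_cst !smul0r subr0.
Qed.

(** * Bidegrees *)
Lemma supp_pd_to t v w F : supp v F -> v - wt t = w -> supp w (pd t F).
Proof. by move=> h <-; exact: supp_pd. Qed.

Lemma supp_vdiff (p q : int) F : supp (p, q) F -> supp (p, q + 1) (vdiff F).
Proof.
move=> h; have -> : (p, q + 1) = (p, q) + (0, 1) :> (int * int)%type.
  by congr (_, _); rewrite addr0.
apply: supp_der h; [exact: zeroD| |by left].
move=> [a|b|x] [p' q'] F' h /=; first exact: supp0.
  by apply: supp_pd_to h _; congr (_, _) => /=; ring.
rewrite addrK; exact: supp_lieop.
Qed.

Lemma supp_brackB b v F : supp v F -> supp (v + (0, -1)) (brackB b F).
Proof.
apply: supp_der; [exact: zeroD| |by left].
move=> [a|c|x] [p' q'] F' h /=; try exact: supp0.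
by apply: supp_pd_to h _; congr (_, _) => /=; ring.
Qed.

Lemma supp_hcommX x v F : supp v F -> supp (v + (1, -1)) (hcommX x F).
Proof.
apply: supp_der; [exact: zeroD| |by left].
move=> [a|c|y] [p' q'] F' h /=; try exact: supp0.
by apply: supp_pd_to h _; congr (_, _) => /=; ring.
Qed.

Lemma supp_hdiff (p q : int) F : supp (p, q) F -> supp (p + 1, q) (hdiff F).
Proof.
move=> h; have -> : (p + 1, q) = (p, q) + (1, 0) :> (int * int)%type.
  by congr (_, _); rewrite addr0.
apply: supp_der h; [exact: zeroD| |by left].
move=> [a|b|x] [p' q'] F' h /=.
- rewrite addrK; exact: supp_lieop.
- have -> : (p', q') + (1, 0) - (1, 1) = (p', q') + (0, -1) :> (int * int)%type.
    by congr (_, _) => /=; ring.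
  apply: suppD; apply: suppN; last exact: supp_brackB.
  by apply: supp_pd_to h _; congr (_, _) => /=; ring.
have -> : (p', q') + (1, 0) - (0, 1) = (p', q') + (1, -1) :> (int * int)%type.
  by congr (_, _) => /=; ring.
exact: supp_hcommX.
Qed.

Lemma wts_count s : wts wt s =
  ((size (als s) + size (bes s))%N%:Z, (size (bes s) + size (xis s))%N%:Z).
Proof.
elim: s => //= t s ->; case: t => c /=; congr (_, _) => /=;
  by rewrite ?add0r ?addSn ?addnS ?intS.
Qed.

Lemma spar_count s : spar par s = odd (size (als s) + size (xis s)).
Proof.
by elim: s => //= t s ->; case: t => c /=; rewrite ?addnS.
Qed.

Lemma twist_supp (p q : nat) F : supp (p%:Z, q%:Z) F -> twist true F = signed (odd (p + q)) F.
Proof.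
move=> h; apply/fnP => s; rewrite signed_fn /twist /=.
have [|/eqP ne] := eqVneq (wts wt s) (p%:Z, q%:Z); last by rewrite h // !signed0.
rewrite wts_count spar_count => -[<- <-].
rewrite !oddD; by case: (odd _) (odd (size (bes s))) (odd _) => -[] [].
Qed.

End WeilModel.

(** * Permutations, shuffles and the Koszul differential by recursion *)
Section Words.
Variables (T : Type).
Implicit Types (s : seq T) (x y : T).

Lemma size_permute s (sigma : 'S_(size s)) : size (permute s sigma) = size s.
Proof. by rewrite size_map size_enum_ord. Qed.

Lemma nth_permute x0 s (sigma : 'S_(size s)) (i : 'I_(size s)) :
  nth x0 (permute s sigma) i = nth x0 s (sigma i).
Proof.
rewrite (nth_map i) ?size_enum_ord // nth_ord_enum.
by rewrite (tnth_nth x0).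
Qed.

(** Every permutation of x :: s is an insertion of x into a permutation of s;
    this turns statements about permutations into inductions on words. *)
Lemma permute_lift x s (j : 'I_(size s).+1) (tau : 'S_(size s)) :
  permute (x :: s) (lift_perm j ord0 tau) =
  take j (permute s tau) ++ x :: drop j (permute s tau).
Proof.
have lt_j : (j <= size s)%N by rewrite -ltnS.
have sz := size_permute tau.
apply: (@eq_from_nth _ x) => [|i].
  rewrite size_permute size_cat /= size_take_min size_drop sz (minn_idPl lt_j).
  by rewrite addnS subnKC.
rewrite size_permute => lt_i.
rewrite (@nth_permute x (x :: s) _ (Ordinal lt_i)) nth_cat size_take_min sz.
rewrite (minn_idPl lt_j); case: (unliftP j (Ordinal lt_i)) => [k|] e.
  rewrite e lift_perm_lift lift0 /= -(nth_permute x tau).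
  have -> : i = bump j k by have := congr1 val e.
  rewrite /bump; case: (leqP j k) => h /=.
    rewrite add1n ltnNge (leq_trans h) //= subSn // /= nth_drop subnKC //.
  by rewrite add0n h nth_take.
rewrite e lift_perm_id; have -> : i = j by have := congr1 val e.
by rewrite ltnn subnn.
Qed.

Lemma perm_lift n (sigma : 'S_n.+1) :
  exists j (tau : 'S_n), sigma = lift_perm j ord0 tau.
Proof.
exists (perm_inv sigma ord0).
pose i0 := perm_inv sigma ord0.
have e0 : sigma i0 = ord0 by rewrite /i0 permKV.
have h k : {k' | lift ord0 k' = sigma (lift i0 k)}.
  case: (unliftP ord0 (sigma (lift i0 k))) => [k' ->|e]; first by exists k'.
  have /perm_inj/eqP := etrans e (esym e0).
  by rewrite eq_sym (negbTE (neq_lift _ _)).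
have inj : injective (fun k => sval (h k)).
  move=> k k' e; apply: (@lift_inj _ i0); apply: (@perm_inj _ sigma).
  by rewrite -(svalP (h k)) -(svalP (h k')) e.
exists (perm inj); apply/permP => i.
case: (unliftP i0 i) => [k ->|->]; last by rewrite lift_perm_id.
by rewrite lift_perm_lift permE (svalP (h k)).
Qed.

Section Signs.
Variable V : zmodType.
Implicit Type F : seq T -> V.

Definition adj_anti F := forall s1 x y s2,
  F (s1 ++ [:: x, y & s2]) = - F (s1 ++ [:: y, x & s2]).

Lemma signzE (b : bool) (v : V) : v *~ (-1) ^+ b = signed b v.
Proof. by case: b; rewrite /= ?expr1 ?mulrN1z ?expr0 ?mulr1z. Qed.

Lemma signnE (n : nat) (v : V) : v *~ (-1) ^+ n = signed (odd n) v.
Proof. by rewrite -signr_odd signzE. Qed.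

Lemma adj_anti_cons x F : adj_anti F -> adj_anti (fun s => F (x :: s)).
Proof. by move=> h s1; exact: (h (x :: s1)). Qed.

Lemma adj_anti_move F x s1 s2 : adj_anti F ->
  F (x :: s1 ++ s2) = signed (odd (size s1)) (F (s1 ++ x :: s2)).
Proof.
elim: s1 F => [|y s1 IH] F hF //=.
rewrite (hF [::]) /= (IH (fun s => F (y :: s))); last exact: adj_anti_cons.
by case: (odd _); rewrite /= ?opprK.
Qed.

Lemma adj_antiP F : adj_anti F -> antisymmetric_map F.
Proof.
move=> hF s; elim: s F hF => [|x s IH] F hF sigma.
  rewrite signzE; have -> : sigma = 1%g by apply/permP => -[].
  rewrite odd_perm1 /=; congr F.
  by apply: size0nil; rewrite size_permute.
have [j [tau ->]] := perm_lift sigma.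
rewrite (@permute_lift x s j tau) odd_lift_perm addbF.
have lt_j : (j <= size s)%N by rewrite -ltnS.
have := adj_anti_move x (take j (permute s tau)) (drop j (permute s tau)) hF.
rewrite size_take_min size_permute (minn_idPl lt_j) cat_take_drop.
rewrite (IH _ (adj_anti_cons x hF)) !signzE => h.
have {}h := congr1 (signed (odd j)) h.
by rewrite !signed_signed addbb /= in h.
Qed.

Lemma permute_tperm s1 x y s2 : exists sigma : 'S_(size (s1 ++ [:: x, y & s2])),
  odd_perm sigma /\ permute (s1 ++ [:: x, y & s2]) sigma = s1 ++ [:: y, x & s2].
Proof.
elim: s1 => [|z s1 [pi [hpi e]]].
  rewrite /=; pose tau := (lift_perm (lift ord0 ord0) ord0 1%g : 'S_(size [:: x, y & s2])).
  exists tau; rewrite odd_lift_perm odd_perm1; split=> //.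
  rewrite /tau (@permute_lift x (y :: s2) (lift ord0 ord0) 1%g).
  have -> : permute (y :: s2) 1 = y :: s2.
    apply: (@eq_from_nth _ x) => [|i]; rewrite size_permute // => hi.
    by rewrite (@nth_permute x (y :: s2) 1%g (Ordinal hi)) perm1.
  by rewrite /= ?take0 ?drop0.
exists (lift_perm ord0 ord0 pi : 'S_(size (z :: (s1 ++ [:: x, y & s2])))).
rewrite odd_lift_perm; split=> //.
by rewrite (@permute_lift z _ ord0 pi) take0 drop0 e.
Qed.

Lemma anti_adj F : antisymmetric_map F -> adj_anti F.
Proof.
move=> h s1 x y s2; have [pi [hpi e]] := permute_tperm s1 x y s2.
by have := h _ pi; rewrite e hpi signzE /= => ->; rewrite opprK.
Qed.

End Signs.

Definition adj_sym (U : Type) (F : seq T -> U) := forall s1 x y s2,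
  F (s1 ++ [:: x, y & s2]) = F (s1 ++ [:: y, x & s2]).

Lemma adj_sym_move (U : Type) (F : seq T -> U) x s1 s2 : adj_sym F ->
  F (x :: s1 ++ s2) = F (s1 ++ x :: s2).
Proof.
elim: s1 F => [|y s1 IH] F hF //=.
by rewrite (hF [::]) /= (IH (fun s => F (y :: s))) // => s; exact: (hF (y :: s)).
Qed.

Lemma adj_symP (U : Type) (F : seq T -> U) : adj_sym F -> symmetric_map F.
Proof.
move=> hF s; elim: s F hF => [|x s IH] F hF sigma.
  by congr F; apply: size0nil; rewrite size_permute.
have [j [tau ->]] := perm_lift sigma.
rewrite (@permute_lift x s j tau) -adj_sym_move // cat_take_drop.
by rewrite (IH (fun s => F (x :: s))) // => s1; exact: (hF (x :: s1)).
Qed.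

Lemma sym_adj (U : Type) (F : seq T -> U) : symmetric_map F -> adj_sym F.
Proof.
move=> h s1 x y s2; have [pi [hpi e]] := permute_tperm s1 x y s2.
by have := h _ pi; rewrite e.
Qed.

End Words.

Section Shuffles.
Variables (T : Type) (V : zmodType).
Implicit Types (s : seq T) (H : seq T -> seq T -> V).

Lemma is_shuffleP a m (sigma : 'S_m) :
  reflect (forall i j : 'I_m, (i < j)%N -> (j < a)%N || (a <= i)%N ->
             (sigma i < sigma j)%N) (is_shuffle a sigma).
Proof.
apply: (iffP forallP) => [h i j ij ha|h i].
  by have /forallP/(_ j)/implyP := h i; apply; rewrite ij ha.
by apply/forallP => j; apply/implyP => /andP[]; exact: h.
Qed.

Lemma is_shuffle_lift0 a m (tau : 'S_m) :
  is_shuffle a.+1 (lift_perm ord0 ord0 tau) = is_shuffle a tau.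
Proof.
apply/is_shuffleP/is_shuffleP => h i j.
  move=> ij ha; have := h (lift ord0 i) (lift ord0 j).
  by rewrite !lift_perm_lift !lift0 !ltnS; apply.
case: (unliftP ord0 i) => [i' ->|->]; case: (unliftP ord0 j) => [j' ->|->] //.
  by rewrite !lift_perm_lift !lift0 !ltnS; apply: h.
by rewrite lift_perm_lift lift_perm_id lift0.
Qed.

Lemma is_shuffle_lift a m (p : 'I_m.+1) (tau : 'S_m) : val p = a ->
  is_shuffle a (lift_perm p ord0 tau) = is_shuffle a tau.
Proof.
move=> pa; apply/is_shuffleP/is_shuffleP => h i j.
  move=> ij ha; have := h (lift p i) (lift p j).
  rewrite !lift_perm_lift !lift0 !ltnS /= pa; apply.
    by rewrite ltnNge leq_bump2 -ltnNge.
  rewrite /bump; move: ha ij; case: (leqP a j) => aj; case: (leqP a i) => //= ai _ ij.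
  - by rewrite (leqW ai) orbT.
  - by rewrite aj.
  - by rewrite aj.
case: (unliftP p i) => [i' ->|->]; case: (unliftP p j) => [j' ->|->].
- rewrite !lift_perm_lift !lift0 !ltnS /= pa => ij ha; apply: h.
    by move: ij; rewrite ltnNge leq_bump2 -ltnNge.
  move: ha; rewrite /bump; case: (leqP a j') => aj; case: (leqP a i') => //= ai.
  by rewrite add1n add0n ltnNge (leqW aj) /= leqNgt ai.
- rewrite pa /= => ia; rewrite pa ltnn /=; rewrite leqNgt.
  by move: ia; rewrite /= pa => ->.
- by move=> _ _; rewrite lift_perm_lift lift_perm_id lift0.
- by rewrite ltnn.
Qed.

(** The first argument can only go to the head of one of the two blocks. *)
Lemma is_shuffle_pos a m (p : 'I_m.+1) (tau : 'S_m) :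
  is_shuffle a (lift_perm p ord0 tau) -> val p = a \/ (val p = 0%N /\ (0 < a)%N).
Proof.
move=> /is_shuffleP h; case: (ltngtP p a) => pa; last by left.
  case: (posnP p) => p0; first by right; rewrite p0 in pa.
  by have := h ord0 p p0; rewrite pa lift_perm_id ltn0 => /(_ isT).
have am : (a < m.+1)%N by apply: ltn_trans pa (ltn_ord p).
by have := h (Ordinal am) p pa; rewrite leqnn orbT lift_perm_id ltn0 => /(_ isT).
Qed.

Lemma sum_lift_perm m (P : pred 'S_m.+1) (f : 'S_m.+1 -> V) :
  \sum_(sigma | P sigma) f sigma =
  \sum_(j < m.+1) \sum_(tau : 'S_m | P (lift_perm j ord0 tau)) f (lift_perm j ord0 tau).
Proof.
rewrite (partition_big (fun s : 'S_m.+1 => perm_inv s ord0) xpredT) //=.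
apply: eq_bigr => j _.
have inj : injective (@lift_perm m j ord0).
  move=> t t' e; apply/permP => i; apply: (@lift_inj _ ord0).
  by rewrite -!(lift_perm_lift j) e.
rewrite [LHS](eq_bigl [pred s | (s \in [set lift_perm j ord0 tau | tau : 'S_m]) && P s]).
  rewrite big_mkcondr /= big_imset /=; last by move=> x y _ _; exact: inj.
  by rewrite -big_mkcondr; apply: eq_bigl => t; rewrite inE.
move=> s /=; rewrite andbC; congr (_ && _); apply/eqP/imsetP => [e|[t _ ->]].
  have [k [tau e']] := perm_lift s; exists tau => //.
  have kj : k = j by apply: (@perm_inj _ s); rewrite -e permKV e' lift_perm_id.
  by rewrite e' kj.
by apply: (@perm_inj _ (lift_perm j ord0 t)); rewrite permKV lift_perm_id.
Qed.

Lemma signed_sum (I : Type) (r : seq I) (P : pred I) (f : I -> V) b :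
  signed b (\sum_(i <- r | P i) f i) = \sum_(i <- r | P i) signed b (f i).
Proof. by case: b => //=; rewrite sumrN. Qed.

(** Either x opens the first block, or it opens the second one and has passed
    over the a letters of the first. *)
Lemma shuffle_sum_cons a H x s :
  shuffle_sum a H (x :: s) =
    (if a is a'.+1 then shuffle_sum a' (fun u v => H (x :: u) v) s else 0)
  + (if (a <= size s)%N then shuffle_sum a (fun u v => H u (x :: v)) s *~ (-1) ^+ a
     else 0).
Proof.
rewrite {1}/shuffle_sum (@sum_lift_perm (size s)).
have E (j : 'I_(size s).+1) : val j = a ->
    \sum_(tau : 'S_(size s) | is_shuffle a (lift_perm j ord0 tau))
      H (take a (permute (x :: s) (lift_perm j ord0 tau)))
        (drop a (permute (x :: s) (lift_perm j ord0 tau)))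
        *~ (-1) ^+ (lift_perm j ord0 tau)
    = shuffle_sum a (fun u v => H u (x :: v)) s *~ (-1) ^+ a.
  move=> ja; rewrite /shuffle_sum signnE signed_sum; apply: eq_big => [tau|tau _].
    exact: is_shuffle_lift.
  have sa : size (take a (permute s tau)) = a.
    apply: size_takel; rewrite size_permute -ja; exact: (ltn_ord j).
  rewrite (@permute_lift _ x s j tau) ja odd_lift_perm addbF ja.
  rewrite -{1 3}sa take_size_cat // drop_size_cat //.
  by rewrite !signzE signed_signed.
have E0 a' : a = a'.+1 ->
    \sum_(tau : 'S_(size s) | is_shuffle a (lift_perm ord0 ord0 tau))
      H (take a (permute (x :: s) (lift_perm ord0 ord0 tau)))
        (drop a (permute (x :: s) (lift_perm ord0 ord0 tau)))
        *~ (-1) ^+ (lift_perm ord0 ord0 tau)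
    = shuffle_sum a' (fun u v => H (x :: u) v) s.
  move=> ->; apply: eq_big => [tau|tau _]; first exact: is_shuffle_lift0.
  by rewrite (@permute_lift _ x s ord0 tau) take0 drop0 odd_lift_perm.
have Z (j : 'I_(size s).+1) : val j <> a -> (val j <> 0%N \/ a = 0%N) ->
    \sum_(tau : 'S_(size s) | is_shuffle a (lift_perm j ord0 tau))
      H (take a (permute (x :: s) (lift_perm j ord0 tau)))
        (drop a (permute (x :: s) (lift_perm j ord0 tau)))
        *~ (-1) ^+ (lift_perm j ord0 tau) = 0.
  move=> ja j0; apply: big_pred0 => tau; apply/negP => /is_shuffle_pos[//|[h1 h2]].
  by case: j0 => // a0; rewrite a0 in h2.
case: a E E0 Z => [|a] E E0 Z.
  rewrite add0r /= big_ord_recl E // big1 ?addr0 // => j _.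
  by apply: Z; [rewrite /= /bump|right].
rewrite big_ord_recl (E0 a) //; congr (_ + _); case: ltnP => ha.
  pose k : 'I_(size s) := Ordinal ha.
  rewrite (bigD1 k) //= E // big1 ?addr0 // => j jk; apply: Z; last by left.
  rewrite /= /bump add1n => -[e]; case/eqP: jk; exact: val_inj.
rewrite big1 // => j _; apply: Z; last by left.
rewrite /= /bump add1n => -[e].
by have := ltn_ord j; rewrite e ltnNge ha.
Qed.

(** Shuffles of all types together satisfy a recursion without side
    conditions; the type is recovered from the support of H, see
    [all_shuffles_shuffle]. *)
Fixpoint all_shuffles H s : V :=
  if s is x :: s' then
    all_shuffles (fun u v => H (x :: u) v) s'
    + all_shuffles (fun u v => H u (x :: v) *~ (-1) ^+ size u) s'
  else H [::] [::].

Lemma eq_all_shuffles H H' s : (forall u v, H u v = H' u v) -> all_shuffles H s = all_shuffles H' s.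
Proof.
elim: s H H' => [|x s IH] H H' e /=; first exact: e.
by congr (_ + _); apply: IH => u v; rewrite e.
Qed.

Lemma eq_shuffle_sum a H H' s : (forall u v, H u v = H' u v) ->
  shuffle_sum a H s = shuffle_sum a H' s.
Proof. by move=> e; apply: eq_bigr => sigma _; rewrite e. Qed.

Lemma shuffle_sum0 a s : shuffle_sum a (fun _ _ => 0) s = 0 :> V.
Proof. by apply: big1 => sigma _; rewrite mul0rz. Qed.

Lemma shuffle_sum_signed a b H s :
  shuffle_sum a (fun u v => signed b (H u v)) s = signed b (shuffle_sum a H s).
Proof.
by case: b => //=; rewrite /shuffle_sum -sumrN; apply: eq_bigr => i _; rewrite mulNrz.
Qed.

Lemma shuffle_sum_big a H s : (size s < a)%N ->
  (forall u v, size u <> a -> H u v = 0) -> shuffle_sum a H s = 0.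
Proof.
move=> sa h; apply: big1 => sigma _; rewrite h ?mul0rz // size_take_min size_permute.
by rewrite (minn_idPr (ltnW sa)) => e; rewrite e ltnn in sa.
Qed.

Lemma all_shuffles_shuffle a H s : (forall u v, size u <> a -> H u v = 0) ->
  all_shuffles H s = shuffle_sum a H s.
Proof.
elim: s a H => [|x s IH] a H h /=.
  rewrite /shuffle_sum (big_pred1 (1%g : 'S_(size [::]))) ?odd_perm1 ?mulr1z.
    have -> : permute [::] 1%g = [::] :> seq T by apply: size0nil; rewrite size_permute.
    by rewrite take_oversize.
  move=> sigma; have -> : sigma = 1%g by apply/permP => -[].
  by rewrite [RHS]eqxx; apply/is_shuffleP => -[].
rewrite shuffle_sum_cons; congr (_ + _).
  case: a h => [|a] h.
    by rewrite (IH 0%N) ?(eq_shuffle_sum 0 (H' := fun _ _ => 0)) ?shuffle_sum0 // => u v;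
      move=> *; rewrite h.
  by apply: IH => u v ua; apply: h => -[].
rewrite (IH a); last by move=> u v ua; rewrite h // mul0rz.
case: leqP => sa; last first.
  by apply: shuffle_sum_big => // u v ua; rewrite h // mul0rz.
rewrite signnE -shuffle_sum_signed; apply: eq_shuffle_sum => u v.
have [<-|/eqP ne] := eqVneq (size u) a; first by rewrite signnE.
by rewrite h // mul0rz signed0.
Qed.

End Shuffles.

Section Cartan.
Variables (T : Type) (V : zmodType) (br : T -> T -> T) (act : T -> V -> V).
Implicit Types (s : seq T) (F : seq T -> V).

Lemma lie_der_nil x F : lie_der br act x F [::] = act x (F [::]).
Proof. by rewrite /lie_der big_ord0 subr0. Qed.

Lemma lie_der_cons x F y s :
  lie_der br act x F (y :: s) =
    lie_der br act x (fun u => F (y :: u)) s - F (br x y :: s).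
Proof.
rewrite /lie_der big_ord_recl /= (tnth_nth x) /= [in LHS]addrC opprD.
rewrite -addrA addrC; congr (_ - _); rewrite addrC; congr (_ - _).
by apply: eq_bigr => j _; rewrite !(tnth_nth x).
Qed.

Lemma omit_cons x s i : omit i.+1 (x :: s) = x :: omit i s.
Proof. by []. Qed.

Lemma omit_head x s : omit 0 (x :: s) = s.
Proof. by rewrite /omit take0 /= drop0. Qed.

(** Cartan's formula i_x d + d i_x = L_x for the Koszul differential: the terms
    involving the first argument form the Lie derivative along it. *)
Lemma koszul_cons c x s : adj_anti c ->
  koszul br act c (x :: s) =
    lie_der br act x c s - koszul br act (fun u => c (x :: u)) s.
Proof.
move=> hc; rewrite {1}/koszul /=; have b0 k : bump 0 k = k.+1 by [].
rewrite big_ord_recl [X in _ + X = _]big_ord_recl /=.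
have -> : \sum_(j < (size s).+1 | (0 < j)%N)
    c (br (tnth (in_tuple (x :: s)) ord0) (tnth (in_tuple (x :: s)) j)
       :: omit 0 (omit j (x :: s))) *~ (-1) ^+ (0 + j)
  = - \sum_(j < size s) c (set_nth x s j (br x (tnth (in_tuple s) j))).
  rewrite big_mkcond big_ord_recl /= add0r -sumrN; apply: eq_bigr => j _.
  rewrite !(tnth_nth x) signnE add0n /= !b0 omit_cons omit_head /=.
  rewrite set_nthE ltn_ord /omit adj_anti_move //.
  by rewrite (size_takel (ltnW (ltn_ord j))) add0n signed_signed addNb addbb.
have -> : \sum_(i < size s) \sum_(j < (size s).+1 | (bump 0 i < j)%N)
    c (br (tnth (in_tuple (x :: s)) (lift ord0 i)) (tnth (in_tuple (x :: s)) j)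
       :: omit (bump 0 i) (omit j (x :: s))) *~ (-1) ^+ (bump 0 i + j)
  = - \sum_(i < size s) \sum_(j < size s | (i < j)%N)
    c (x :: br (tnth (in_tuple s) i) (tnth (in_tuple s) j) :: omit i (omit j s))
       *~ (-1) ^+ (i + j).
  rewrite -sumrN; apply: eq_bigr => i _.
  rewrite big_mkcond big_ord_recl /= add0r -big_mkcond /= -sumrN.
  apply: eq_big => [j|j _]; first by rewrite /= !b0 ltnS.
  rewrite !(tnth_nth x) /= !b0 !omit_cons (hc [::]) /= addnS addSn.
  by rewrite mulNrz 2!exprS !mulN1r opprK.
have -> : \sum_(i < size s) act (tnth (in_tuple (x :: s)) (lift ord0 i))
     (c (omit (bump 0 i) (x :: s))) *~ (-1) ^+ bump 0 i
  = - \sum_(i < size s) act (tnth (in_tuple s) i) (c (x :: omit i s)) *~ (-1) ^+ i.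
  rewrite -sumrN; apply: eq_bigr => i _.
  by rewrite !(tnth_nth x) /= b0 omit_cons exprS mulN1r mulrNz.
rewrite (tnth_nth x) /= omit_head expr0 mulr1z /lie_der /koszul opprD.
rewrite addrACA; congr (_ + _).
by rewrite addrC.
Qed.

End Cartan.

Section SumsOfShuffles.
Variables (T : Type) (V : zmodType).
Implicit Types (s : seq T).

Lemma all_shuffles_sum n (H : 'I_n -> seq T -> seq T -> V) s :
  all_shuffles (fun u v => \sum_(i < n) H i u v) s = \sum_(i < n) all_shuffles (H i) s.
Proof.
elim: s H => [|x s IH] H //=.
rewrite (IH (fun i u v => H i (x :: u) v)) big_split /=; congr (_ + _).
rewrite -IH; apply: eq_all_shuffles => u v.
by rewrite signnE signed_sum; apply: eq_bigr => i _; rewrite signnE.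
Qed.

End SumsOfShuffles.

(** * The differentials and the product on sorted words *)
Section WordFormulas.
Variables (C : comPzRingType) (G X : lmodType C).
Variables (LG : lie_rinehart G) (LX : lie_rinehart X) (rho : G -> X).
Hypothesis rhoP : anchored LG LX rho.
Local Notation letter := (letter G X).
Local Notation fn := (seq letter -> C).
Local Notation par := (@par C G X).
Local Notation sform := (sform par (@splits C G X)).
Local Notation Al := (@Al C G X).
Local Notation Be := (@Be C G X).
Local Notation Xi := (@Xi C G X).
Local Notation vdiff := (@vdiff C G X LX).
Local Notation hdiff := (@hdiff C G X LG LX rho).
Local Notation smul := (smul par).
Local Notation nword := (@nword C G X).
Implicit Types (F H : fn).

Lemma sform_app w F : sform F -> sform (fun r => F (w ++ r)).
Proof.
elim: w F => [|t w IH] F gF //; exact: (IH (pd t F) (sform_pd t gF)).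
Qed.

Lemma sform_Xi_anti F : sform F -> adj_anti (fun xs => F (map Xi xs)).
Proof.
by move=> [h _] s1 x y s2; rewrite !map_cat /= h.
Qed.

Lemma sform_Al_anti F : sform F ->
  adj_anti (fun as_ bs xs => F (nword as_ bs xs) : C).
Proof.
move=> [h _] s1 x y s2; apply/funext => bs; apply/funext => xs.
rewrite -[RHS]/(- F (nword (s1 ++ [:: y, x & s2]) bs xs)).
by rewrite /nword !map_cat -!catA /= h.
Qed.

Lemma lieX_Xi x F xs :
  lieX LX x F (map Xi xs) = lie_der (brk LX) (act LX) x (fun ys => F (map Xi ys)) xs.
Proof.
elim: xs F => [|y xs IH] F; first by rewrite lie_der_nil.
by rewrite lie_der_cons /= (fn_cons (lieX _ _ _)) pd_lieX fnE IH.
Qed.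

Lemma vdiff_Xi F xs : sform F ->
  vdiff F (map Xi xs) = koszul (brk LX) (act LX) (fun ys => F (map Xi ys)) xs.
Proof.
elim: xs F => [|x xs IH] F gF; first by rewrite /koszul !big_ord0 addr0.
rewrite koszul_cons; last exact: sform_Xi_anti.
rewrite /= (fn_cons (vdiff _)) pdX_vdiff !fnE IH; last exact: sform_pd.
by rewrite lieX_Xi addrC.
Qed.

Lemma vdiff_Al F as_ r :
  vdiff F (map Al as_ ++ r) = signed (odd (size as_)) (vdiff (fun r => F (map Al as_ ++ r)) r).
Proof.
elim: as_ F => [|a as_ IH] F //=.
rewrite (fn_cons (vdiff _)) pdA_vdiff fnE IH -signedN.
by case: (odd _); rewrite //= opprK.
Qed.

(** Each of the k equal letters contributes the same commutator, which accounts
    for the factor k. *)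
Lemma vdiff_Be F k a r : sform F ->
  vdiff F (nseq k (Be a) ++ r) =
    vdiff (fun r => F (nseq k (Be a) ++ r)) r + F (Al a :: nseq k.-1 (Be a) ++ r) *+ k.
Proof.
elim: k F => [|k IH] F gF; first by rewrite addr0.
rewrite /= (fn_cons (vdiff _)) pdB_vdiff fnE IH; last exact: sform_pd.
rewrite -addrA mulrSr; congr (_ + _); congr (_ + _).
case: k {IH} => [|k] //=; congr (_ *+ _).
by have [h _] := gF; rewrite /pd (h [::]).
Qed.

Lemma nword_rcons as_ a bs xs :
  nword (rcons as_ a) bs xs = map Al as_ ++ Al a :: map Be bs ++ map Xi xs.
Proof. by rewrite /nword map_rcons cat_rcons. Qed.

Lemma vdiff_nword F as_ k a xs : sform F ->
  vdiff F (nword as_ (nseq k a) xs) = signed (odd (size as_))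
    (koszul (brk LX) (act LX) (fun ys => F (nword as_ (nseq k a) ys)) xs
     + F (nword (rcons as_ a) (nseq k.-1 a) xs) *+ k).
Proof.
move=> gF; rewrite nword_rcons /nword !map_nseq vdiff_Al; congr signed.
rewrite vdiff_Be; last exact: sform_app.
by rewrite vdiff_Xi //; apply: sform_app (sform_app _ _).
Qed.

Definition lieF (b : G) (w : seq X -> C) : seq X -> C :=
  lie_der (brk LX) (act LX) (rho b) w.
Definition lieFS (a : G) (P : seq G -> seq X -> C) : seq G -> seq X -> C :=
  lie_der (brk LG) lieF a P.

Lemma lieA_nword a F as_ bs xs :
  lieA LG LX rho a F (nword as_ bs xs) =
  lie_der (brk LG) lieFS a (fun as_ bs xs => F (nword as_ bs xs)) as_ bs xs.
Proof.
elim: as_ F => [|b as_ IH] F; last first.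
  by rewrite lie_der_cons nword_Al pd_lieA fnE IH.
rewrite lie_der_nil /lieFS; elim: bs F => [|b bs IH] F; last first.
  by rewrite lie_der_cons nword_Be pd_lieA fnE IH.
rewrite lie_der_nil /lieF; elim: xs F => [|x xs IH] F; last first.
  by rewrite lie_der_cons /nword /= (fn_cons (lieA _ _ _ _ _)) pd_lieA fnE IH.
by rewrite lie_der_nil.
Qed.

Lemma anchE_xionly F xs : anchE rho F (map Xi xs) = 0.
Proof.
elim: xs F => [|x xs IH] F //.
by rewrite /= (fn_cons (anchE _ _)) pdX_anchE fnE IH oppr0.
Qed.

Lemma anchE_Be F k a xs : sform F ->
  anchE rho F (nseq k (Be a) ++ map Xi xs) =
    F (nseq k.-1 (Be a) ++ Xi (rho a) :: map Xi xs) *+ k.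
Proof.
elim: k F => [|k IH] F gF; first exact: anchE_xionly.
rewrite /= (fn_cons (anchE _ _)) pdB_anchE fnE IH; last exact: sform_pd.
rewrite mulrSr; congr (_ + _); first by case: k {IH}.
rewrite -[LHS]/(F (Xi (rho a) :: nseq k (Be a) ++ map Xi xs)) sform_move //.
have -> : spar par (nseq k (Be a)) = false by elim: k {IH} => //= k ->.
by rewrite andbF.
Qed.

Lemma hdiff_nword F as_ k a xs : sform F ->
  hdiff F (nword as_ (nseq k a) xs) =
    koszul (brk LG) lieFS (fun as_ bs xs => F (nword as_ bs xs) : C) as_ (nseq k a) xs
    - signed (odd (size as_)) (F (nword as_ (nseq k.-1 a) (rho a :: xs)) *+ k).
Proof.
elim: as_ F => [|b as_ IH] F gF.
  rewrite /koszul !big_ord0 addr0 hdiff_alfree; last exact: alfree_nword.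
  by rewrite /nword /= !map_nseq anchE_Be // add0r.
rewrite koszul_cons; last exact: sform_Al_anti.
rewrite nword_Al pdA_hdiff fnE fnN IH; last exact: sform_pd.
rewrite lieA_nword.
rewrite -[RHS]/(lie_der (brk LG) lieFS b (fun as_ bs xs => F (nword as_ bs xs)) as_ (nseq k a) xs
  - koszul (brk LG) lieFS (fun as_ bs xs => pd (Al b) F (nword as_ bs xs)) as_ (nseq k a) xs
  - signed (~~ odd (size as_)) (pd (Al b) F (nword as_ (nseq k.-1 a) (rho a :: xs)) *+ k)).
move: (lie_der _ _ _ _ _ _ _) => z; move: (koszul _ _ _ _ _ _) => K.
rewrite opprB addrC -addrA; congr (_ + _).
by case: (odd _); rewrite /= ?opprK addrC.
Qed.

Lemma twist_app e F w : (fun r => twist par e F (w ++ r)) =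
  signed (e && spar par w) (twist par e (fun r => F (w ++ r))).
Proof.
apply/fnP => r; rewrite signed_fn /twist spar_cat signed_signed.
by case: e.
Qed.

Lemma smul_Al F H as_ r :
  smul F H (map Al as_ ++ r) =
  all_shuffles (fun u v => smul (twist par (odd (size v)) (fun r => F (map Al u ++ r)))
                        (fun r => H (map Al v ++ r)) r) as_.
Proof.
elim: as_ F H => [|a as_ IH] F H //.
rewrite /= (fn_cons (smul _ _)) pd_smul fnE !IH; congr (_ + _).
apply: eq_all_shuffles => u v; rewrite twist_app spar_Al signnE andTb.
have -> : twist par (odd (size v)) (signed (odd (size u)) (twist par true (fun r =>
  F (map Al u ++ r))))
   = signed (odd (size u)) (twist par (odd (size (a :: v))) (fun r => F (map Al u ++ r))).
  by case: (odd (size u)); rewrite /= ?twistN twistT addbT.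
by rewrite smul_signedl signed_fn.
Qed.

Lemma pascal_sum (V : zmodType) (g : nat -> V) k :
  \sum_(i < k.+1) g i.+1 *+ 'C(k, i) + \sum_(i < k.+1) g i *+ 'C(k, i) =
  \sum_(i < k.+2) g i *+ 'C(k.+1, i).
Proof.
have -> : \sum_(i < k.+1) g i *+ 'C(k, i) = \sum_(i < k.+2) g i *+ 'C(k, i).
  by rewrite [RHS]big_ord_recr /= bin_small // mulr0n addr0.
rewrite !(big_ord_recl k.+1) !bin0 addrCA; congr (_ + _).
by rewrite -big_split; apply: eq_bigr => i _; rewrite /= binS mulrnDr addrC.
Qed.

(** Equal even letters are distributed in binomially many identical ways. *)
Lemma smul_Be F H k a r :
  smul F H (nseq k (Be a) ++ r) =
  \sum_(i < k.+1) smul (fun r => F (nseq i (Be a) ++ r))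
                      (fun r => H (nseq (k - i) (Be a) ++ r)) r *+ 'C(k, i).
Proof.
elim: k F H => [|k IH] F H; first by rewrite big_ord1 bin0.
pose g i := smul (fun r => F (nseq i (Be a) ++ r)) (fun r => H (nseq (k.+1 - i) (Be a) ++ r)) r.
rewrite /= (fn_cons (smul _ _)) pd_smul fnE !IH -(pascal_sum g); congr (_ + _).
by apply: eq_bigr => i _; rewrite /g subSn // -ltnS.
Qed.

Lemma smul_Xi F H xs :
  smul F H (map Xi xs) = all_shuffles (fun u v => F (map Xi u) * H (map Xi v)) xs.
Proof.
elim: xs F H => [|x xs IH] F H //.
rewrite /= (fn_cons (smul _ _)) pd_smul fnE !IH; congr (_ + _).
apply: eq_all_shuffles => u v; rewrite /twist spar_Xi signnE /=.
by case: (odd _) => //=; rewrite mulNr.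
Qed.

Lemma smul_nword F H as_ k a xs :
  smul F H (nword as_ (nseq k a) xs) =
  \sum_(i < k.+1) all_shuffles (fun u v =>
    all_shuffles (fun y z => signed (odd (size v) && odd (size y))
      (F (nword u (nseq i a) y) * H (nword v (nseq (k - i) a) z))) xs *+ 'C(k, i)) as_.
Proof.
rewrite {1}/nword smul_Al -all_shuffles_sum; apply: eq_all_shuffles => u v.
rewrite map_nseq smul_Be; apply: eq_bigr => i _; congr (_ *+ _).
rewrite smul_Xi; apply: eq_all_shuffles => y z.
rewrite /nword !map_nseq /twist spar_cat spar_Xi.
have -> : spar par (nseq i (Be a)) = false by elim: (val i) => //= m ->.
by case: (_ && _); rewrite //= mulNr.
Qed.

End WordFormulas.

Section Spread.
Variables (C : comPzRingType) (G X : lmodType C).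
Local Notation letter := (letter G X).
Local Notation fn := (seq letter -> C).
Local Notation par := (@par C G X).
Local Notation sform := (sform par (@splits C G X)).
Local Notation Al := (@Al C G X).
Local Notation Be := (@Be C G X).
Local Notation Xi := (@Xi C G X).
Local Notation nword := (@nword C G X).
Local Notation als := (@als C G X).
Local Notation bes := (@bes C G X).
Local Notation xis := (@xis C G X).
Local Notation xinv := (@xinv C G X).
Variable K : seq G -> seq G -> seq X -> C.

(** Extends a function of sorted words to all words by the sign of sorting. *)
Definition spread : fn := fun s => signed (xinv s) (K (als s) (bes s) (xis s)).

Lemma als_cat s1 s2 : als (s1 ++ s2) = als s1 ++ als s2. Proof. exact: pmap_cat. Qed.
Lemma bes_cat s1 s2 : bes (s1 ++ s2) = bes s1 ++ bes s2. Proof. exact: pmap_cat. Qed.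
Lemma xis_cat s1 s2 : xis (s1 ++ s2) = xis s1 ++ xis s2. Proof. exact: pmap_cat. Qed.

Lemma als_nword as_ bs xs : als (nword as_ bs xs) = as_.
Proof.
rewrite /nword !als_cat; elim: as_ => [|a as_ IH] /=; last by rewrite IH.
by elim: bs => //=; elim: xs.
Qed.
Lemma bes_nword as_ bs xs : bes (nword as_ bs xs) = bs.
Proof.
rewrite /nword !bes_cat; elim: as_ => [|a as_ IH] /=; last by rewrite IH.
by elim: bs => [|b bs /= ->] //=; elim: xs.
Qed.
Lemma xis_nword as_ bs xs : xis (nword as_ bs xs) = xs.
Proof.
rewrite /nword !xis_cat; elim: as_ => [|a as_ IH] /=; last by rewrite IH.
by elim: bs => //=; elim: xs => //= x xs ->.
Qed.
Lemma xinv_nword as_ bs xs : xinv (nword as_ bs xs) = false.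
Proof.
rewrite /nword; elim: as_ => [|a as_ IH] //=; elim: bs => [|b bs IH] //=.
elim: xs => [|x xs IH] //=; rewrite IH.
by have -> : als (map Xi xs) = [::] by elim: xs {IH}.
Qed.

Lemma spread_nword as_ bs xs : spread (nword as_ bs xs) = K as_ bs xs.
Proof. by rewrite /spread xinv_nword als_nword bes_nword xis_nword. Qed.

Lemma xinv_cat s1 s2 : xinv (s1 ++ s2) =
  xinv s1 (+) (odd (size (xis s1)) && odd (size (als s2))) (+) xinv s2.
Proof.
elim: s1 => //= t s1 ->; rewrite als_cat size_cat oddD.
case: t => c /=; rewrite ?addbA //.
case: (odd (size (als s1))) (odd (size (als s2))) (xinv s1) (odd (size (xis s1))) (xinv s2);
  by do 4 case.
Qed.

Hypothesis antiA : adj_anti (fun as_ => K as_).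
Hypothesis symB : forall as_, adj_sym (K as_).
Hypothesis antiX : forall as_ bs, adj_anti (K as_ bs).
Hypothesis addA : forall s1 s2 a b bs xs,
  K (s1 ++ (a + b) :: s2) bs xs = K (s1 ++ a :: s2) bs xs + K (s1 ++ b :: s2) bs xs.
Hypothesis addB : forall as_ s1 s2 a b xs,
  K as_ (s1 ++ (a + b) :: s2) xs = K as_ (s1 ++ a :: s2) xs + K as_ (s1 ++ b :: s2) xs.
Hypothesis addX : forall as_ bs s1 s2 x y,
  K as_ bs (s1 ++ (x + y) :: s2) = K as_ bs (s1 ++ x :: s2) + K as_ bs (s1 ++ y :: s2).

(** For two letters of the same kind the claim is the corresponding hypothesis;
    for two different kinds the sorted word does not change, and [xinv] changes
    exactly when an [Al] and a [Xi] are exchanged. *)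
Lemma sform_spread : sform spread.
Proof.
have aA s1 x y s2 bs xs : K (s1 ++ [:: x, y & s2]) bs xs = - K (s1 ++ [:: y, x & s2]) bs xs.
  by rewrite antiA.
split=> [s1 t u s2|s1 s2 t u w].
  rewrite /spread !als_cat !bes_cat !xis_cat !xinv_cat /=.
  case: t => c; case: u => d //=.
  - by rewrite aA; case: (_ (+) _).
  - rewrite -[RHS]/(signed true (signed _ _)) signed_signed; congr signed.
    by case: (xinv s1) (odd _) (odd _) (xinv s2) => -[] [] [].
  - by rewrite symB.
  - rewrite -[RHS]/(signed true (signed _ _)) signed_signed; congr signed.
    by case: (xinv s1) (odd _) (odd _) (xinv s2) => -[] [] [].
  - by rewrite antiX signedN.
case=> a b; rewrite /spread !als_cat !bes_cat !xis_cat !xinv_cat /=.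
- by rewrite addA signedD.
- by rewrite addB signedD.
- by rewrite addX signedD.
Qed.

End Spread.

Section Additivity.
Variables (V W : zmodType) (f : V -> W).
Hypothesis fD : {morph f : x y / x + y}.

Lemma morph_add0 : f 0 = 0.
Proof. by apply: (addrI (f 0)); rewrite -fD !addr0. Qed.
Lemma morph_addN x : f (- x) = - f x.
Proof. by apply: (addrI (f x)); rewrite -fD !subrr morph_add0. Qed.
Lemma morph_signed b x : f (signed b x) = signed b (f x).
Proof. by case: b => //; exact: morph_addN. Qed.
Lemma morph_mulrn m x : f (x *+ m) = f x *+ m.
Proof. by elim: m => [|m IH]; rewrite ?morph_add0 // !mulrS fD IH. Qed.
Lemma morph_sum (I : Type) (r : seq I) (P : pred I) (g : I -> V) :
  f (\sum_(i <- r | P i) g i) = \sum_(i <- r | P i) f (g i).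
Proof. by rewrite (big_morph f fD morph_add0). Qed.

Lemma koszul_morph (T : Type) (br : T -> T -> T) (act : T -> V -> V)
    (act' : T -> W -> W) c s : (forall x v, f (act x v) = act' x (f v)) ->
  f (koszul br act c s) = koszul br act' (fun s => f (c s)) s.
Proof.
move=> h; rewrite /koszul fD !morph_sum; congr (_ + _); apply: eq_bigr => i _.
  by rewrite morph_sum; apply: eq_bigr => j _; rewrite !signnE morph_signed.
by rewrite !signnE morph_signed h.
Qed.

Lemma all_shuffles_morph (T : Type) (H : seq T -> seq T -> V) s :
  f (all_shuffles H s) = all_shuffles (fun u v => f (H u v)) s.
Proof.
elim: s H => [|x s IH] H //=; rewrite fD !IH; congr (_ + _).
by apply: eq_all_shuffles => u v; rewrite !signnE morph_signed.
Qed.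

End Additivity.

Lemma lie_derD (T : Type) (V : zmodType) (br : T -> T -> T) (act : T -> V -> V) x :
  {morph act x : v w / v + w} -> {morph lie_der br act x : F H / F + H}.
Proof.
move=> h F H; apply/funext => s.
rewrite -[RHS]/(lie_der br act x F s + lie_der br act x H s) /lie_der h.
by rewrite big_split /= opprD addrACA.
Qed.

Lemma shuffle_sum_fun (T U : Type) (V : zmodType) a (H : seq T -> seq T -> U -> V) s u :
  shuffle_sum a H s u = shuffle_sum a (fun y z => H y z u) s.
Proof.
rewrite /shuffle_sum fct_sumE; apply: eq_bigr => sigma _.
by rewrite !signzE; case: (odd_perm sigma).
Qed.

(** * Vector fields and sections of a Lie algebroid *)
Section Geometry.
Variables (R : realType) (n : nat) (M : manifold R n).
Implicit Types (X Y Z : vfield M) (f g : Cinf M).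

Lemma vfieldP X Y : (forall f, lie_fun X f = lie_fun Y f) -> X = Y.
Proof.
move=> h; apply/val_inj/functional_extensionality_dep => x.
apply: (@val_inj _ _ (tangent x)); apply/funext => f.
exact: (congr1 (fun g : Cinf M => cval g x : R^o) (h f)).
Qed.

Lemma lie_funDl X Y f : lie_fun (X + Y) f = lie_fun X f + lie_fun Y f.
Proof. exact/val_inj/funext. Qed.
Lemma lie_funNl X f : lie_fun (- X) f = - lie_fun X f.
Proof. exact/val_inj/funext. Qed.
Lemma lie_funZl g X f : lie_fun (g *: X) f = g * lie_fun X f.
Proof. exact/val_inj/funext. Qed.
Lemma lie_fun_vbracket X Y f :
  lie_fun (vbracket X Y) f = lie_fun X (lie_fun Y f) - lie_fun Y (lie_fun X f).
Proof. exact/val_inj/funext. Qed.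
Lemma lie_funN X f : lie_fun X (- f) = - lie_fun X f.
Proof.
have h0 : lie_fun X 0 = 0 by apply: (addrI (lie_fun X 0)); rewrite -lie_funD !addr0.
by apply: (addrI (lie_fun X f)); rewrite -lie_funD !subrr.
Qed.

Lemma vfield_lie_rinehart : lie_rinehart (vfield M).
Proof.
apply: (@LieRinehart _ _ (@lie_fun R n M) (@vbracket R n M)).
- by move=> X f g; exact: lie_funD.
- by move=> X f g; rewrite lie_funM; ring.
- exact: lie_funDl.
- by move=> f X g; exact: lie_funZl.
- move=> X Y Z; apply: vfieldP => f.
  by rewrite lie_funDl !lie_fun_vbracket !lie_funDl lie_funD; ring.
- by move=> X Y; apply: vfieldP => f; rewrite lie_funNl !lie_fun_vbracket opprB.
- move=> X Y Z; apply: vfieldP => f.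
  rewrite lie_funDl lie_funNl !lie_fun_vbracket !lie_funD !lie_funN; ring.
- move=> X g Y; apply: vfieldP => f.
  rewrite lie_funDl !lie_funZl !lie_fun_vbracket !lie_funZl lie_funM; ring.
- exact: lie_fun_vbracket.
Defined.

Variable A : lie_algebroid M.
Implicit Types (a b : gsec A).

Lemma cst1 : cinf_cst M 1 = 1. Proof. exact/val_inj. Qed.
Lemma anchorD : {morph @anchor R n M A : a b / a + b}.
Proof.
move=> a b; apply: vfieldP => f; apply/val_inj/funext => x.
have e : gsval (a + b) x = gsval a x + gsval b x by [].
rewrite lie_funDl /= /along /= /push e (linearD (anchor_map A x)).
by [].
Qed.

Lemma anchorZ g a : anchor (g *: a) = g *: anchor a.
Proof.
apply: vfieldP => f; apply/val_inj/funext => x.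
have e : gsval (g *: a) x = g x *: gsval a x by [].
rewrite lie_funZl /= /along /= /push e linearZ.
by [].
Qed.

Lemma lbracketD a : {morph lbracket a : b c / b + c}.
Proof. by move=> b c; have := lbracket_linear 1 a b c; rewrite cst1 !scale1r. Qed.
Lemma lbracketN a b : lbracket a (- b) = - lbracket a b.
Proof.
have h0 : lbracket a 0 = 0.
  by apply: (addrI (lbracket a 0)); rewrite -lbracketD !addr0.
by apply: (addrI (lbracket a b)); rewrite -lbracketD !subrr.
Qed.

Lemma gsec_lie_rinehart : lie_rinehart (gsec A).
Proof.
apply: (@LieRinehart _ _ (fun a => lie_fun (anchor a)) (@lbracket R n M A)).
- by move=> X f g; exact: lie_funD.
- by move=> X f g; rewrite lie_funM; ring.
- by move=> a b f; rewrite anchorD lie_funDl.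
- by move=> f a g; rewrite anchorZ lie_funZl.
- exact: lbracketD.
- exact: lbracket_antisym.
- move=> a b c; apply/eqP; rewrite eq_sym subr_eq; apply/eqP.
  have := lbracket_jacobi a b c; rewrite (lbracket_antisym c (lbracket a b)).
  rewrite (lbracket_antisym c a) lbracketN => /eqP; rewrite subr_eq0 => /eqP <-.
  by rewrite subrK.
- exact: lbracket_leibniz.
- by move=> a b f; rewrite /anchor anchor_bracket lie_fun_vbracket.
Defined.

Lemma anchorP : anchored gsec_lie_rinehart vfield_lie_rinehart (@anchor R n M A).
Proof.
split; [exact: anchorD|exact: anchorZ|by []|exact: anchor_bracket].
Qed.

End Geometry.

(** * Cochains as superfunctions *)
Section Comparison.
Variables (R : realType) (n : nat) (M : manifold R n) (A : lie_algebroid M).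
Local Notation C := (Cinf M).
Local Notation Gamma := (gsec A).
Local Notation LG := (gsec_lie_rinehart A).
Local Notation LX := (vfield_lie_rinehart M).
Local Notation letter := (@letter C Gamma (vfield M)).
Local Notation fn := (seq letter -> C).
Local Notation par := (@par C Gamma (vfield M)).
Local Notation sform := (sform par (@splits C Gamma (vfield M))).
Local Notation weilfn := (@weilfn C Gamma (vfield M) LX).
Local Notation Al := (@Al C Gamma (vfield M)).
Local Notation Be := (@Be C Gamma (vfield M)).
Local Notation Xi := (@Xi C Gamma (vfield M)).
Local Notation vdiff := (@vdiff C Gamma (vfield M) LX).
Local Notation hdiff := (@hdiff C Gamma (vfield M) LG LX (@anchor R n M A)).
Local Notation smul := (smul par).
Local Notation nword := (@nword C Gamma (vfield M)).
Local Notation supp := (supp (@wt C Gamma (vfield M))).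
Local Notation cst := (cinf_cst M).
Implicit Types (F H : fn) (c : cochain A) (p q i k : nat).

(** The conditions of [is_weil] one variable at a time, with all the degree
    conditions merged into one and symmetries expressed by adjacent
    transpositions. *)
Record weil_facts p q c : Prop := {
  wf_supp : forall i as_ bs xs,
    ~ [/\ (size as_ + i)%N = p, size bs = i & (i + size xs)%N = q] -> c i as_ bs xs = 0;
  wf_antiA : forall i, adj_anti (c i);
  wf_symB : forall i as_, adj_sym (c i as_);
  wf_antiX : forall i as_ bs, adj_anti (c i as_ bs);
  wf_linA : forall i, multilinear cst (c i);
  wf_linB : forall i as_, multilinear id (c i as_);
  wf_linX : forall i as_ bs, multilinear id (c i as_ bs);
  wf_leib : forall i as_ f a, c i (rcons as_ (f *: a)) =
    f *: c i (rcons as_ a) - wedgeS 1 (dDR (form0 f)) (partialS a (c i.+1 as_)) }.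

Lemma is_weilP p q c : is_weil p q c <-> weil_facts p q c.
Proof.
split=> [h|[h1 h2 h3 h4 h5 h6 h7 h8] i].
  split=> [i as_ bs xs ne|i|i as_|i as_ bs|i|i as_|i as_ bs|i].
  - have [w1 _ _ w4 _] := h i; have := w4 as_.
    have [e1|/eqP e1] := eqVneq (size as_ + i)%N p; last by rewrite w1.
    case: leqP => iq; last by move=> ->.
    case=> b1 b2 _ _; have [e2|/eqP e2] := eqVneq (size bs) i; last by rewrite b1.
    have [x1 _ _] := b2 bs; rewrite x1 // => e3; apply: ne; split=> //.
    by rewrite e3 subnKC.
  - by have [_ w2 _ _ _] := h i; exact: anti_adj.
  - have [_ _ _ /(_ as_) w4 _] := h i.
    case: leqP w4 => iq; last by move=> ->.
    by case=> _ _ b3 _; exact: sym_adj.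
  - have [_ _ _ /(_ as_) w4 _] := h i.
    case: leqP w4 => iq; last by move=> -> s1 x y s2; rewrite -[RHS]/(- (0 : C)) oppr0.
    by case=> _ /(_ bs)[_ x2 _] _ _; exact: anti_adj.
  - by have [_ _ w3 _ _] := h i.
  - have [_ _ _ /(_ as_) w4 _] := h i.
    case: leqP w4 => iq; last by move=> -> s1 s2 k x y; rewrite scaler0 addr0.
    by case.
  - have [_ _ _ /(_ as_) w4 _] := h i.
    case: leqP w4 => iq; last by move=> -> s1 s2 k x y; rewrite scaler0 addr0.
    by case=> _ /(_ bs)[].
  - by have [_ _ _ _ w5] := h i.
split=> //.
- move=> as_ e; apply/funext => bs; apply/funext => xs; by apply: h1 => -[/e].
- exact: adj_antiP.
- move=> as_; case: leqP => iq.
    split=> [bs e|bs||//]; last exact: adj_symP.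
      by apply/funext => xs; apply: h1 => -[_ /e].
    split=> [xs e||//]; last exact: adj_antiP.
    by apply: h1 => -[_ _ e']; apply: e; rewrite -e' addKn.
  apply/funext => bs; apply/funext => xs; apply: h1 => -[_ _ e].
  by rewrite -e ltnNge leq_addr in iq.
Qed.

Lemma multi_add (S : Type) (K : pzRingType) (phi : S -> K) one (T V : lmodType K)
    (F : seq T -> V) s1 s2 x y : phi one = 1 -> multilinear phi F ->
  F (s1 ++ (x + y) :: s2) = F (s1 ++ x :: s2) + F (s1 ++ y :: s2).
Proof. by move=> h1 h; have := h s1 s2 one x y; rewrite h1 !scale1r. Qed.

Lemma multi_scale (K : pzRingType) (T V : lmodType K)
    (F : seq T -> V) s1 s2 f x : multilinear id F ->
  F (s1 ++ (f *: x) :: s2) = f *: F (s1 ++ x :: s2).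
Proof.
move=> h; have h0 : F (s1 ++ 0 :: s2) = 0.
  have := multi_add s1 s2 0 0 (erefl : id 1 = 1) h; rewrite addr0 => e.
  by apply: (addrI (F (s1 ++ 0 :: s2))); rewrite -e addr0.
by have := h s1 s2 f x 0; rewrite h0 !addr0.
Qed.

(** With the factor k!, the polarized derivative becomes the contraction by a
    letter [Be], and products of polynomial functions become the product of
    superfunctions, whose binomial coefficients are k! / (i! j!). *)
Definition normalized c : seq Gamma -> seq Gamma -> seq (vfield M) -> C :=
  fun as_ bs xs => (c (size bs) as_ bs xs : C) *+ (size bs)`!.
(** The function on words associated with a cochain. *)
Definition hat c : fn := spread (normalized c).

Lemma hat_nword c as_ bs xs : hat c (nword as_ bs xs) = normalized c as_ bs xs.
Proof. exact: spread_nword. Qed.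

Lemma sform_hat p q c : is_weil p q c -> sform (hat c).
Proof.
move=> /is_weilP[h1 h2 h3 h4 h5 h6 h7 h8]; apply: sform_spread; rewrite /normalized.
- move=> s1 x y s2; apply/funext => bs; apply/funext => xs.
  by rewrite h2 -[LHS]/((- c (size bs) (s1 ++ [:: y, x & s2]) bs xs : C) *+ _) mulNrn.
- move=> as_ s1 x y s2; apply/funext => xs.
  by rewrite !size_cat /= h3.
- by move=> as_ bs s1 x y s2; rewrite h4 mulNrn.
- move=> s1 s2 a b bs xs; rewrite -mulrnDl; congr (_ *+ _).
  by rewrite (multi_add _ _ _ _ (cst1 M) (h5 _)).
- move=> as_ s1 s2 a b xs; rewrite !size_cat /= -mulrnDl; congr (_ *+ _).
  by rewrite (multi_add _ _ _ _ (erefl : id 1 = 1) (h6 _ _)).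
- move=> as_ bs s1 s2 a b; rewrite -mulrnDl; congr (_ *+ _).
  by rewrite (multi_add _ _ _ _ (erefl : id 1 = 1) (h7 _ _ _)).
Qed.

Lemma supp_hat p q c : is_weil p q c -> supp (p%:Z, q%:Z) (hat c).
Proof.
move=> /is_weilP h s; rewrite wts_count => ne; rewrite /hat /spread /normalized.
rewrite (wf_supp h) ?mul0rn ?signed0 // => -[e1 _ e3]; apply: ne.
by rewrite e1 e3.
Qed.

Lemma fct_mulrn (T : Type) (V : zmodType) (f : T -> V) m x : (f *+ m) x = f x *+ m.
Proof. by elim: m => [|m IH] //; rewrite !mulrS -IH. Qed.

Lemma wedge_mulrn r (w w' : Omega M) m xs : wedge r w (w' *+ m) xs = wedge r w w' xs *+ m.
Proof.
rewrite /wedge /shuffle_sum -sumrMnl; apply: eq_bigr => s _.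
rewrite (@fct_mulrn _ C^o) !signzE.
by case: (odd_perm s); rewrite /= mulrnAr ?mulNrn.
Qed.

Lemma wedge_scale r (w w' : Omega M) (f : C) xs :
  wedge r w (fun u => f * w' u : C) xs = f * (wedge r w w' xs : C).
Proof.
rewrite /wedge /shuffle_sum mulr_sumr; apply: eq_bigr => s _.
by rewrite !signzE; case: (odd_perm s); rewrite /= ?mulrN mulrCA.
Qed.

Lemma wedge_0r r (w : Omega M) xs : wedge r w (fun=> 0) xs = 0.
Proof. by apply: big1 => s _; rewrite mulr0 mul0rz. Qed.

Lemma vdiff_cst_Xi f xs : vdiff (sconst f) (map Xi xs) = dDR (form0 f) xs.
Proof.
rewrite vdiff_Xi; last exact: sform_cst.
rewrite /dDR; congr (koszul _ _ _ _); apply/funext => ys.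
by rewrite /sconst /form0 /nilp size_map.
Qed.

Lemma dcst_smul_nword f H as_ bs xs :
  smul (vdiff (sconst f)) H (nword as_ bs xs) =
  signed (odd (size as_)) (wedge 1 (dDR (form0 f)) (fun ys => H (nword as_ bs ys)) xs : C).
Proof.
elim: as_ H => [|a as_ IH] H; last first.
  by rewrite nword_Al pdA_dM fnN IH /=; case: (odd (size as_)); rewrite /= ?opprK.
elim: bs H => [|b bs IH] H /=; first last.
  by rewrite nword_Be pdB_dM IH.
rewrite /nword /= smul_Xi (all_shuffles_shuffle (a := 1)).
  by rewrite /wedge; apply: eq_shuffle_sum => u v; rewrite vdiff_cst_Xi.
move=> u v u1; rewrite (@supp_vdiff _ _ _ LX 0 0 (sconst f)) ?mul0r //.
  exact: supp_cst.
rewrite wts_count -[map Xi u]/(nword [::] [::] u) als_nword bes_nword xis_nword /= add0n.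
by rewrite add0r => -[e]; apply: u1.
Qed.

Lemma vdiff_cst_cst (k : R) : vdiff (sconst (cst k)) = 0.
Proof.
apply/fnP => -[|t s] //; rewrite (fn_cons (vdiff _)); case: t => c.
- by rewrite pdA_dcst.
- by rewrite pdB_dcst.
rewrite pdX_dcst /= lie_fun_cst.
by rewrite /sconst; case: nilp.
Qed.

Lemma signedMr b (f x : C) : signed b (f * x) = f * signed b x.
Proof. by case: b; rewrite /= ?mulrN. Qed.

(** The condition of [is_weil] singles out the last section argument, while
    [Al_leibniz] concerns the first; moving the letter produces the same sign
    in all terms. *)
Lemma weilfn_hat p q c : is_weil p q c -> weilfn (hat c).
Proof.
move=> wc; have gc := sform_hat wc; have /is_weilP[h1 h2 h3 h4 h5 h6 h7 h8] := wc.
split=> //.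
- move=> f b; apply/fnP => s; rewrite smul_cstl /pd /hat /spread /normalized /= -signedMr.
  congr signed; rewrite mulrnAr; congr (_ *+ _).
  by have := multi_scale [::] (bes s) f b (h6 (size (bes s)).+1 (als s)) => /= ->.
- move=> f x; apply/fnP => s; rewrite smul_cstl /pd /hat /spread /normalized /= -signedMr.
  congr signed; rewrite mulrnAr; congr (_ *+ _).
  exact: (multi_scale [::] (xis s) f x (h7 (size (bes s)) (als s) (bes s))).
move=> f a; apply: sform_ext => [||as_ bs xs]; first exact: sform_pd.
  apply: sformD; [|apply: sformN]; apply: sform_smul (@splits_par C Gamma (vfield M)) _ _ _ _;
  do ?[exact: sform_pd | exact: sform_cst | apply: sform_vdiff].
have E y : pd (Al y) (hat c) (nword as_ bs xs) = signed (odd (size as_))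
     (c (size bs) (rcons as_ y) bs xs *+ (size bs)`! : C).
  rewrite -nword_Al hat_nword /normalized; have := adj_anti_move y as_ [::] (h2 (size bs)).
  by rewrite cats0 cats1 => ->; case: (odd _) => //=; rewrite -mulNrn.
rewrite fnD fnN smul_cstl dcst_smul_nword !E h8 -signedMr -signedN -signedD.
congr signed; rewrite mulrnBl mulrnAr; congr (_ - _).
rewrite /wedgeS -wedge_mulrn; congr (wedge _ _ _ _); apply/funext => ys.
rewrite !(@fct_mulrn _ C^o) -[RHS]/(hat c (Be a :: nword as_ bs ys)).
have -> : hat c (Be a :: nword as_ bs ys) = hat c (nword as_ (a :: bs) ys).
  by rewrite /nword /= sform_move.
by rewrite hat_nword /normalized /= factS /partialS (@fct_mulrn _ C^o) -mulrnA.
Qed.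

Lemma cstD (r s : R) : cst (r + s) = cst r + cst s. Proof. exact/val_inj. Qed.
Lemma cstM (r s : R) : cst (r * s) = cst r * cst s. Proof. exact/val_inj. Qed.
Lemma cst0 : cst 0 = 0. Proof. exact/val_inj. Qed.
Lemma cst_nat m : cst m%:R = m%:R.
Proof. by elim: m => [|m IH]; rewrite ?cst0 // -natr1 cstD IH cst1 natr1. Qed.

Definition inv_nat m : C := cst m%:R^-1.

Lemma inv_natK m (f : C) : (0 < m)%N -> inv_nat m * (f *+ m) = f.
Proof.
move=> m0; rewrite -mulr_natl -cst_nat mulrA -cstM mulVf ?cst1 ?mul1r //.
by rewrite Num.Theory.pnatr_eq0 -lt0n.
Qed.

Lemma inv_natKl m (f : C) : (0 < m)%N -> (inv_nat m * f) *+ m = f.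
Proof. by move=> m0; rewrite -mulrnAr inv_natK. Qed.

Lemma inv_natM m k (f : C) : (0 < m)%N -> (0 < k)%N ->
  (inv_nat (m * k) * f) *+ m = inv_nat k * f.
Proof.
move=> m0 k0; rewrite /inv_nat natrM invfM cstM -mulrA -mulrnAr mulrnAr.
by rewrite -mulrnAr; exact: inv_natK.
Qed.

Definition unhat F : cochain A := fun k as_ bs xs =>
  if size bs == k then inv_nat k`! * F (nword as_ bs xs) else 0.

Lemma normalized_unhat F as_ bs xs : normalized (unhat F) as_ bs xs = F (nword as_ bs xs).
Proof. by rewrite /normalized /unhat eqxx inv_natKl // fact_gt0. Qed.

Lemma hatK F : sform F -> hat (unhat F) = F.
Proof.
by move=> gF; apply/fnP => s; rewrite [RHS]sform_sort // /hat /spread normalized_unhat.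
Qed.

Lemma unhatK p q c : is_weil p q c -> unhat (hat c) = c.
Proof.
move=> /is_weilP wc; apply/funext => k; apply/funext => as_; apply/funext => bs.
apply/funext => xs; rewrite /unhat; case: eqP => [e|ne].
  by rewrite hat_nword /normalized e inv_natK // fact_gt0.
by rewrite (wf_supp wc) // => -[_ /ne].
Qed.

Lemma sform_AlM F s1 a s2 bs xs : sform F ->
  F (nword (s1 ++ a :: s2) bs xs) =
  signed (odd (size s1)) (pd (Al a) F (nword (s1 ++ s2) bs xs)).
Proof.
move=> gF; rewrite /nword !map_cat /= -!catA /=.
rewrite -[pd _ _ _]/(F (Al a :: map Al s1 ++ (map Al s2 ++ map Be bs ++ map Xi xs))).
by rewrite sform_move // spar_Al /= signed_signed addbb.
Qed.

Lemma sform_BeM F as_ s1 b s2 xs : sform F ->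
  F (nword as_ (s1 ++ b :: s2) xs) = pd (Be b) F (nword as_ (s1 ++ s2) xs).
Proof.
move=> gF; set w1 := map Al as_ ++ map Be s1; set w2 := map Be s2 ++ map Xi xs.
have -> : nword as_ (s1 ++ b :: s2) xs = w1 ++ Be b :: w2.
  by rewrite /nword map_cat /= -!catA.
have -> : nword as_ (s1 ++ s2) xs = w1 ++ w2 by rewrite /nword map_cat -!catA.
by rewrite -[RHS]/(F (Be b :: w1 ++ w2)) sform_move.
Qed.

Lemma sform_XiM F as_ bs s1 x s2 : sform F ->
  F (nword as_ bs (s1 ++ x :: s2)) =
  signed (odd (size as_ + size s1)) (pd (Xi x) F (nword as_ bs (s1 ++ s2))).
Proof.
move=> gF; set w1 := map Al as_ ++ map Be bs ++ map Xi s1.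
have -> : nword as_ bs (s1 ++ x :: s2) = w1 ++ Xi x :: map Xi s2.
  by rewrite /nword map_cat /= -!catA.
have -> : nword as_ bs (s1 ++ s2) = w1 ++ map Xi s2 by rewrite /nword map_cat -!catA.
rewrite -[pd _ _ _]/(F (Xi x :: w1 ++ map Xi s2)) sform_move //.
by rewrite !spar_cat spar_Al spar_Be spar_Xi oddD /= signed_signed addbb.
Qed.

Lemma sform_nword_symB F as_ xs : sform F -> adj_sym (fun bs => F (nword as_ bs xs)).
Proof.
move=> [h _] s1 x y s2; rewrite /nword !map_cat /= -!catA /= !(catA (map Al as_)).
exact: h.
Qed.

Lemma sform_nword_antiX F as_ bs : sform F -> adj_anti (fun xs => F (nword as_ bs xs)).
Proof.
move=> [h _] s1 x y s2; rewrite /nword !map_cat /= !(catA (map Be bs)) !(catA (map Al as_)).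
exact: h.
Qed.

Lemma unhat_weilfn p q F : weilfn F -> supp (p%:Z, q%:Z) F -> is_weil p q (unhat F).
Proof.
move=> wF sF; have gF := weilfn_sform wF; apply/is_weilP; rewrite /unhat; split.
- move=> i as_ bs xs ne; case: eqP => // e; rewrite sF ?mulr0 //.
  rewrite wts_count als_nword bes_nword xis_nword => -[e1 e2].
  by apply: ne; rewrite -e.
- move=> k s1 x y s2; apply/funext => bs; apply/funext => xs.
  rewrite -[RHS]/(- (if size bs == k then inv_nat k`! * F (nword
    (s1 ++ [:: y, x & s2]) bs xs) else 0)).
  case: eqP => _; last by rewrite oppr0.
  by rewrite -mulrN; congr (_ * _); have := sform_Al_anti gF s1 x y s2 => /(congr1 (fun f =>
    f bs xs)).
- move=> i as_ s1 x y s2; apply/funext => xs; rewrite !size_cat /=.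
  by case: eqP => // _; rewrite sform_nword_symB.
- move=> i as_ bs s1 x y s2; case: eqP => _; last by rewrite oppr0.
  by rewrite -mulrN; congr (_ * _); exact: (sform_nword_antiX as_ bs gF).
- move=> k s1 s2 r x y; apply/funext => bs; apply/funext => xs.
  set l := LHS.
  rewrite -[RHS]/(cst r * (if size bs == k then inv_nat k`! * F (nword
    (s1 ++ x :: s2) bs xs) else 0)
    + (if size bs == k then inv_nat k`! * F (nword (s1 ++ y :: s2) bs xs) else 0)) /l.
  case: eqP => _; last by rewrite mulr0 addr0.
  rewrite !(sform_AlM _ _ _ _ _ gF) sform_AlD // (weilfn_Al wF) vdiff_cst_cst smul0l subr0.
  by rewrite fnD smul_cstl signedD signedMr mulrDr mulrCA.
- move=> k as_ s1 s2 f x y; apply/funext => xs; rewrite !size_cat /=.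
  set l := LHS.
  rewrite -[RHS]/(f * (if (size s1 + (size s2).+1)%N == k
    then inv_nat k`! * F (nword as_ (s1 ++ x :: s2) xs) else 0)
    + (if (size s1 + (size s2).+1)%N == k then inv_nat k`! * F (nword as_
      (s1 ++ y :: s2) xs) else 0)) /l.
  case: eqP => _; last by rewrite mulr0 addr0.
  rewrite !(sform_BeM _ _ _ _ _ gF) sform_BeD // (weilfn_Be wF).
  by rewrite fnD smul_cstl mulrDr mulrCA.
- move=> k as_ bs s1 s2 f x y; case: eqP => _; last by rewrite scaler0 addr0.
  rewrite !(sform_XiM _ _ _ _ _ gF) sform_XiD // (weilfn_Xi wF).
  by rewrite fnD smul_cstl signedD signedMr mulrDr mulrCA.
move=> k as_ f a; apply/funext => bs; apply/funext => xs; set l := LHS.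
rewrite -[RHS]/(f * (if size bs == k then inv_nat k`! * F (nword (rcons as_ a) bs xs) else 0)
  - wedge 1 (dDR (form0 f)) (((fun ys => if (size bs).+1 == k.+1 then
      inv_nat (k.+1)`! * F (nword as_ (a :: bs) ys) else 0) : Omega M) *+ (size bs).+1) xs) /l.
rewrite wedge_mulrn eqSS; case: eqP => [e|_]; last first.
  rewrite mulr0 sub0r (_ : wedge _ _ _ _ = 0) ?mul0rn ?oppr0 //.
  exact: wedge_0r.
rewrite wedge_scale e factS inv_natM // ?fact_gt0 // -!cats1 !(sform_AlM _ _ _ _ _ gF) !cats0.
rewrite (weilfn_Al wF) fnD fnN smul_cstl dcst_smul_nword signedD signedN signed_signed addbb /=.
rewrite signedMr mulrBr mulrCA; congr (_ - _); congr (_ * _).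
congr (wedge _ _ _ _); apply/funext => ys.
exact: (esym (sform_BeM as_ [::] a bs ys gF)).
Qed.

(** * Polarization *)
Section Polarization.

Lemma cvalMn (f : C) m (x : M) : (f *+ m : C) x = f x *+ m.
Proof. by elim: m => [|m IH] //; rewrite !mulrS -IH. Qed.

(** Evaluated at a point, a function of k equal even letters [Be (b + t a)] is
    polynomial in t by additivity.  Additivity alone reaches natural numbers t,
    which is enough as there are infinitely many of them. *)
Lemma polar_poly F k b a r (x : M) : sform F ->
  exists P : {poly R}, [/\ forall t : nat, (F (nseq k (Be (b + a *+ t)) ++ r) : C) x = P.[t%:R],
    P`_0 = (F (nseq k (Be b) ++ r) : C) x &
    P`_1 = (F (Be a :: nseq k.-1 (Be b) ++ r) : C) x *+ k].
Proof.
elim: k F => [|k IH] F gF.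
  exists ((F r : C) x)%:P; split=> [t||].
  - by rewrite hornerC.
  - by rewrite coefC.
  - by rewrite coefC mulr0n.
have [P1 [h1 h2 h3]] := IH _ (sform_pd (Be b) gF).
have [P2 [g1 g2 g3]] := IH _ (sform_pd (Be a) gF).
exists (P1 + 'X * P2); split=> [t||].
- rewrite hornerD hornerM hornerX -h1 -g1 /=.
  have E : forall s, F (Be (b + a *+ t) :: s) = F (Be b :: s) + F (Be a :: s) *+ t.
    move=> s; elim: t => [|t IHt]; first by rewrite mulr0n !addr0.
    rewrite mulrSr addrA -[LHS]/(pd (Be (b + a *+ t + a)) F s) sform_BeD // fnD /pd IHt.
    by rewrite mulrSr addrA.
  rewrite E -[LHS]/((pd (Be b) F _ : C) x + (pd (Be a) F _ *+ t : C) x) cvalMn.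
  by rewrite mulr_natl.
- by rewrite coefD coefXM /= addr0 h2.
rewrite coefD coefXM /= h3 g2 mulrSr; congr (_ + _).
case: k {IH h1 h2 h3 g1 g2 g3} => [|k] //=; congr (_ *+ _).
by rewrite -[pd _ _ _]/(pd (Be a) (pd (Be b) F) _) pdC.
Qed.

(** The polynomial vanishes at all natural numbers, hence so does its linear
    coefficient, and k + 1 is invertible. *)
Lemma polar_step F k b a r : sform F ->
  (forall b', F (nseq k.+1 (Be b') ++ r) = 0) -> F (Be a :: nseq k (Be b) ++ r) = 0.
Proof.
move=> gF h; apply/val_inj/funext => x.
have [P [h1 _ h3]] := polar_poly k.+1 b a r x gF.
have P0 : P = 0.
  apply/eqP; apply: contraT => nP.
  (* A nonzero polynomial has fewer than [size P] roots, and the first natural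
     numbers are that many. *)
  have := @max_poly_roots R P [seq i%:R | i <- iota 0 (size P)] nP.
  rewrite size_map size_iota ltnn => -> //.
    apply/allP => _ /mapP[t _ ->]; rewrite rootE -h1 h; exact/eqP.
  rewrite map_inj_uniq ?iota_uniq // => i j /eqP.
  by rewrite Num.Theory.eqr_nat => /eqP.
move: h3; rewrite P0 coef0 => /esym/eqP.
by rewrite Num.Theory.mulrn_eq0 /= => /eqP.
Qed.

(** By induction on the number of letters [Be] outside a block of equal ones:
    [polar_step] lets one letter of the block become arbitrary. *)
Lemma polar F H : sform F -> sform H ->
  (forall as_ k a xs, F (nword as_ (nseq k a) xs) = H (nword as_ (nseq k a) xs)) -> F = H.
Proof.
move=> gF gH h; apply/eqP; rewrite -subr_eq0; apply/eqP.
have gD : sform (F - H) by apply: sformD => //; exact: sformN.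
apply: sform_ext => // [|as_ bs xs]; first exact: sform0.
suff E : forall m b, (F - H) (map Al as_ ++ map Be bs ++ nseq m (Be b) ++ map Xi xs) = 0.
  exact: (E 0%N 0).
elim: bs => [|a bs IH] m b.
  by rewrite /= -map_nseq -/(nword as_ (nseq m b) xs) fnD fnN h subrr.
have E b' : (F - H) (map Al as_ ++ map Be bs ++ nseq m.+1 (Be b') ++ map Xi xs) = 0 by [].
have gE := sform_app (map Be bs) (sform_app (map Al as_) gD).
rewrite -[RHS](polar_step b a gE E).
by rewrite /= (sform_move (Be a) (map Be bs) _ (sform_app (map Al as_) gD)).
Qed.

End Polarization.

(** * The operations of the Weil algebra *)
Section Operations.
Local Notation W := (W A).

Lemma signed_mulrn (V : zmodType) b (x : V) m : signed b x *+ m = signed b (x *+ m).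
Proof. by case: b; rewrite /= ?mulNrn. Qed.

Lemma wvalP p q (c : W p q) : is_weil p q (wval c).
Proof. exact: set_mem (valP c). Qed.

Definition hatW p q (c : W p q) : fn := hat (wval c).
Lemma weilfn_hatW p q (c : W p q) : weilfn (hatW c).
Proof. exact: weilfn_hat (wvalP c). Qed.
Lemma sform_hatW p q (c : W p q) : sform (hatW c).
Proof. exact: sform_hat (wvalP c). Qed.
Lemma supp_hatW p q (c : W p q) : supp (p%:Z, q%:Z) (hatW c).
Proof. exact: supp_hat (wvalP c). Qed.
Lemma hatW_diag p q (c : W p q) as_ k a xs :
  hatW c (nword as_ (nseq k a) xs) = (ev (wval c) k as_ a xs : C) *+ k`!.
Proof. by rewrite /hatW hat_nword /normalized size_nseq. Qed.

Lemma hatW_inj p q p' q' (c : W p q) (c' : W p' q') :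
  hatW c = hatW c' -> wval c = wval c'.
Proof. by move=> e; rewrite -(unhatK (wvalP c)) -(unhatK (wvalP c')) -/(hatW c) e. Qed.

Definition ofW p q F (wF : weilfn F) (sF : supp (p%:Z, q%:Z) F) : W p q :=
  MkW (mem_set (unhat_weilfn wF sF)).
Lemma hatW_of p q F (wF : weilfn F) (sF : supp (p%:Z, q%:Z) F) : hatW (ofW wF sF) = F.
Proof. exact: hatK (weilfn_sform wF). Qed.

Lemma hatW_D p q (c c' : W p q) : hatW (c + c') = hatW c + hatW c'.
Proof.
apply/fnP => s; rewrite fnD /hatW /hat /spread /normalized -signedD -mulrnDl.
by [].
Qed.
Lemma hatW_Z p q (k : R) (c : W p q) : hatW (cst k *: c) = smul (sconst (cst k)) (hatW c).
Proof.
apply/fnP => s; rewrite smul_cstl /hatW /hat /spread /normalized -signedMr; congr signed.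
by rewrite mulrnAr.
Qed.
Lemma hatW_0 p q : hatW (0 : W p q) = 0.
Proof. by apply/fnP => s; rewrite /hatW /hat /spread /normalized mul0rn signed0. Qed.

Lemma supp_neq F (p q : nat) as_ bs xs : supp (p%:Z, q%:Z) F ->
  (size as_ + size bs)%N <> p -> F (nword as_ bs xs) = 0.
Proof.
by move=> sF ne; apply: sF; rewrite wts_count als_nword bes_nword xis_nword => -[/ne].
Qed.

Lemma factn_inj k (f g : C) : f *+ k`! = g *+ k`! -> f = g.
Proof. by move=> e; rewrite -(inv_natK f (fact_gt0 k)) e inv_natK // fact_gt0. Qed.

Lemma lie_funMn X m (f : C) : lie_fun X (f *+ m) = lie_fun X f *+ m.
Proof. by rewrite (morph_mulrn (f := lie_fun X)) // => u v; exact: lie_funD. Qed.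

(** The contribution of c_(k-1) carries k (k-1)! = k!, the same factor as that of
    c_k. *)
Lemma vdiff_diag p q (c : W p q) as_ k a xs : (size as_ + k)%N = p ->
  vdiff (hatW c) (nword as_ (nseq k a) xs) =
  (((dDR (ev (wval c) k as_ a) + ev_pred (wval c) k (rcons as_ a) a) *~ (-1) ^+ (p - k)
     : Omega M) xs : C) *+ k`!.
Proof.
move=> e; rewrite vdiff_nword; last exact: sform_hatW.
have -> : (p - k)%N = size as_ by rewrite -e addnK.
rewrite signnE [X in _ = X *+ _]signed_fn [RHS]signed_mulrn.
congr signed; rewrite -[in RHS]/((dDR (ev (wval c) k as_ a) xs : C) + ev_pred (wval c) k
  (rcons as_ a) a xs).
rewrite mulrnDl; congr (_ + _).
  have mD : {morph (fun x : C => x *+ k`!) : x y / x + y} by move=> x y; exact: mulrnDl.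
  have -> : (fun ys => hatW c (nword as_ (nseq k a) ys)) =
      (fun ys => (ev (wval c) k as_ a ys : C) *+ k`!).
    by apply/funext => ys; rewrite hatW_diag.
  exact: esym (koszul_morph mD _ _ _ (fun X f => esym (lie_funMn X k`! f))).
case: k e => [|k] e; first by rewrite mulr0n mul0rn.
by rewrite hatW_diag /= factS mulnC mulrnA.
Qed.

(** From left to right, the given values on words with equal letters [Be] determine
    the function by polarization; in degrees other than the prescribed one both
    sides vanish. *)
Lemma is_dvP p q (c : W p q) (d : W p q.+1) : is_dv c d <-> hatW d = vdiff (hatW c).
Proof.
have gd : sform (vdiff (hatW c)) by apply: sform_vdiff; exact: sform_hatW.
have sd : supp (p%:Z, q.+1%:Z) (vdiff (hatW c)).
  by rewrite -addn1 PoszD; apply: supp_vdiff; exact: supp_hatW.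
split=> [h|h].
  apply: polar => //; first exact: sform_hatW.
  move=> as_ k a xs; have [e|/eqP e] := eqVneq (size as_ + k)%N p.
    by rewrite vdiff_diag // hatW_diag h.
  by rewrite (supp_neq _ (supp_hatW d)) ?(supp_neq _ sd) ?size_nseq.
move=> k as_ a e; apply/funext => xs; apply: (@factn_inj k).
by rewrite -hatW_diag h vdiff_diag.
Qed.

Lemma lie_formD X : {morph @lie_form R n M X : u v / u + v}.
Proof. by apply: lie_derD => u v; exact: lie_funD. Qed.

Lemma lie_formSD a : {morph @lie_formS R n M A a : P Q / P + Q}.
Proof. apply: lie_derD => u v; exact: lie_formD. Qed.

(** In [lieFS], the superfunction combines all the c_k, whereas [deltaS] treats one
    of them; Lie derivatives preserve the number of arguments, which
    separates the components. *)
Definition restr k (P : OmegaS A) : OmegaS A := fun bs => if size bs == k then P bs else 0.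

Lemma restrD k : {morph restr k : P Q / P + Q}.
Proof.
move=> P Q; apply/funext => bs; rewrite -[RHS]/(restr k P bs + restr k Q bs) /restr.
by case: eqP => _ //; rewrite addr0.
Qed.

Lemma restr_lie k a P : restr k (lie_formS a P) = lie_formS a (restr k P).
Proof.
apply/funext => bs; rewrite /restr /lie_formS /lie_der /=.
have E (j : 'I_(size bs)) : size (set_nth a bs j (lbracket a (tnth (in_tuple bs) j))) = size bs.
  by rewrite size_set_nth; apply/maxn_idPr; exact: ltn_ord.
case: eqP => e.
  by congr (_ - _); apply: eq_bigr => j _; case: eqP; rewrite E.
rewrite big1 ?subr0; last by move=> j _; rewrite E; case: eqP.
exact: esym (morph_add0 (lie_formD _)).
Qed.

Lemma deltaS_diag p q (c : W p q) as_ k a xs :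
  koszul (brk LG) (lieFS LG LX (@anchor R n M A))
    (fun as_ bs xs => hatW c (nword as_ bs xs) : C) as_ (nseq k a) xs
  = (deltaS (wval c k) as_ (nseq k a) xs : C) *+ k`!.
Proof.
set P := (fun as_ bs xs => hatW c (nword as_ bs xs) : C).
have E : restr k (koszul (brk LG) (lieFS LG LX (@anchor R n M A)) P as_) =
    deltaS (wval c k) as_ *+ k`!.
  have mD : {morph (fun Q : OmegaS A => Q *+ k`!) : x y / x + y}.
    by move=> x y; exact: mulrnDl.
  have mL x (Q : OmegaS A) : lie_formS x Q *+ k`! = lie_formS x (Q *+ k`!).
    exact: esym (morph_mulrn (@lie_formSD x) _ _).
  have EQ : (fun us => restr k (P us)) = (fun us => wval c k us *+ k`!).
    apply/funext => us; apply/funext => bs; apply/funext => ys.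
    rewrite fct_mulrn (@fct_mulrn _ C^o) /restr /P; case: eqP => e.
      by rewrite /hatW hat_nword /normalized e.
    have /is_weilP wc := wvalP c.
    by rewrite (wf_supp wc) ?mul0rn // => -[_ /e].
  rewrite (koszul_morph (@restrD k) _ _ _ (restr_lie k)) EQ.
  exact: esym (koszul_morph mD _ _ _ mL).
have := congr1 (fun f : OmegaS A => f (nseq k a) xs) E.
by rewrite /restr size_nseq eqxx fct_mulrn (@fct_mulrn _ C^o).
Qed.

Lemma hdiff_diag p q (c : W p q) as_ k a xs : (size as_ + k)%N = p.+1 ->
  hdiff (hatW c) (nword as_ (nseq k a) xs) =
  ((deltaS (wval c k) as_ (nseq k a)
    + Defs.contract (anchor a) (ev_pred (wval c) k as_ a) *~ (-1) ^+
      (p + k) : Omega M) xs : C) *+ k`!.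
Proof.
move=> e; rewrite hdiff_nword; last exact: sform_hatW.
rewrite deltaS_diag signnE.
have -> : odd (p + k) = ~~ odd (size as_).
  have := congr1 odd e; rewrite !oddD /=.
  by case: (odd (size as_)); case: (odd k); case: (odd p).
have E2 (u v : Omega M) : (u + v) xs = (u xs : C) + v xs by [].
rewrite E2 {E2} [RHS]mulrnDl; congr (_ + _).
rewrite [X in _ = X *+ _]signed_fn [RHS]signed_mulrn.
have -> b (x : C) : signed (~~ b) x = - signed b x by case: b; rewrite /= ?opprK.
congr (- signed _ _).
case: k e => [|k] e; first by rewrite mulr0n mul0rn.
by rewrite hatW_diag /= factS mulnC mulrnA.
Qed.

Lemma is_dhP p q (c : W p q) (d : W p.+1 q) : is_dh c d <-> hatW d = hdiff (hatW c).
Proof.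
have gd : sform (hdiff (hatW c)) by apply: (sform_hdiff (anchorP A)); exact: sform_hatW.
have sd : supp (p.+1%:Z, q%:Z) (hdiff (hatW c)).
  by rewrite -addn1 PoszD; apply: supp_hdiff; exact: supp_hatW.
split=> [h|h].
  apply: polar => //; first exact: sform_hatW.
  move=> as_ k a xs; have [e|/eqP e] := eqVneq (size as_ + k)%N p.+1.
    by rewrite hdiff_diag // hatW_diag h.
  by rewrite (supp_neq _ (supp_hatW d)) ?(supp_neq _ sd) ?size_nseq.
move=> k as_ a e; apply/funext => xs; apply: (@factn_inj k).
by rewrite -hatW_diag h hdiff_diag.
Qed.

(** Outside the degrees where c_i and c'_(k-i) are supported both sides vanish,
    so the signs may be compared in these degrees, where the truncated
    differences in the exponent are the numbers of letters. *)
Lemma smul_diag p q p' q' (c : W p q) (c' : W p' q') as_ k a xs :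
  smul (hatW c) (hatW c') (nword as_ (nseq k a) xs) =
  ((\sum_(i < k.+1)
      shuffle_sum (p - i) (fun us vs =>
        wedge (q - i) (ev (wval c) i us a) (ev (wval c') (k - i) vs a)) as_
      *~ (-1) ^+ ((q - i) * (p' - (k - i))) : Omega M) xs : C) *+ k`!.
Proof.
have /is_weilP wc := wvalP c; have /is_weilP wc' := wvalP c'.
have mD m : {morph (fun x : C => x *+ m) : x y / x + y} by move=> x y; exact: mulrnDl.
have sD b : {morph (fun x : C => signed b x) : x y / x + y} by move=> x y; exact: signedD.
rewrite smul_nword (@fct_sumE _ _ C^o) -sumrMnl; apply: eq_bigr => i _.
rewrite signnE signed_fn shuffle_sum_fun -(@all_shuffles_shuffle _ C^o); last first.
  move=> u v ne; apply: big1 => s _.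
  have -> : ev (wval c) i u a (take (q - i) (permute xs s)) = 0.
    by apply: (wf_supp wc) => -[e _ _]; apply: ne; rewrite -e addnK.
  by rewrite mul0r mul0rz.
rewrite [X in _ = X *+ _](all_shuffles_morph (sD _)) [RHS](all_shuffles_morph (mD _)).
apply: eq_all_shuffles => u v; rewrite /wedge -(@all_shuffles_shuffle _ C^o); last first.
  move=> y z ne; rewrite /ev (wf_supp wc) ?mul0r // => -[_ _ e]; apply: ne.
  by rewrite -e addKn.
rewrite [X in _ = X *+ _](all_shuffles_morph (sD _)) [RHS](all_shuffles_morph (mD _)).
rewrite [LHS](all_shuffles_morph (mD _)).
apply: eq_all_shuffles => y z; rewrite !hatW_diag.
have ik : (i <= k)%N by rewrite -ltnS.
have [e1|/eqP ne] := eqVneq (i + size y)%N q; last first.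
  have -> : ev (wval c) i u a y = 0 by apply: (wf_supp wc) => -[_ _ /ne].
  by rewrite !mul0rn !mul0r !signed0 !mul0rn.
have [e2|/eqP ne] := eqVneq (size v + (k - i))%N p'; last first.
  have -> : ev (wval c') (k - i) v a z = 0 by apply: (wf_supp wc') => -[/ne].
  by rewrite !mul0rn !mulr0 !signed0 !mul0rn.
have -> : (q - i)%N = size y by rewrite -e1 addKn.
have -> : (p' - (k - i))%N = size v by rewrite -e2 addnK.
rewrite oddM andbC.
rewrite mulrnAl mulrnAr [LHS]signed_mulrn [RHS]signed_mulrn.
congr signed; rewrite -!mulrnA; congr (_ *+ _).
by rewrite -(bin_fact ik) mulnA mulnC (mulnC (k - i)`!).
Qed.

Lemma is_mulP p q p' q' (c : W p q) (c' : W p' q') (d : W (p + p') (q + q')) :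
  is_mul c c' d <-> hatW d = smul (hatW c) (hatW c').
Proof.
have gd : sform (smul (hatW c) (hatW c')).
  by apply: sform_smul (@splits_par C Gamma (vfield M)) _ _ _ _; exact: sform_hatW.
have sd : supp ((p + p')%N%:Z, (q + q')%N%:Z) (smul (hatW c) (hatW c')).
  rewrite !PoszD; exact: (supp_smul _ (supp_hatW c) (supp_hatW c')).
split=> [h|h].
  apply: polar => //; first exact: sform_hatW.
  move=> as_ k a xs; have [e|/eqP e] := eqVneq (size as_ + k)%N (p + p')%N.
    by rewrite smul_diag hatW_diag h.
  by rewrite (supp_neq _ (supp_hatW d)) ?(supp_neq _ sd) ?size_nseq.
move=> k as_ a e; apply/funext => xs; apply: (@factn_inj k).
by rewrite -hatW_diag h smul_diag.
Qed.

Definition vdiffW p q (c : W p q) : W p q.+1.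
Proof.
apply: (@ofW p q.+1 (vdiff (hatW c))).
  exact: weilfn_vdiff (weilfn_hatW c).
by rewrite -addn1 PoszD; apply: supp_vdiff; exact: supp_hatW.
Defined.

Definition hdiffW p q (c : W p q) : W p.+1 q.
Proof.
apply: (@ofW p.+1 q (hdiff (hatW c))).
  exact: weilfn_hdiff (anchorP A) _ (weilfn_hatW c).
by rewrite -addn1 PoszD; apply: supp_hdiff; exact: supp_hatW.
Defined.

Definition mulW p q p' q' (c : W p q) (c' : W p' q') : W (p + p') (q + q').
Proof.
apply: (@ofW _ _ (smul (hatW c) (hatW c'))).
  exact: weilfn_smul (weilfn_hatW c) (weilfn_hatW c').
by rewrite !PoszD; exact: (supp_smul _ (supp_hatW c) (supp_hatW c')).
Defined.

Definition unitW : W 0 0.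
Proof.
apply: (@ofW 0 0 (sconst 1)); first exact: weilfn_cst.
exact: supp_cst.
Defined.

Lemma hat_vdiff p q (c : W p q) : hatW (vdiffW c) = vdiff (hatW c).
Proof. exact: hatW_of. Qed.
Lemma hat_hdiff p q (c : W p q) : hatW (hdiffW c) = hdiff (hatW c).
Proof. exact: hatW_of. Qed.
Lemma hat_smul p q p' q' (c : W p q) (c' : W p' q') :
  hatW (mulW c c') = smul (hatW c) (hatW c').
Proof. exact: hatW_of. Qed.
Lemma hat_unit : hatW unitW = sconst 1.
Proof. exact: hatW_of. Qed.

Lemma hatW_eq p q (c c' : W p q) : hatW c = hatW c' -> c = c'.
Proof. by move=> e; apply/val_inj; exact: hatW_inj e. Qed.

Lemma hatD (c c' : cochain A) : hat (c + c') = hat c + hat c'.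
Proof.
by apply/fnP => s; rewrite fnD /hat /spread /normalized -signedD -mulrnDl.
Qed.
Lemma hatN (c : cochain A) : hat (- c) = - hat c.
Proof.
by apply/fnP => s; rewrite fnN /hat /spread /normalized -signedN -mulNrn.
Qed.
Lemma hat_signed b (c : cochain A) : hat (signed b c) = signed b (hat c).
Proof. by case: b => //; exact: hatN. Qed.

(** Elements of components indexed by equal bidegrees that are not convertible
    can only be compared as cochains; [hat] is injective on those that lie in
    one component. *)
Lemma hat_inj_derivation P Q (b : bool) (x y z : cochain A) :
  is_weil P Q x -> is_weil P Q y -> is_weil P Q z ->
  hat x = hat y + signed b (hat z) -> x = y + signed b z.
Proof.
move=> wx wy wz e.
have w : is_weil P Q (y + signed b z).
  have my : y \in weil_pred P Q by apply/mem_set; exact: wy.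
  have mz : z \in weil_pred P Q by apply/mem_set; exact: wz.
  have [_ cl] := weil_submod_closed A P Q.
  have := cl (signed b 1) z y mz my; rewrite addrC => /set_mem.
  by case: (b); rewrite /= ?scaleN1r ?scale1r.
rewrite -(unhatK wx) e -hat_signed -hatD; exact: unhatK w.
Qed.

End Operations.
End Comparison.

Theorem theorem3p4 (R : realType) (n : nat) (M : manifold R n)
    (A : lie_algebroid M) :
  exists (dv : forall p q : nat, W A p q -> W A p q.+1)
         (dh : forall p q : nat, W A p q -> W A p.+1 q)
         (mul : forall p q p' q' : nat,
            W A p q -> W A p' q' -> W A (p + p')%N (q + q')%N),
    [/\ forall (p q : nat) (c : W A p q) (d : W A p q.+1),
          is_dv c d <-> d = dv p q c,
        forall (p q : nat) (c : W A p q) (d : W A p.+1 q),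
          is_dh c d <-> d = dh p q c,
        forall (p q p' q' : nat) (c : W A p q) (c' : W A p' q')
            (d : W A (p + p')%N (q + q')%N),
          is_mul c c' d <-> d = mul p q p' q' c c'
      & bidifferential_bigraded_algebra dv dh mul].
Proof.
exists (@vdiffW R n M A), (@hdiffW R n M A), (@mulW R n M A); split.
- move=> p q c d; rewrite is_dvP; split=> [h|->]; last exact: hat_vdiff.
  by apply: hatW_eq; rewrite hat_vdiff.
- move=> p q c d; rewrite is_dhP; split=> [h|->]; last exact: hat_hdiff.
  by apply: hatW_eq; rewrite hat_hdiff.
- move=> p q p' q' c c' d; rewrite is_mulP; split=> [h|->]; last exact: hat_smul.
  by apply: hatW_eq; rewrite hat_smul.
have sv := @superder_vdiff _ (gsec A) _ (vfield_lie_rinehart M).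
have sh := @superder_hdiff _ _ _ (gsec_lie_rinehart A) (vfield_lie_rinehart M) (@anchor R n M A).
have vc k := vdiff_cst_cst A k.
have hc k : hdiff (gsec_lie_rinehart A) (vfield_lie_rinehart M) (@anchor R n M A)
    (sconst (cinf_cst M k)) = 0.
  apply/fnP => -[|t s] //; rewrite (fn_cons (hdiff _ _ _ _)).
  case: t => a; rewrite ?(pdA_hcst (anchorP A)) ?pdB_hcst ?pdX_hcst //=.
  by rewrite lie_fun_cst /sconst; case: nilp.
split.
- move=> p q p' q' k c1 c2 c'; apply: hatW_eq.
  by rewrite hatW_D hatW_Z !hat_smul hatW_D hatW_Z smulDl smulA.
- move=> p q p' q' k c c1 c2; apply: hatW_eq.
  by rewrite hatW_D hatW_Z !hat_smul hatW_D hatW_Z smulDr !smulA (smul_cstC _ _ (hatW c)).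
- move=> p q p' q' p'' q'' c c' c''; apply: hatW_inj.
  by rewrite !hat_smul smulA.
- exists (unitW A) => p q c; split; apply: hatW_inj; rewrite hat_smul hat_unit.
    exact: smul1l.
  exact: smul1r.
- move=> p q k c1 c2; apply: hatW_eq; rewrite hatW_D hatW_Z !hat_vdiff hatW_D hatW_Z.
  by rewrite (superderD sv) (superderM sv) vc smul0l add0r twist_cst.
- move=> p q k c1 c2; apply: hatW_eq; rewrite hatW_D hatW_Z !hat_hdiff hatW_D hatW_Z.
  by rewrite (superderD sh) (superderM sh) hc smul0l add0r twist_cst.
- move=> p q p' q' c c'; rewrite signnE.
  apply: (@hat_inj_derivation _ _ _ A (p + p') (q + q').+1).
  + exact: wvalP.
  + rewrite -addSn; exact: wvalP.
  + rewrite -addnS; exact: wvalP.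
  rewrite -/(hatW _) -/(hatW _) -/(hatW _) hat_vdiff !hat_smul !hat_vdiff (superderM sv).
  by rewrite (twist_supp (supp_hatW c)) smul_signedl.
- move=> p q p' q' c c'; rewrite signnE.
  apply: (@hat_inj_derivation _ _ _ A (p + p').+1 (q + q')).
  + exact: wvalP.
  + rewrite -addSn; exact: wvalP.
  + rewrite -addnS; exact: wvalP.
  rewrite -/(hatW _) -/(hatW _) -/(hatW _) hat_hdiff !hat_smul !hat_hdiff (superderM sh).
  by rewrite (twist_supp (supp_hatW c)) smul_signedl.
- move=> p q c; apply: hatW_eq; rewrite !hat_vdiff hatW_0.
  exact: vdiff_vdiff (sform_hatW c).
- move=> p q c; apply: hatW_eq; rewrite !hat_hdiff hatW_0.
  exact: hdiff_hdiff (anchorP A) _ (sform_hatW c).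
move=> p q c; apply: hatW_eq; rewrite hatW_D hat_vdiff !hat_hdiff hat_vdiff hatW_0.
exact: vdiff_hdiff (anchorP A) _ (sform_hatW c).
Qed.
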